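(* Consider the scheduling policy that uses $$\hat r_s(k)=\frac{N_s(k)}{N_s(k)+N_f(k)},\qquad \theta^\star(\hat r_s(k))=\Big\lfloor\frac1{\hat r_s(k)b}-\frac1{\hat r_s(k)}\Big\rfloor,\qquad r_{\theta^\star}(\hat r_s(k))=\theta^\star(\hat r_s(k))+1+\frac{b-1}{b\,\hat r_s(k)},$$ where $N_s(k)$ and $N_f(k)$ are the numbers of successful and failed transmissions at time $k$, and which at time $k$ applies the randomized threshold policy with parameters $(\theta^\star(\hat r_s(k)),r_{\theta^\star}(\hat r_s(k)))$. This scheduling policy converges almost surely to the optimal policy for Problem 2, i.e. for $\inf_{f\in\mathbb F:\,J_r(f)\le b}J_e(f)$. Moreover, the average estimation error also converges almost surely to the optimal average estimation error.
   Context: System: $x(k+1)=Ax(k)+w(k)$, $y(k)=Cx(k)+v(k)$, with mutually independent $w(k)\sim\mathcal N(0,\Sigma_w)$, $v(k)\sim\mathcal N(0,\Sigma_v)$, $x(0)\sim\mathcal N(0,\Pi)$; $\Sigma_w,\Pi$ positive semidefinite, $\Sigma_v$ positive definite, $(A,C)$ detectable, $(A,\sqrt{\Sigma_w})$ stabilizable. A sensor runs a Kalman filter, assumed to be in steady state, with steady-state error covariance $\overline P$, and may send its estimate over a packet-dropping channel to a remote estimator. If $\tau$ is the time elapsed since the last successful transmission, the remote error covariance is $P(0)=\overline P$ and $P(\tau)=A^\tau\overline P(A^\top)^\tau+\sum_{t=0}^{\tau-1}A^t\Sigma_w(A^\top)^t$ for $\tau\ge1$. Scheduling: the state is $\tau(k)\in\mathbb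 N=\{0,1,2,\dots\}$, $\tau(0)=0$; the action is $a(k)\in\{0,1\}$ ($1$ = transmit). Transmissions succeed independently with probability $r_s$, which is unknown to the scheduler: under $a=1$ the state moves from $\tau$ to $0$ with probability $r_s$ (success) and to $\tau+1$ with probability $1-r_s$ (failure); under $a=0$ it moves to $\tau+1$. An admissible policy $f=\{f_k\}_{k\ge0}\in\mathbb F$ is a sequence of mappings from the history to the transmission decision, $a(k)=f_k(\tau(0),\dots,\tau(k),a(0),\dots,a(k-1))$. The expected average estimation error is $J_e(f)=\limsup_T\frac1T\mathbb E^f[\sum_{k=0}^{T-1}\operatorname{Tr}P(\tau(k))\mid\tau(0)=0]$ and the expected average transmission rate is $J_r(f)=\limsup_T\frac1T\mathbb E^f[\sum_{k=0}^{T-1}a(k)\mid\tau(0)=0]$; $b$ is the communication budget. The randomized threshold policy with parameters $(\theta,r)$ does not transmit if $\tau<\theta$, transmits with probability $r$ if $\tau=\theta$, and transmits if $\tau>\theta$. When $r_s$ is known, the optimal policy for Problem 2 is the one with $\theta^\star=\lfloor\frac1{r_sb}-\frac1{r_s}\rfloor$ and $r_{\theta^\star}=\theta^\star+1+\frac{b-1}{br_s}$; the learning policy replaces $r_s$ by its maximum likelihood estimate $\hat r_s(k)$. Initialization: the sensor keeps transmitting until $N_s(k)=1$, which avoids $\hat r_s=0$ (for which the threshold would be defined to be infinity); after that the randomized threshold policy above is used while $r_s$ is being learned. *)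

(* Defs.v *)
From HB Require Import structures.
From mathcomp Require Import all_boot all_order all_algebra.
From mathcomp Require Import complex.
From mathcomp Require Import all_classical all_reals all_analysis.

Set Implicit Arguments.
Unset Strict Implicit.
Unset Printing Implicit Defensive.

Import Order.TTheory GRing.Theory Num.Theory.
Import numFieldNormedType.Exports.

Local Open Scope classical_set_scope.
Local Open Scope ring_scope.

Section LinearSystem.
Variable R : realType.

Definition psd (n : nat) (M : 'M[R]_n) : Prop :=
  M^T = M /\ forall v : 'cV[R]_n, 0 <= (v^T *m M *m v) 0 0.

Definition posdef (n : nat) (M : 'M[R]_n) : Prop :=
  M^T = M /\ forall v : 'cV[R]_n, v != 0 -> 0 < (v^T *m M *m v) 0 0.

Definition is_sqrtmx (n : nat) (S M : 'M[R]_n) : Prop :=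
  psd S /\ S *m S = M.

(* Complex eigenvalues: a real matrix may have none over R. *)
Definition schur_stable (n : nat) (M : 'M[R]_n) : Prop :=
  forall z : complex R,
    eigenvalue (map_mx (real_complex R) M) z -> `|z| < 1.

Definition detectable (n m : nat) (A : 'M[R]_n) (C : 'M[R]_(m, n)) : Prop :=
  exists L : 'M[R]_(n, m), schur_stable (A - L *m C).

Definition stabilizable (n p : nat) (A : 'M[R]_n) (B : 'M[R]_(n, p)) : Prop :=
  exists K : 'M[R]_(p, n), schur_stable (A - B *m K).

Definition predict_cov (n : nat) (A Sw X : 'M[R]_n) : 'M[R]_n :=
  A *m X *m A^T + Sw.

Definition update_cov (n m : nat) (C : 'M[R]_(m, n)) (Sv : 'M[R]_m)
    (X : 'M[R]_n) : 'M[R]_n :=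
  X - X *m C^T *m invmx (C *m X *m C^T + Sv) *m C *m X.

(* A posteriori covariance at time k, i.e. that of the estimate of x(k) given
   y(0), ..., y(k), with x(0) of covariance Pi. *)
Fixpoint kalman_cov (n m : nat) (A : 'M[R]_n) (C : 'M[R]_(m, n))
    (Sw : 'M[R]_n) (Sv : 'M[R]_m) (Pi : 'M[R]_n) (k : nat) : 'M[R]_n :=
  match k with
  | 0 => update_cov C Sv Pi
  | j.+1 => update_cov C Sv (predict_cov A Sw (kalman_cov A C Sw Sv Pi j))
  end.

Definition is_steady_state_cov (n m : nat) (A : 'M[R]_n) (C : 'M[R]_(m, n))
    (Sw : 'M[R]_n) (Sv : 'M[R]_m) (Pi Pbar : 'M[R]_n) : Prop :=
  forall i j, (fun k => kalman_cov A C Sw Sv Pi k i j) @ \oo --> Pbar i j.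

Definition remote_cov (n : nat) (A Sw Pbar : 'M[R]_n) (t : nat) : 'M[R]_n :=
  A ^+ t *m Pbar *m A^T ^+ t + \sum_(s < t) A ^+ s *m Sw *m A^T ^+ s.

End LinearSystem.

Section Scheduling.
Variable R : realType.

(* [f k s u] is the probability of transmitting at time k given the states
   s = (tau 0, ..., tau k) and the past actions u = (a 0, ..., a (k - 1)).
   Randomized decisions are needed for the randomized threshold policies to be
   policies; deterministic ones take their values in {0, 1}. *)
Definition policy : Type := forall k : nat, k.+1.-tuple nat -> k.-tuple bool -> R.

Definition admissible (f : policy) : Prop :=
  forall k (s : k.+1.-tuple nat) (u : k.-tuple bool), 0 <= f k s u <= 1.

Definition stationary (q : nat -> R) : policy := fun k s _ => q (tnth s ord_max).

Definition trans_prob (rs : R) (t : nat) (a : bool) (t' : nat) : R :=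
  if a then rs * (t' == 0%N)%:R + (1 - rs) * (t' == t.+1)%:R
  else (t' == t.+1)%:R.

Section Process.
Context {d : measure_display} {Omega : measurableType d}.
Variables (tau : nat -> Omega -> nat) (act : nat -> Omega -> bool).

Definition tau_hist (k : nat) (w : Omega) : k.+1.-tuple nat :=
  [tuple tau i w | i < k.+1].

Definition act_hist (k : nat) (w : Omega) : k.-tuple bool :=
  [tuple act i w | i < k].

Definition hist_event (k : nat) (s : k.+1.-tuple nat) (u : k.-tuple bool) :
    set Omega :=
  [set w | tau_hist k w = s /\ act_hist k w = u].

(* [P] is the law of the controlled process under the policy [f]: conditional
   probabilities are written in product form, so that histories of probability
   zero need no special treatment. *)
Definition is_policy_law (rs : R) (f : policy) (P : probability Omega R) : Prop :=
  [/\ P [set w | tau 0%N w = 0%N] = 1%E,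
      forall k (s : k.+1.-tuple nat) (u : k.-tuple bool),
        P (hist_event s u `&` [set w | act k w]) =
          ((f k s u)%:E * P (hist_event s u))%E &
      forall k (s : k.+1.-tuple nat) (u : k.-tuple bool) (a : bool) (t : nat),
        P (hist_event s u `&` [set w | act k w = a] `&` [set w | tau k.+1 w = t]) =
          ((trans_prob rs (tnth s ord_max) a t)%:E *
           P (hist_event s u `&` [set w | act k w = a]))%E].

(* Long-run averages for a cost-per-state [c] (the trace of the remote error
   covariance); [PP f] is the law under the policy [f]. *)
Variables (PP : policy -> probability Omega R) (c : nat -> R).

Definition avg_error (f : policy) : \bar R :=
  limn_esup (fun T : nat =>
    ((T%:R^-1)%:E * 'E_(PP f)[fun w => (\sum_(k < T) c (tau k w))%R])%E).

Definition avg_rate (f : policy) : \bar R :=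
  limn_esup (fun T : nat =>
    ((T%:R^-1)%:E * 'E_(PP f)[fun w => (\sum_(k < T) (act k w)%:R)%R])%E).

Definition feasible (b : R) : set policy :=
  [set f | admissible f /\ (avg_rate f <= b%:E)%E].

Definition optimal_error (b : R) : \bar R :=
  ereal_inf [set avg_error f | f in feasible b].

Definition optimal_policy (b : R) (f : policy) : Prop :=
  feasible b f /\ avg_error f = optimal_error b.

End Process.

Definition rand_threshold (theta : int) (r : R) (t : nat) : R :=
  if t%:Z < theta then 0 else if t%:Z == theta then r else 1.

Definition opt_threshold (b rs : R) : int := Num.floor (1 / (rs * b) - 1 / rs).

Definition opt_rand (b rs : R) : R :=
  (opt_threshold b rs)%:~R + 1 + (b - 1) / (b * rs).

Definition threshold_rule (b rs : R) : nat -> R :=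
  rand_threshold (opt_threshold b rs) (opt_rand b rs).

(* Transmissions made before time k; one made at time j succeeded iff
   tau (j + 1) = 0, since a failure leads to tau j + 1. *)
Definition nb_success (k : nat) (s : k.+1.-tuple nat) (u : k.-tuple bool) : nat :=
  (\sum_(j < k) (tnth u j && (tnth s (lift ord0 j) == 0)))%N.

Definition nb_failure (k : nat) (s : k.+1.-tuple nat) (u : k.-tuple bool) : nat :=
  (\sum_(j < k) (tnth u j && (tnth s (lift ord0 j) != 0)))%N.

Definition mle (ns nf : nat) : R := ns%:R / (ns%:R + nf%:R).

Definition learned_rule (b : R) (k : nat) (s : k.+1.-tuple nat)
    (u : k.-tuple bool) : nat -> R :=
  if nb_success s u == 0%N then fun=> 1
  else threshold_rule b (mle (nb_success s u) (nb_failure s u)).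

Definition learning_policy (b : R) : policy :=
  fun k s u => learned_rule b s u (tnth s ord_max).

End Scheduling.

(* Main.v *)
(* The tail probability P(tau >= t) of any policy of rate at most b is
   asymptotically bounded below by the sequence G with G(0) = 1 and
   G(t+1) = max((1 - rs) G(t), 1 - (t+1) rs b): a state is followed by its
   successor with probability at least 1 - rs, and no state is more frequent
   than 0, whose frequency is rs times the transmission rate.  Since the cost
   is nondecreasing in tau, this bounds the error of every feasible policy.

   The threshold rule is q(t) = min(1, max(0, t + 1 - (1/b - 1)/rs)), which is
   continuous in rs.  For every policy whose decision rule converges to q almost
   surely, a law of large numbers for martingale differences turns the dynamics
   into linear relations between the frequencies of the events tau >= t, whose
   only solution is G.  Under the learning policy the number of transmissions is
   unbounded, so the estimate of rs, hence the rule, converges.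

   The cost is unbounded, so the tails have to be controlled as well.  Its
   increments satisfy a linear recurrence; if the optimal error is finite, they
   are therefore O(la^t) for some la with (1 - rs) la < 1, while tau is
   eventually at most a constant plus the current number of consecutive failed
   transmissions, whose exponential moments of base la are bounded. *)
Require Import Defs.
From HB Require Import structures.
From mathcomp Require Import all_boot all_order all_algebra.
From mathcomp Require Import complex.
From mathcomp Require Import all_classical all_reals all_analysis.
From mathcomp Require Import measurable_realfun.
From mathcomp Require Import ring lra zify.

Set Implicit Arguments.
Unset Strict Implicit.
Unset Printing Implicit Defensive.

Import Order.TTheory GRing.Theory Num.Theory.
Import numFieldNormedType.Exports.

Local Open Scope classical_set_scope.
Local Open Scope ring_scope.

(** * Linear recurrences *)

Section SequenceLimits.
Variable R : realType.
Implicit Types (u v : nat -> R).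

(** The learning policy depends on the whole history, so the state is not a Markov chain and ergodic
    theorems for chains do not apply; this is why everything is phrased through frequencies of the
    events [t <= tau k]. They determine the error as well, since summation by parts writes a cost as
    [c 0] plus a combination of the indicators of [s.+1 <= tau] with nonnegative coefficients. The
    infinitely many linear relations close up because from a fixed state [t0] on the limit rule, and
    eventually every learned rule, equals 1: a single unknown is left, with a positive coefficient.

    Nothing ties the growth of the powers of [A] to [rs], so the optimal error may be [+oo]; then
    the lower bound alone gives divergence. If it is finite, [G(t) >= (1 - rs)^t] forces
    [(1 - rs)^t] times the increments of the cost to tend to 0, and a linearly recurrent sequence
    that tends to 0 does so exponentially fast. This yields the strict inequality [(1 - rs) la < 1],
    hence room for a slightly larger base with bounded moments. For [rs = 1] the factor [1 - rs]
    vanishes, and a small positive [p] takes its place. *)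

Lemma cvgn_sum (n : nat) (F : 'I_n -> nat -> R) (l : 'I_n -> R) :
  (forall i, F i @ \oo --> l i) ->
  (fun t => \sum_(i < n) F i t) @ \oo --> \sum_(i < n) l i.
Proof.
elim: n F l => [|n IH] F l H.
  rewrite big_ord0 (_ : (fun t => _) = fun=> 0); first exact: cvg_cst.
  by apply/funext => t; rewrite big_ord0.
rewrite big_ord_recr /=.
rewrite (_ : (fun t => _) = (fun t =>
    \sum_(i < n) F (widen_ord (leqnSn n) i) t) \+ F ord_max); last first.
  by apply/funext => t; rewrite big_ord_recr.
by apply: cvgD; [exact: (IH (fun i => F (widen_ord (leqnSn n) i))) | exact: H].
Qed.

Lemma limr_ge_seq u l x : u @ \oo --> l -> (forall n, x <= u n) -> x <= l.
Proof. by move=> ul xu; apply: (cvgr_to_ge ul); exact: nearW. Qed.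

End SequenceLimits.

Section LinearRecurrence.
Variable R : realType.

Lemma nzmx_power_recurrence (m : nat) (L : 'M[R]_m.+1) :
  exists a : 'I_m.+1 -> R, L ^+ m.+1 = \sum_(i < m.+1) a i *: L ^+ i.
Proof.
exists (fun i => - (char_poly L)`_i).
have := Cayley_Hamilton L.
have -> : horner_mx L (char_poly L) =
    \sum_(i < m.+2) (char_poly L)`_i *: L ^+ i.
  rewrite -[in LHS](coefK (char_poly L)) size_char_poly poly_def rmorph_sum /=.
  apply: eq_bigr => i _.
  by rewrite linearZ /= rmorphXn /= horner_mx_X.
rewrite big_ord_recr /=.
have -> : (char_poly L)`_m.+1 = 1.
  by move: (monicP (char_poly_monic L)); rewrite lead_coefE size_char_poly.
rewrite scale1r addrC => /eqP; rewrite addr_eq0 => /eqP ->.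
by rewrite -sumrN; apply: eq_bigr => i _; rewrite scaleNr.
Qed.

Lemma mx_power_recurrence (m : nat) (L : 'M[R]_m) :
  exists (N : nat) (a : 'I_N.+1 -> R), L ^+ N.+1 = \sum_(i < N.+1) a i *: L ^+ i.
Proof.
case: m L => [|m] L; last by exists m; exact: nzmx_power_recurrence.
by exists 0%N, (fun=> 0); apply/matrixP => -[].
Qed.

Definition recurrent (N : nat) (a : 'I_N -> R) (x : nat -> R) :=
  forall t, x (t + N)%N = \sum_(i < N) a i * x (t + i)%N.

Lemma recurrent_ext (N : nat) (a : 'I_N -> R) (x y : nat -> R) :
  recurrent a x -> recurrent a y -> (forall t, (t < N)%N -> x t = y t) ->
  x =1 y.
Proof.
move=> rx ry xy t; elim/ltn_ind: t => t IH.
have [tN|Nt] := ltnP t N; first exact: xy.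
rewrite -(subnK Nt) rx ry; apply: eq_bigr => i _; congr (_ * _); apply: IH.
by rewrite -[ltnRHS](subnK Nt) ltn_add2l.
Qed.

Lemma recurrent_shift (N : nat) (a : 'I_N -> R) (x : nat -> R) s :
  recurrent a x -> recurrent a (fun t => x (s + t)%N).
Proof. by move=> rx t; rewrite addnA rx; apply: eq_bigr => i _; rewrite addnA. Qed.

Definition window (N : nat) (x : nat -> R) t := \sum_(i < N) `|x (t + i)%N|.

(* The sequence is determined by its windows of length N, and every window is
   a combination of the first N ones, with coefficients controlled by the
   window; hence windows are submultiplicative up to a constant. *)
Lemma recurrent_window (N : nat) (a : 'I_N -> R) (x : nat -> R) :
  recurrent a x -> exists2 k : R, 0 <= k &
    forall t s, `|x (t + s)%N| <= k * window N x t * window N x s.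
Proof.
move=> rx.
pose h t : 'rV[R]_N := \row_i x (t + i)%N.
pose W : 'M[R]_N := \matrix_(j, i) x (j + i)%N.
have hW t : (h t <= W)%MS.
  elim/ltn_ind: t => t IH.
  have [tN|Nt] := ltnP t N.
    suff -> : h t = row (Ordinal tN) W by exact: row_sub.
    by apply/rowP => i; rewrite !mxE.
  have -> : h t = \sum_(i < N) a i *: h (t - N + i)%N.
    apply/rowP => i; rewrite summxE mxE -{1}(subnK Nt) addnAC rx.
    by apply: eq_bigr => j _; rewrite !mxE addnAC.
  apply: summx_sub => i _; apply: scalemx_sub; apply: IH.
  by rewrite -[ltnRHS](subnK Nt) ltn_add2l.
(* [W] may be singular; the pseudo-inverse selects coefficients that are linear in the window [h t],
   hence bounded by its norm. *)
pose al t := h t *m pinvmx W.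
have xal t s : x (t + s)%N = \sum_(j < N) al t 0 j * x (j + s)%N.
  move: s; apply: (@recurrent_ext N a (fun s => x (t + s)%N)).
  - exact: recurrent_shift.
  - move=> s; under eq_bigr do rewrite addnA rx mulr_sumr.
    rewrite exchange_big /=; apply: eq_bigr => i _; rewrite mulr_sumr.
    by apply: eq_bigr => j _; rewrite mulrCA addnA.
  - move=> s sN; have /rowP/(_ (Ordinal sN)) := mulmxKpV (hW t).
    by rewrite !mxE => <-; apply: eq_bigr => j _; rewrite !mxE.
exists (\sum_i \sum_j `|pinvmx W i j|).
  by apply: sumr_ge0 => i _; exact: sumr_ge0.
set k := \sum_i _ => t s.
rewrite xal; apply: (le_trans (ler_norm_sum _ _ _)).
rewrite /window mulr_sumr; apply: ler_sum => j _.
rewrite normrM addnC; apply: ler_wpM2r => //.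
rewrite mxE; apply: (le_trans (ler_norm_sum _ _ _)).
rewrite mulr_sumr; apply: ler_sum => i _.
rewrite [h t _ _]mxE normrM mulrC; apply: ler_wpM2r => //.
apply: (@le_trans _ _ (\sum_j0 `|pinvmx W i j0|)).
  by rewrite [leRHS](bigD1 j) //= lerDl sumr_ge0.
by rewrite /k [leRHS](bigD1 i) //= lerDl sumr_ge0 // => ? _; rewrite sumr_ge0.
Qed.

(** Submultiplicativity replaces any spectral argument: as the windows tend to 0, some shift [s] at
    least halves every window, and iterating it gives a geometric rate. *)
Lemma recurrent_exp_decay (N : nat) (a : 'I_N.+1 -> R) (x : nat -> R) :
  recurrent a x -> x @ \oo --> (0 : R) ->
  exists C mu : R, [/\ 0 <= C, 0 < mu < 1 & forall t, `|x t| <= C * mu ^+ t].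
Proof.
move=> rx x0; have [k k0 wk] := recurrent_window rx.
pose w := window N.+1 x.
have w_ge0 t : 0 <= w t by apply: sumr_ge0.
have xw t : `|x t| <= w t.
  by rewrite /w /window big_ord_recl /= addn0 lerDl sumr_ge0.
have xs0 i : `|x (t + i)%N| @[t --> \oo] --> (0 : R).
  rewrite (cvg_shiftn i (fun n => `|x n|)); exact/norm_cvg0P.
have wc : w @ \oo --> (0 : R).
  have := cvgn_sum (fun i : 'I_N.+1 => xs0 i).
  by rewrite big1 //; exact.
have wwc : (fun s => k * \sum_(i < N.+1) w (s + i)%N) @ \oo --> (0 : R).
  have ws0 (i : 'I_N.+1) : (fun s => w (s + i)%N) @ \oo --> (0 : R).
    by rewrite (cvg_shiftn i w).
  by have := cvgMl_tmp (a := k) (cvgn_sum ws0); rewrite big1 // mulr0; exact.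
have [s s0 ws] : exists2 s, (0 < s)%N & k * \sum_(i < N.+1) w (s + i)%N <= 2^-1.
  have /cvgrPdist_le /(_ (2^-1)) := wwc.
  rewrite invr_gt0 ltr0n => /(_ isT) [n _ Hn].
  exists n.+1 => //; have := Hn n.+1 (leqnSn n).
  by rewrite /= sub0r normrN => /(le_trans _); apply; exact: ler_norm.
have whalf t : w (s + t)%N <= 2^-1 * w t.
  have -> : w (s + t)%N = \sum_(i < N.+1) `|x (t + (s + i))%N|.
    by rewrite /w /window; apply: eq_bigr => i _; rewrite addnCA addnA.
  apply: (@le_trans _ _ (\sum_(i < N.+1) k * w t * w (s + i)%N)).
    by apply: ler_sum => i _; exact: wk.
  rewrite -mulr_sumr mulrAC; exact: ler_wpM2r.
(* A substitute for the [s]-th root of 1/2: Bernoulli's inequality gives [mu ^+ s >= 1/2]. *)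
pose mu : R := 1 - (2 * s%:R)^-1.
have s0R : 1 <= s%:R :> R by rewrite ler1n.
have mu01 : 0 < mu < 1.
  rewrite /mu; apply/andP; split; last by rewrite ltrBlDr ltrDl invr_gt0; lra.
  rewrite subr_gt0 invf_lt1; lra.
have mus : 2^-1 <= mu ^+ s.
  suff : forall n, 1 - n%:R * (2 * s%:R)^-1 <= mu ^+ n.
    move=> /(_ s); apply: le_trans.
    have -> : s%:R * (2 * s%:R)^-1 = 2^-1 :> R by field; lra.
    lra.
  elim => [|n IH]; first by rewrite mul0r subr0 expr0.
  rewrite exprS; apply: (le_trans _ (ler_wpM2l _ IH)); last lra.
  rewrite /mu -natr1; set y := (2 * s%:R)^-1.
  have : 0 <= n%:R * y * y.
    by rewrite !mulr_ge0 // invr_ge0 mulr_ge0.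
  nra.
(* Large enough for the first [s] windows; the halving propagates the bound to all others. *)
pose C := \sum_(i < s) w i / mu ^+ i.
have C_ge0 : 0 <= C.
  by apply: sumr_ge0 => i _; rewrite mulr_ge0 // invr_ge0 exprn_ge0 //; lra.
exists C, mu; split => // t; apply: (le_trans (xw t)).
elim/ltn_ind: t => t IH.
have [ts|st] := ltnP t s.
  rewrite -ler_pdivrMr; last by rewrite exprn_gt0; lra.
  rewrite /C (bigD1 (Ordinal ts)) //= lerDl sumr_ge0 // => i _.
  by rewrite mulr_ge0 // invr_ge0 exprn_ge0 //; lra.
rewrite -(subnKC st); apply: (le_trans (whalf _)).
have /IH H : (t - s < t)%N by rewrite ltn_subrL s0 (leq_trans s0).
rewrite exprD mulrCA; apply: (le_trans (ler_wpM2l _ H)); first lra.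
by apply: ler_wpM2r => //; rewrite mulr_ge0 // exprn_ge0 //; lra.
Qed.

Lemma recurrent_exp_growth (N : nat) (a : 'I_N -> R) (x : nat -> R) :
  recurrent a x -> exists C mu : R,
    [/\ 0 <= C, 1 <= mu & forall t, `|x t| <= C * mu ^+ t].
Proof.
move=> rx; pose mu : R := 1 + \sum_i `|a i|.
have S0 : 0 <= \sum_i `|a i| by exact: sumr_ge0.
have mu1 : 1 <= mu by rewrite lerDl.
pose C := \sum_(i < N) `|x i|.
have C0 : 0 <= C by exact: sumr_ge0.
exists C, mu; split => // t.
elim/ltn_ind: t => t IH.
have [tN|Nt] := ltnP t N.
  apply: (@le_trans _ _ C).
    by rewrite /C (bigD1 (Ordinal tN)) //= lerDl sumr_ge0.
  by rewrite ler_peMr // exprn_ege1.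
have [N0|N0] := posnP N.
  have := rx t; subst N; rewrite big_ord0 addn0 => ->.
  by rewrite normr0 mulr_ge0 // exprn_ge0 //; lra.
rewrite -{1}(subnK Nt) rx; apply: (le_trans (ler_norm_sum _ _ _)).
have t0 : (0 < t)%N := leq_trans N0 Nt.
apply: (@le_trans _ _ (\sum_i `|a i| * (C * mu ^+ t.-1))).
  apply: ler_sum => i _; rewrite normrM; apply: ler_wpM2l => //.
  have it : (t - N + i < t)%N by rewrite -[ltnRHS](subnK Nt) ltn_add2l.
  apply: (le_trans (IH _ it)); apply: ler_wpM2l => //.
  by rewrite ler_weXn2l // -ltnS prednK.
rewrite -mulr_suml -[in leRHS](prednK t0) exprS mulrCA.
apply: ler_wpM2l => //; apply: ler_wpM2r; first by rewrite exprn_ge0 //; lra.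
by rewrite lerDr.
Qed.

Lemma recurrent_scale (N : nat) (a : 'I_N -> R) (x : nat -> R) (p : R) :
  recurrent a x ->
  recurrent (fun i => a i * p ^+ (N - i)) (fun t => p ^+ t * x t).
Proof.
move=> rx t; rewrite rx mulr_sumr; apply: eq_bigr => i _.
have -> : (t + N = (t + i) + (N - i))%N by rewrite -addnA subnKC // ltnW.
by rewrite exprD; ring.
Qed.

Lemma recurrent_scale_cvg0 (N : nat) (a : 'I_N -> R) (x : nat -> R) :
  recurrent a x ->
  exists2 p : R, 0 < p < 1 & (fun t => p ^+ t * x t) @ \oo --> (0 : R).
Proof.
move=> /recurrent_exp_growth [C [mu [C0 mu1 H]]].
have mu0 : 0 < 2 * mu by lra.
exists (2 * mu)^-1.
  by rewrite invr_gt0 mu0 invf_lt1 //; lra.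
apply/norm_cvg0P.
apply: (@squeeze_cvgr _ _ _ _ (fun=> 0) (fun t => C * 2^-1 ^+ t)).
- near=> t; rewrite normr_ge0 /= normrM normrX ger0_norm ?invr_ge0 //; last lra.
  apply: (le_trans (ler_wpM2l _ (H t))).
    by rewrite exprn_ge0 // invr_ge0; lra.
  rewrite mulrCA -exprMn invfM -mulrA mulVf ?mulr1 //; lra.
- exact: cvg_cst.
- rewrite -[X in _ --> X](mulr0 C); apply: cvgMl_tmp; apply: cvg_expr.
  by rewrite ger0_norm ?invr_ge0 // invf_lt1 //; lra.
Unshelve. all: by end_near.
Qed.

(** The hypothesis only says that the increments are [o(p^-t)]; being recurrent after scaling, they
    are [O((mu/p)^t)] with [mu < 1], and this gain makes [p * la < 1] strict. *)
Lemma recurrent_sum_growth (N : nat) (a : 'I_N.+1 -> R) (c : nat -> R) (p : R) :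
  recurrent a (fun t => c t.+1 - c t) -> 0 < p < 1 ->
  (fun t => p ^+ t * (c t.+1 - c t)) @ \oo --> (0 : R) ->
  exists K la : R, [/\ 0 <= K, 1 < la, p * la < 1 & forall t, c t <= K * la ^+ t].
Proof.
move=> /(recurrent_scale p) rx p01 /(recurrent_exp_decay rx).
move=> [C [mu [C0 mu01 H]]].
have p0 : 0 < p by lra.
(* [nu] becomes [p * la]: it is below 1, above [mu] to absorb the decay rate, and above [p] so that
   [la > 1]. *)
pose nu := (1 + Num.max mu p) / 2.
have M0 : Num.max mu p < 1 by rewrite gt_max; apply/andP; split; lra.
have M1 : mu <= Num.max mu p by rewrite le_max lexx.
have M2 : p <= Num.max mu p by rewrite le_max lexx orbT.
have nu0 : 0 < nu by rewrite /nu; lra.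
pose la := nu / p.
have la1 : 1 < la by rewrite /la ltr_pdivlMr // /nu; lra.
have e t : c t.+1 - c t <= C * la ^+ t.
  have /(le_trans (ler_norm _)) := H t.
  rewrite mulrC -ler_pdivlMr ?exprn_gt0 // => /le_trans; apply.
  rewrite -mulrA; apply: ler_wpM2l => //.
  rewrite -expr_div_n lerXn2r ?nnegrE ?divr_ge0 //; try lra.
  by apply: ler_wpM2r; [rewrite invr_ge0|rewrite /nu]; lra.
(* Summing the increments [C * la ^+ t] as a geometric series produces [C / (la - 1)]. *)
pose K := `|c 0%N| + C / (la - 1).
have CK : 0 <= C / (la - 1) by rewrite divr_ge0 //; lra.
exists K, la; split => //.
- by rewrite addr_ge0.
- rewrite /la mulrC divfK ?gt_eqF // /nu; lra.
- move=> t; suff : c t <= `|c 0%N| + C / (la - 1) * la ^+ t.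
    move/le_trans; apply; rewrite /K mulrDl lerD2r.
    by rewrite ler_peMr // exprn_ege1 // ltW.
  elim: t => [|t IH]; first by rewrite expr0 mulr1; have := ler_norm (c 0%N); lra.
  have := e t; rewrite exprS.
  have -> : C / (la - 1) * (la * la ^+ t) = C / (la - 1) * la ^+ t + C * la ^+ t.
    by field; lra.
  lra.
Qed.

End LinearRecurrence.

(** * Error covariances *)

Section Covariance.
Variable R : realType.

(** [psd] without the symmetry: this form passes directly to entrywise limits and to differences of
    covariances, and it already gives a nonnegative trace. *)
Definition nneg_form (n : nat) (M : 'M[R]_n) :=
  forall v : 'cV[R]_n, 0 <= (v^T *m M *m v) 0 0.

Lemma nneg_form_conj (n p : nat) (B : 'M[R]_(p, n)) (M : 'M[R]_n) :
  nneg_form M -> nneg_form (B *m M *m B^T).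
Proof.
by move=> HM v; have := HM (B^T *m v); rewrite trmx_mul trmxK !mulmxA.
Qed.

Lemma nneg_formD (n : nat) (M N : 'M[R]_n) :
  nneg_form M -> nneg_form N -> nneg_form (M + N).
Proof. by move=> HM HN v; rewrite mulmxDr mulmxDl mxE addr_ge0. Qed.

Lemma nneg_form_trace (n : nat) (M : 'M[R]_n) : nneg_form M -> 0 <= \tr M.
Proof.
move=> HM; apply: sumr_ge0 => i _.
by have := HM (delta_mx i 0); rewrite trmx_delta -rowE -colE !mxE.
Qed.

Lemma psd_conj (n p : nat) (B : 'M[R]_(p, n)) (M : 'M[R]_n) :
  psd M -> psd (B *m M *m B^T).
Proof.
case=> Ms Mp; split; last exact: nneg_form_conj.
by rewrite !trmx_mul trmxK Ms mulmxA.
Qed.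

Lemma psdD (n : nat) (M N : 'M[R]_n) : psd M -> psd N -> psd (M + N).
Proof.
case=> Ms Mp [Ns Np]; split; last exact: nneg_formD.
by rewrite linearD /= Ms Ns.
Qed.

Lemma psd_posdefD (n : nat) (M N : 'M[R]_n) : psd M -> posdef N -> posdef (M + N).
Proof.
case=> Ms Mp [Ns Np]; split; first by rewrite linearD /= Ms Ns.
by move=> v v0; rewrite mulmxDr mulmxDl mxE ltr_wpDl // Np.
Qed.

Lemma posdef_psd (n : nat) (M : 'M[R]_n) : posdef M -> psd M.
Proof.
case=> Ms Mp; split=> // v; have [->|/Mp/ltW//] := eqVneq v 0.
by rewrite mulmx0 mxE.
Qed.

Lemma posdef_unit (n : nat) (M : 'M[R]_n) : posdef M -> M \in unitmx.
Proof.
case=> Ms Mp; rewrite -row_free_unit -kermx_eq0; apply/negPn/negP => /rowV0Pn[u].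
move=> /sub_kermxP uM u0; have := Mp u^T.
by rewrite trmxK uM mul0mx mxE ltxx trmx_eq0 => /(_ u0).
Qed.

Lemma psd_inv (n : nat) (M : 'M[R]_n) : posdef M -> psd (invmx M).
Proof.
move=> HM; have uM := posdef_unit HM; have [Ms Mp] := posdef_psd HM.
have -> : invmx M = invmx M *m M *m (invmx M)^T.
  by rewrite mulVmx // mul1mx trmx_inv Ms.
by apply: psd_conj.
Qed.

(** As [X] is symmetric, the correction that a measurement subtracts is a conjugate of the inverse
    of the innovation covariance, which is positive definite. *)
Lemma update_cov_le (n m : nat) (C : 'M[R]_(m, n)) (Sv : 'M[R]_m) (X : 'M[R]_n) :
  psd X -> posdef Sv -> nneg_form (X - update_cov C Sv X).
Proof.
move=> HX HSv; have HS : posdef (C *m X *m C^T + Sv).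
  by apply: psd_posdefD => //; exact: psd_conj.
have [_ HI] := psd_inv HS; have [Xs _] := HX.
have -> : X - update_cov C Sv X = (X *m C^T) *m invmx (C *m X *m C^T + Sv) *m (X *m C^T)^T.
  by rewrite /update_cov opprB addrC subrK trmx_mul trmxK Xs !mulmxA.
exact: nneg_form_conj.
Qed.

(* Joseph's form (1 - K C) X (1 - K C)^T + K Sv K^T of the updated covariance,
   with K the Kalman gain. *)
Lemma update_cov_psd (n m : nat) (C : 'M[R]_(m, n)) (Sv : 'M[R]_m) (X : 'M[R]_n) :
  psd X -> posdef Sv -> psd (update_cov C Sv X).
Proof.
move=> HX HSv; have HS : posdef (C *m X *m C^T + Sv).
  by apply: psd_posdefD => //; exact: psd_conj.
have uS := posdef_unit HS.
set S := C *m X *m C^T + Sv in HS uS.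
pose K := X *m C^T *m invmx S.
suff -> : update_cov C Sv X =
    (1%:M - K *m C) *m X *m (1%:M - K *m C)^T + K *m Sv *m K^T.
  by apply: psdD; apply: psd_conj => //; exact: posdef_psd.
have SvE : Sv = S - C *m X *m C^T by rewrite /S addrC addKr.
have KS : K *m S = X *m C^T by rewrite -mulmxA mulVmx // mulmx1.
have -> : update_cov C Sv X = X - K *m C *m X by [].
have TE : (1%:M - K *m C)^T = 1%:M - C^T *m K^T.
  by rewrite linearB /= trmx1 trmx_mul.
have -> : K *m Sv *m K^T = X *m C^T *m K^T - K *m C *m X *m C^T *m K^T.
  by rewrite [in LHS]SvE mulmxBr mulmxBl KS !mulmxA.
by rewrite TE mulmxBl mul1mx mulmxBr mulmx1 mulmxBl !mulmxA subrK.
Qed.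

Lemma kalman_cov_psd (n m : nat) (A : 'M[R]_n) (C : 'M[R]_(m, n))
    (Sw : 'M[R]_n) (Sv : 'M[R]_m) (Pi : 'M[R]_n) k :
  psd Sw -> psd Pi -> posdef Sv -> psd (kalman_cov A C Sw Sv Pi k).
Proof.
move=> HSw HPi HSv; elim: k => [|k IH] /=; apply: update_cov_psd => //.
by apply: psdD => //; exact: psd_conj.
Qed.

Lemma cvg_form (n : nat) (M : nat -> 'M[R]_n) (L : 'M[R]_n) (v : 'cV[R]_n) :
  (forall i j, (fun k => M k i j) @ \oo --> L i j) ->
  (fun k => (v^T *m M k *m v) 0 0) @ \oo --> (v^T *m L *m v) 0 0.
Proof.
move=> H.
have E (N : 'M[R]_n) :
    (v^T *m N *m v) 0 0 = \sum_(i < n) (\sum_(j < n) v j 0 * N j i) * v i 0.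
  by rewrite mxE; apply: eq_bigr => i _; rewrite mxE; under eq_bigr do rewrite mxE.
rewrite E (_ : (fun k => _) =
    (fun k => \sum_(i < n) (\sum_(j < n) v j 0 * M k j i) * v i 0)); last first.
  by apply/funext => k; rewrite E.
apply: cvgn_sum => i; apply: cvgMr_tmp; apply: cvgn_sum => j.
by apply: cvgMl_tmp; exact: H.
Qed.

Section SteadyState.
Variables (n m : nat) (A : 'M[R]_n) (C : 'M[R]_(m, n)).
Variables (Sw : 'M[R]_n) (Sv : 'M[R]_m) (Pi Pbar : 'M[R]_n).
Hypotheses (hSw : psd Sw) (hPi : psd Pi) (hSv : posdef Sv).
Hypothesis hPbar : is_steady_state_cov A C Sw Sv Pi Pbar.

Lemma steady_state_nneg : nneg_form Pbar.
Proof.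
move=> v; apply: (limr_ge_seq (cvg_form (v := v) hPbar)) => k.
by have [_] := kalman_cov_psd A C k hSw hPi hSv; exact.
Qed.

(** The inequality between an updated covariance and its prediction holds at every finite time and
    passes to the limit in quadratic forms. Neither the Riccati equation for [Pbar] nor the
    continuity of matrix inversion enters. It is the source of the monotonicity of the cost. *)
Lemma steady_state_le_predict : nneg_form (predict_cov A Sw Pbar - Pbar).
Proof.
move=> v; rewrite mulmxBr mulmxBl mxE [X in _ + X]mxE.
have qf_predict (M : 'M[R]_n) : (v^T *m predict_cov A Sw M *m v) 0 0 =
    ((A^T *m v)^T *m M *m (A^T *m v)) 0 0 + (v^T *m Sw *m v) 0 0.
  by rewrite /predict_cov mulmxDr mulmxDl mxE trmx_mul trmxK !mulmxA.
have c1 := cvg_form (v := A^T *m v) hPbar.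
have c2 : (fun k => (v^T *m kalman_cov A C Sw Sv Pi k.+1 *m v) 0 0) @ \oo -->
    (v^T *m Pbar *m v) 0 0.
  by have := cvg_form (v := v) hPbar;
    rewrite -(cvg_shiftS (fun k => (v^T *m kalman_cov A C Sw Sv Pi k *m v) 0 0)); exact.
rewrite qf_predict.
have c3 := cvgB (cvgD c1 (cvg_cst ((v^T *m Sw *m v) 0 0))) c2.
apply: (limr_ge_seq (c3 _ _ _)) => k /=.
rewrite !fctE /= -qf_predict.
have HX : psd (predict_cov A Sw (kalman_cov A C Sw Sv Pi k)).
  by apply: psdD => //; apply: psd_conj; exact: kalman_cov_psd.
have := update_cov_le C HX hSv v.
by rewrite mulmxBr mulmxBl mxE [X in _ + X]mxE.
Qed.

End SteadyState.

Section RemoteCov.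
Variables (n : nat) (A Sw Pbar : 'M[R]_n).
Let c t := \tr (remote_cov A Sw Pbar t).
Let Q := predict_cov A Sw Pbar - Pbar.

(** With [h X = A X A^T + Sw], the remote covariance is the [t]-th iterate of [h] at [Pbar], and
    differences of iterates of an affine map evolve by its linear part. *)
Lemma remote_cov_diff t :
  remote_cov A Sw Pbar t.+1 - remote_cov A Sw Pbar t = A ^+ t *m Q *m (A ^+ t)^T.
Proof.
have AT s : (A ^+ s)^T = A^T ^+ s.
  by elim: s => [|s IH]; rewrite ?expr0 ?trmx1 // exprS exprSr trmx_mul IH.
rewrite AT /remote_cov big_ord_recr /= /Q /predict_cov.
rewrite mulmxBr mulmxBl mulmxDr mulmxDl.
rewrite exprSr [in X in X - _]exprS -!mulmxE !mulmxA.
by rewrite opprD !addrA addrAC; congr (_ - _); rewrite addrAC addrK.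
Qed.

Lemma remote_cov_trace0 : nneg_form Pbar -> 0 <= c 0%N.
Proof.
move=> HP; rewrite /c /remote_cov big_ord0 addr0 !expr0.
by rewrite mulmx1 mul1mx nneg_form_trace.
Qed.

Lemma remote_cov_trace_nondecreasing t : nneg_form Q -> c t <= c t.+1.
Proof.
move=> HQ; rewrite -subr_ge0 /c -linearB /= remote_cov_diff.
by apply: nneg_form_trace; exact: nneg_form_conj.
Qed.

(** The increments are traces of the iterates of the linear map [X |-> A X A^T] at [Q];
    Cayley-Hamilton is applied to the matrix of this map on vectorized matrices. *)
Lemma remote_cov_trace_recurrent :
  exists (N : nat) (a : 'I_N.+1 -> R), recurrent a (fun t => c t.+1 - c t).
Proof.
pose f : {linear 'M[R]_n -> 'M[R]_n} := mulmxr A^T \o mulmx A.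
have E t : c t.+1 - c t = \tr (vec_mx (mxvec Q *m lin_mx f ^+ t)).
  rewrite /c -linearB /= remote_cov_diff; congr (\tr _).
  suff -> : mxvec Q *m lin_mx f ^+ t = mxvec (A ^+ t *m Q *m (A ^+ t)^T).
    by rewrite mxvecK.
  elim: t => [|t IH]; first by rewrite !expr0 mulmx1 mul1mx trmx1 mulmx1.
  rewrite exprSr -mulmxE mulmxA IH mul_vec_lin /=.
  by rewrite exprS -mulmxE trmx_mul !mulmxA.
have [N [a HL]] := mx_power_recurrence (lin_mx f).
exists N, a => t; rewrite E exprD HL mulr_sumr -mulmxE mulmx_sumr !linear_sum.
apply: eq_bigr => i _.
by rewrite E exprD -scalemxAr -mulmxE -!scalemxAr !linearZ.
Qed.

End RemoteCov.

End Covariance.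

(** * Averages and the optimal tail distribution *)

Section Averages.
Variable R : realType.
Implicit Types (u v : nat -> R).

Definition avg u (T : nat) : R := T%:R^-1 * \sum_(k < T) u k.

Lemma eq_avg u v : u =1 v -> avg u =1 avg v.
Proof. by move=> uv T; rewrite /avg; under eq_bigr do rewrite uv. Qed.

Lemma avgD u v T : avg (fun k => u k + v k) T = avg u T + avg v T.
Proof. by rewrite /avg big_split mulrDr. Qed.

Lemma avgB u v T : avg (fun k => u k - v k) T = avg u T - avg v T.
Proof. by rewrite /avg sumrB mulrBr. Qed.

Lemma avgZ (a : R) u T : avg (fun k => a * u k) T = a * avg u T.
Proof. by rewrite /avg -mulr_sumr mulrCA. Qed.

Lemma avg_cst (a : R) T : (0 < T)%N -> avg (fun=> a) T = a.
Proof.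
by move=> T0; rewrite /avg sumr_const card_ord -(mulr_natl a) mulKf // pnatr_eq0 -lt0n.
Qed.

Lemma le_avg u v T : (forall k, (k < T)%N -> u k <= v k) -> avg u T <= avg v T.
Proof.
move=> uv; apply: ler_wpM2l; first by rewrite invr_ge0.
by apply: ler_sum => i _; exact: uv.
Qed.

Lemma avg_sum (n : nat) (F : 'I_n -> nat -> R) T :
  avg (fun k => \sum_(i < n) F i k) T = \sum_(i < n) avg (F i) T.
Proof. by rewrite /avg exchange_big mulr_sumr. Qed.

Lemma avg_cvg u (l : R) : u @ \oo --> l -> avg u @ \oo --> l.
Proof.
move=> /cesaro; rewrite -(cvg_shiftS (avg u)).
suff -> : (fun n => avg u n.+1) = arithmetic_mean u by [].
by apply/funext => n; rewrite /arithmetic_mean /avg /series /= big_mkord.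
Qed.

Lemma avg_shift u C : (forall k, `|u k| <= C) ->
  (fun T => avg (fun k => u k.+1) T - avg u T) @ \oo --> (0 : R).
Proof.
move=> uC; have C0 : 0 <= C by exact: le_trans (uC 0%N).
apply/norm_cvg0P.
apply: (@squeeze_cvgr _ _ _ _ (fun=> 0) (fun T => (2 * C) * T%:R^-1)).
- near=> T; rewrite normr_ge0 /=.
  have -> : avg (fun k => u k.+1) T - avg u T = T%:R^-1 * (u T - u 0%N).
    rewrite /avg -mulrBr; congr (_ * _).
    by rewrite -telescope_sumr // big_mkord sumrB.
  rewrite normrM ger0_norm ?invr_ge0 // mulrC ler_wpM2r ?invr_ge0 //.
  by apply: (le_trans (ler_normB _ _)); rewrite mulr_natl mulr2n lerD.
- exact: cvg_cst.
- rewrite -[X in _ --> X](mulr0 (2 * C)); apply: cvgMl_tmp.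
  by rewrite -(cvg_shiftS (fun T : nat => (T%:R : R)^-1)); exact: cvg_harmonic.
Unshelve. all: by end_near.
Qed.

End Averages.

Section LimitSuperior.
Variable R : realType.
Implicit Types (u : nat -> \bar R).
Local Open Scope ereal_scope.

Lemma limn_esup_ge u l N0 : (forall n, (N0 <= n)%N -> l <= u n) -> l <= limn_esup u.
Proof.
move=> H; apply: le_ereal_inf_tmp => _ [V [N _ NV] <-].
apply: (@le_trans _ _ (u (maxn N N0))); first by rewrite H // leq_maxr.
by apply: ereal_sup_ubound; exists (maxn N N0) => //; apply: NV; exact: leq_maxl.
Qed.

Lemma limn_esup_ltP u l : limn_esup u < l ->
  exists N, forall n, (N <= n)%N -> u n < l.
Proof.
move=> /ereal_inf_lt [_ [V [N _ NV] <-] lt_l]; exists N => n nN.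
apply: le_lt_trans lt_l; apply: ereal_sup_ubound; exists n => //.
exact: NV.
Qed.

Lemma limn_esup_cvg u l : u @ \oo --> l -> limn_esup u = l.
Proof.
by move=> ul; rewrite is_cvg_limn_esupE; [exact/cvg_lim | exact: cvgP ul].
Qed.

End LimitSuperior.

(** * The threshold rule in closed form and the optimal tail sequence *)

Section TailDistribution.
Variables (R : realType) (rs b : R).
Hypotheses (hrs : 0 < rs <= 1) (hb : 0 < b).

Let x : R := (b^-1 - 1) / rs.

(** With [y = (1/b - 1)/r], the randomization at [floor y] is [floor y + 1 - y], which is where the
    clamped line [t + 1 - y] crosses from 0 to 1. The jumps of the floor thus cancel, and the rule
    is continuous in [r]. For [b > 1] the threshold is negative and the rule always transmits. *)
Lemma threshold_ruleE (r : R) (t : nat) : 0 < r ->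
  threshold_rule b r t = Num.min 1 (Num.max 0 (t%:R + 1 - (b^-1 - 1) / r)).
Proof.
move=> r0; rewrite /threshold_rule /rand_threshold /opt_rand /opt_threshold.
have -> : 1 / (r * b) - 1 / r = (b^-1 - 1) / r by field; rewrite !gt_eqF //; lra.
have -> : (b - 1) / (b * r) = - ((b^-1 - 1) / r) by field; rewrite !gt_eqF //; lra.
set y := (b^-1 - 1) / r; have /andP[fl fu] := floor_itv y.
have [tf|ft] := ltP (t%:Z) (Num.floor y).
  have H : (t%:Z + 1)%:~R <= (Num.floor y)%:~R :> R by rewrite ler_int lezD1.
  rewrite intrD /= in H.
  have H2 : t%:R + 1 <= (Num.floor y)%:~R :> R := H.
  by rewrite (max_idPl _) ?(min_idPr _) //; lra.
have [ty|tf] := eqVneq (t%:Z) (Num.floor y).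
  have E : (Num.floor y)%:~R = t%:R :> R by rewrite -ty.
  rewrite E in fl *.
  by rewrite (max_idPr _) ?(min_idPr _) //; lra.
have H : (Num.floor y + 1)%:~R <= t%:Z%:~R :> R.
  by rewrite ler_int lezD1 lt_neqAle eq_sym tf ft.
have H2 : (Num.floor y + 1)%:~R <= t%:R :> R := H.
by rewrite (max_idPr _) ?(min_idPl _) //; lra.
Qed.

Lemma threshold_rule_itv (r : R) (t : nat) : 0 < r -> 0 <= threshold_rule b r t <= 1.
Proof.
move=> r0; rewrite threshold_ruleE //.
by rewrite le_min ge_min le_max !lexx ler01.
Qed.

Lemma threshold_rule1 (r : R) (t : nat) : 0 < r -> (b^-1 - 1) / r <= t%:R ->
  threshold_rule b r t = 1.
Proof.
move=> r0 tr; rewrite threshold_ruleE //.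
by rewrite (max_idPr _) ?(min_idPl _) //; lra.
Qed.

(* The smallest tail probabilities compatible with the dynamics and the budget:
   a state t+1 follows a state t with probability at least 1 - rs, and every
   state has frequency at most that of 0, hence at most rs * b. *)
Fixpoint tail (t : nat) : R :=
  if t is s.+1 then Num.max ((1 - rs) * tail s) (1 - s.+1%:R * (rs * b)) else 1.

(** The first state strictly above [x]. At [t = x] the rule is 1 already, but only a strict
    inequality survives a small error in the estimate of [rs]. *)
Lemma crossing_exists :
  exists t0 : nat, x < t0%:R /\ forall t, (t < t0)%N -> t%:R <= x.
Proof.
exists `|(Num.max 0 (Num.floor x + 1))%R|%N.
have /andP[fl fu] := floor_itv x.
have [H|H] := leP 0 (Num.floor x + 1).
  split=> [|t tH]; first by rewrite natr_absz ger0_norm.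
  have : t%:Z < Num.floor x + 1 by rewrite -(gez0_abs H) ltz_nat.
  rewrite ltzD1 => tf; apply: le_trans fl.
  by rewrite -[leLHS]/(t%:Z%:~R) ler_int.
split=> [|t]; last by rewrite absz0.
have : (Num.floor x + 1)%:~R <= (0 : int)%:~R :> R by rewrite ler_int ltW.
by rewrite absz0 /=; lra.
Qed.

Let xE : rs * b * x = 1 - b.
Proof.
have /andP[rs0 _] := hrs; have b0 := hb.
by rewrite /x; field; rewrite !gt_eqF.
Qed.

Lemma tail_ge t : 1 - t%:R * (rs * b) <= tail t.
Proof. by case: t => [|t] /=; rewrite ?mul0r ?subr0 // le_max lexx orbT. Qed.

Lemma tail_pow t : (1 - rs) ^+ t <= tail t.
Proof.
elim: t => [|t IH] /=; first by rewrite expr0.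
rewrite le_max exprS; apply/orP; left; apply: ler_wpM2l => //.
by have := hrs; lra.
Qed.

Section Crossing.
Variable crossing : nat.
Hypothesis crossing_gt : x < crossing%:R.
Hypothesis lt_crossing : forall t, (t < crossing)%N -> t%:R <= x.

(** The two branches of the maximum compare like [t] and [x]:
    [(1 - rs)(1 - t rs b) <= 1 - (t+1) rs b] amounts to [t rs b <= 1 - b], and [1 - b = rs b x]. *)
Lemma tail_below t : (t <= crossing)%N -> tail t = 1 - t%:R * (rs * b).
Proof.
elim: t => [|t IH] tc; first by rewrite mul0r subr0.
rewrite [tail _]/= (IH (ltnW tc)); apply/max_idPr.
have := lt_crossing tc; rewrite -natr1.
have /andP[rs0 rs1] := hrs; have b0 := hb.
have p : 0 < rs * b by exact: mulr_gt0.
rewrite -(ler_pM2l p) xE; set z := rs * b * t%:R => tx.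
have -> : t%:R * (rs * b) = z by rewrite mulrC.
have -> : (t%:R + 1) * (rs * b) = z + rs * b by rewrite /z; ring.
nra.
Qed.

Lemma tail_above t : (crossing <= t)%N -> tail t.+1 = (1 - rs) * tail t.
Proof.
move=> ct; apply/max_idPl.
have tx : x < t%:R by apply: (lt_le_trans crossing_gt); rewrite ler_nat.
have /andP[rs0 rs1] := hrs; have b0 := hb.
have p : 0 < rs * b by exact: mulr_gt0.
have T := tail_ge t; rewrite -(ltr_pM2l p) xE in tx.
apply: (@le_trans _ _ ((1 - rs) * (1 - t%:R * (rs * b)))); last first.
  by apply: ler_wpM2l => //; lra.
rewrite -natr1; set z := rs * b * t%:R in tx.
have -> : t%:R * (rs * b) = z by rewrite mulrC.
have -> : (t%:R + 1) * (rs * b) = z + rs * b by rewrite /z; ring.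
nra.
Qed.

(** The balance equations of the chain driven by the threshold rule, with [tail t - tail t.+1] as
    frequency of the state [t]. The decrements are constant where the rule is 0 and geometric where
    it is 1; only [t.+1 = crossing] sees the randomization. *)
Lemma tail_threshold t :
  tail t.+1 - tail t.+2 = (1 - rs * threshold_rule b rs t) * (tail t - tail t.+1).
Proof.
have /andP[rs0 rs1] := hrs; have b0 := hb.
have [ct|tc] := leqP crossing t.
  rewrite [tail t.+2]tail_above ?leqW // threshold_rule1 //; last first.
    by rewrite ltW // (lt_le_trans crossing_gt) // ler_nat.
  by rewrite tail_above //; ring.
rewrite threshold_ruleE // -/x.
have tx := lt_crossing tc.
have [t1c|] := ltnP t.+1 crossing.
  have := lt_crossing t1c; rewrite -natr1 => t1x.
  rewrite (max_idPl _) ?(min_idPr _); [|lra|lra].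
  rewrite !tail_below // ?(ltnW tc) ?(ltnW t1c) //.
  by rewrite -!natr1; ring.
rewrite leq_eqVlt ltnS leqNgt tc orbF => /eqP ct.
have := crossing_gt; rewrite ct -natr1 => xt.
rewrite (max_idPr _) ?(min_idPr _); [|lra|lra].
rewrite (@tail_above t.+1) ?ct // (@tail_below t.+1) ?ct // (@tail_below t) ?ct //.
rewrite -!natr1.
transitivity (rs * b - rs * (rs * b) * (t%:R + 1) + rs * (rs * b * x)).
  by rewrite xE; ring.
by ring.
Qed.

End Crossing.

End TailDistribution.

(** * Limits of tail frequencies and of average costs *)

Section TailLimit.
Variable R : realType.

(** [M t] stands for the frequency of the states at least [t], [be t] for that of the transmissions
    made there. The deviations [dm t] of the point frequencies satisfy the balance equations up to
    [o(1)], so all are multiples of [dm 0]. Certain transmission from [t0] on adds one equation,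
    which forces [dm 0] to vanish in the limit. *)
Lemma tail_limit (q g : nat -> R) (M be : nat -> nat -> R) (rs : R) (t0 : nat) :
  0 < rs <= 1 -> (forall t, 0 <= q t <= 1) ->
  g 0%N = 1 ->
  (forall t, g t.+1 - g t.+2 = (1 - rs * q t) * (g t - g t.+1)) ->
  g t0.+1 = (1 - rs) * g t0 ->
  M 0%N @ \oo --> (1 : R) ->
  (forall t, (fun T => M t.+1 T - M t T + rs * be t T) @ \oo --> (0 : R)) ->
  (forall t, (fun T => be t T - be t.+1 T - q t * (M t T - M t.+1 T)) @ \oo
     --> (0 : R)) ->
  (fun T => be t0 T - M t0 T) @ \oo --> (0 : R) ->
  forall t, M t @ \oo --> g t.
Proof.
move=> hrs hq g0 gq gt0 M0 Mbe beq bet0.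
pose D t T := M t T - g t.
pose dm t T := D t T - D t.+1 T.
have D0 : D 0%N @ \oo --> (0 : R).
  by have := cvgB M0 (cvg_cst (1 : R)); rewrite subrr /D g0; exact.
have dmS t : (fun T => dm t.+1 T - (1 - rs * q t) * dm t T) @ \oo --> (0 : R).
  have := cvgB (cvgB (Mbe t) (Mbe t.+1)) (cvgMl_tmp (a := rs) (beq t)).
  rewrite subrr mulr0 subrr => /(_ _ _ _).
  rewrite (_ : (fun T => dm t.+1 T - _) = (fun T => M t.+1 T - M t T + rs * be t T) \-
    (fun T => M t.+2 T - M t.+1 T + rs * be t.+1 T) \-
    (fun T => rs * (be t T - be t.+1 T - q t * (M t T - M t.+1 T)))); first exact.
  apply/funext => T; rewrite /dm /D /=; have := gq t; move: (g t) (g t.+1) (g t.+2) => a b c.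
  by move=> H; have -> : c = b - (1 - rs * q t) * (a - b); [lra|ring].
pose p t := \prod_(s < t) (1 - rs * q s).
have p0 t : 0 <= p t.
  by apply: prodr_ge0 => i _; have := hq i; have := hrs; nra.
have dmp t : (fun T => dm t T - p t * dm 0%N T) @ \oo --> (0 : R).
  elim: t => [|t IH].
    rewrite (_ : (fun T => _) = fun=> 0); first exact: cvg_cst.
    by apply/funext => T; rewrite /p big_ord0 mul1r subrr.
  have := cvgD (dmS t) (cvgMl_tmp (a := 1 - rs * q t) IH).
  rewrite mulr0 addr0 => /(_ _ _).
  rewrite (_ : (fun T => dm t.+1 T - p t.+1 * _) =
    (fun T => dm t.+1 T - (1 - rs * q t) * dm t T) \+
    (fun T => (1 - rs * q t) * (dm t T - p t * dm 0%N T))); first exact.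
  by apply/funext => T /=; rewrite /p big_ord_recr /=; ring.
have DE t T : D t T = D 0%N T - \sum_(s < t) dm s T.
  elim: t => [|t IH]; first by rewrite big_ord0 subr0.
  by rewrite big_ord_recr /= opprD addrA -IH /dm; ring.
pose P := \sum_(s < t0) p s.
have P0 : 0 <= P by apply: sumr_ge0 => i _.
have DP : (fun T => D t0 T + P * dm 0%N T) @ \oo --> (0 : R).
  have := cvgB D0 (cvgn_sum (fun s : 'I_t0 => dmp s)).
  rewrite big1 // subr0 => /(_ _ _).
  rewrite (_ : (fun T => D t0 T + _) = D 0%N \-
    (fun T => \sum_(i < t0) (dm i T - p i * dm 0%N T))); first exact.
  by apply/funext => T /=; rewrite sumrB -mulr_suml DE /P; ring.
have Dt0 : (fun T => dm t0 T - rs * D t0 T) @ \oo --> (0 : R).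
  have := cvgD (cvgMl_tmp (a := rs) bet0) (cvgN (Mbe t0)).
  rewrite mulr0 oppr0 addr0 => /(_ _ _).
  rewrite (_ : (fun T => dm t0 T - _) = (fun T => rs * (be t0 T - M t0 T)) \+
    \- (fun T => M t0.+1 T - M t0 T + rs * be t0 T)); first exact.
  by apply/funext => T /=; rewrite /dm /D gt0; ring.
(* The coefficient left on [dm 0]. Later factors [p t] may vanish, so positivity comes from
   [p 0 = 1], found in the first summand if [t0 = 0] and in [P] otherwise. *)
have k0 : 0 < p t0 + rs * P.
  have rs0 : 0 < rs by lra.
  case: (posnP t0) => [E|t0_gt0].
    by rewrite /P /p E !big_ord0 mulr0 addr0.
  rewrite ltr_wpDl // mulr_gt0 //.
  apply: (@lt_le_trans _ _ (p 0%N)); first by rewrite /p big_ord0.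
  by rewrite /P (bigD1 (Ordinal t0_gt0)) //= lerDl sumr_ge0.
have dm0 : dm 0%N @ \oo --> (0 : R).
  have := cvgB (cvgB (cvgMl_tmp (a := rs) DP) (cvgN (Dt0))) (dmp t0).
  rewrite mulr0 oppr0 !subrr => /(_ _ _ _) H.
  have := cvgMl_tmp (a := (p t0 + rs * P)^-1) (H _); rewrite ?addr0 mulr0.
  rewrite (_ : (fun T => _) = dm 0%N); first exact.
  apply/funext => T /=; rewrite !fctE.
  apply: (mulfI (lt0r_neq0 k0)); rewrite mulrA divff ?lt0r_neq0 // mul1r; ring.
have dmt t : dm t @ \oo --> (0 : R).
  have := cvgD (dmp t) (cvgMl_tmp (a := p t) dm0).
  rewrite mulr0 addr0 => /(_ _ _).
  rewrite (_ : (fun T => dm t T - p t * dm 0%N T) + (fun T => p t * dm 0%N T) = dm t);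
    first exact.
  by apply/funext => T; rewrite !fctE subrK.
move=> t.
have := cvgD (cvgB D0 (cvgn_sum (fun s : 'I_t => dmt s))) (cvg_cst (g t)).
rewrite big1 // subrr add0r => /(_ _ _ _ _).
rewrite (_ : D 0%N - _ + _ = M t); first exact.
by apply/funext => T; rewrite !fctE -DE /D subrK.
Qed.

Section Occupation.
Variables (tau : nat -> nat) (a : nat -> bool) (qk : nat -> nat -> R).
Variables (q : nat -> R) (rs : R).

Let S k := a k && (tau k.+1 == 0)%N.

(* be t is the frequency of transmissions from the states at least t: by the
   law of large numbers rs * be t is the frequency of successes there, which
   is what the frequency of the states >= t + 1 loses over that of >= t. *)
Lemma occupation_limit (g : nat -> R) (t0 : nat) :
  0 < rs <= 1 -> (forall t, 0 <= q t <= 1) ->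
  g 0%N = 1 ->
  (forall t, g t.+1 - g t.+2 = (1 - rs * q t) * (g t - g t.+1)) ->
  g t0.+1 = (1 - rs) * g t0 ->
  (forall k, tau k.+1 = if S k then 0%N else (tau k).+1) ->
  (forall t, avg (fun k => (t <= tau k)%N%:R * ((a k)%:R - qk k (tau k))) @ \oo
     --> (0 : R)) ->
  (forall t, avg (fun k => (t <= tau k)%N%:R * ((a k)%:R * ((S k)%:R - rs))) @ \oo
     --> (0 : R)) ->
  (forall t, (fun k => qk k t) @ \oo --> q t) ->
  (\forall k \near \oo, forall t, (t0 <= t)%N -> qk k t = 1) ->
  forall t, avg (fun k => (t <= tau k)%N%:R) @ \oo --> g t.
Proof.
move=> hrs hq g0 gq gt0 Hdyn Ha HS Hq Hq1.
pose be t := avg (fun k => (t <= tau k)%N%:R * (a k)%:R : R).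
apply: (@tail_limit q g _ be rs t0) => //.
- rewrite -(cvg_shiftS (avg _)).
  rewrite (_ : (fun n => _) = fun=> 1); first exact: cvg_cst.
  by apply/funext => T; rewrite avg_cst.
- move=> t; pose u k : R := (t.+1 <= tau k)%N%:R.
  have u1 k : `|u k| <= 1 by rewrite /u; case: (_ <= _)%N; rewrite ?normr1 ?normr0.
  have := cvgN (cvgD (HS t) (avg_shift u1)).
  rewrite addr0 oppr0 => /(_ _ _).
  rewrite (_ : (fun T => avg _ T - avg _ T + _) = \- (avg (fun k =>
    (t <= tau k)%N%:R * ((a k)%:R * ((S k)%:R - rs))) \+
    (fun T => avg (fun k => u k.+1) T - avg u T))); first exact.
  apply/funext => T /=.
  (* The state exceeds [t] at the next time exactly when it is at least [t] now and no success
     occurs. *)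
  have -> : avg (fun k => u k.+1) T = avg (fun k => (t <= tau k)%N%:R) T -
      avg (fun k => (t <= tau k)%N%:R * ((a k)%:R * ((S k)%:R - rs))) T - rs * be t T.
    rewrite -avgZ -!avgB; apply: eq_avg => k; rewrite /u Hdyn /S.
    by case: (a k); case: (tau k.+1 == 0)%N => /=; rewrite ?ltnS; ring.
  by rewrite /u; ring.
- move=> t; pose I k : R := (t <= tau k)%N%:R - (t.+1 <= tau k)%N%:R.
  (* [I k] is the indicator of [tau k = t], so convergence of the rule at this single state is
     enough. *)
  have c1 : (fun k => I k * (qk k t - q t)) @ \oo --> (0 : R).
    apply/norm_cvg0P.
    apply: (@squeeze_cvgr _ _ _ _ (fun=> 0) (fun k => `|qk k t - q t|)).
    + near=> k; rewrite normr_ge0 normrM ler_piMl //= /I.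
      have [->|/negPf E] := eqVneq (tau k) t.
        by rewrite leqnn ltnn subr0 normr1.
      by rewrite ltn_neqAle eq_sym E subrr normr0.
    + exact: cvg_cst.
    + by apply/norm_cvg0P; have := cvgB (Hq t) (cvg_cst (q t)); rewrite subrr; exact.
  have := cvgD (cvgB (Ha t) (Ha t.+1)) (avg_cvg c1).
  rewrite subrr addr0 => /(_ _ _ _).
  rewrite (_ : (fun T => be t T - _ - _) =
     avg (fun k => (t <= tau k)%N%:R * ((a k)%:R - qk k (tau k)))
     \- avg (fun k => (t.+1 <= tau k)%N%:R * ((a k)%:R - qk k (tau k)))
     \+ avg (fun k => I k * (qk k t - q t))); first exact.
  apply/funext => T /=; rewrite -!avgB -avgZ -avgB -avgD; apply: eq_avg => k.
  rewrite /I; have [->|/negPf E] := eqVneq (tau k) t; first by rewrite leqnn ltnn; ring.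
  by rewrite ltn_neqAle eq_sym E /=; ring.
(* Infinitely many states lie above [t0]; pointwise convergence would not do, hence the hypothesis
   that the rule is eventually 1 on all of them at once. *)
- have c1 : (fun k => (t0 <= tau k)%N%:R * (qk k (tau k) - 1)) @ \oo --> (0 : R).
    apply: cvg_near_cst; near=> k; have [tk|_] := leqP t0 (tau k); last by rewrite mul0r.
    have /(_ _ tk) -> : forall t, (t0 <= t)%N -> qk k t = 1 by near: k.
    by rewrite subrr mulr0.
  have := cvgD (Ha t0) (avg_cvg c1); rewrite addr0 => /(_ _ _).
  rewrite (_ : (fun T => be t0 T - _) =
     avg (fun k => (t0 <= tau k)%N%:R * ((a k)%:R - qk k (tau k)))
     \+ avg (fun k => (t0 <= tau k)%N%:R * (qk k (tau k) - 1))); first exact.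
  by apply/funext => T /=; rewrite -!avgB -avgD; apply: eq_avg => k; ring.
Unshelve. all: by end_near.
Qed.

End Occupation.

(** * Average costs from tail frequencies *)

Section CostLimit.
Variables (c g : nat -> R).
Let e t := c t.+1 - c t.
Hypothesis g0 : forall t, 0 <= g t.
Hypothesis cS : forall t, c t <= c t.+1.

(** The mean of [c] under the distribution with tail [g], after summation by parts. *)
Definition tail_cost : \bar R :=
  ((c 0%N)%:E + \sum_(0 <= t <oo) (e t * g t.+1)%:E)%E.

Let pcost N := c 0%N + \sum_(t < N) e t * g t.+1.

Let e0 t : 0 <= e t. Proof. by rewrite subr_ge0. Qed.

Let pcostE N : (pcost N)%:E = ((c 0%N)%:E + \sum_(0 <= t < N) (e t * g t.+1)%:E)%E.
Proof. by rewrite sumEFin -EFinD big_mkord. Qed.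

Let pcost_cvg : (fun N => (pcost N)%:E) @ \oo --> tail_cost.
Proof.
rewrite /tail_cost (_ : (fun N => _) =
  (fun N => ((c 0%N)%:E + \sum_(0 <= t < N) (e t * g t.+1)%:E)%E)); last first.
  by apply/funext => N; exact: pcostE.
apply: cvgeD; first by [].
  exact: cvg_cst.
by apply: is_cvg_nneseries => n _ _; rewrite lee_fin mulr_ge0.
Qed.

Let pcost_le N : ((pcost N)%:E <= tail_cost)%E.
Proof.
rewrite pcostE /tail_cost leeD2l //; apply: nneseries_lim_ge => n _ _.
by rewrite lee_fin mulr_ge0.
Qed.

(** The mean of the cost truncated at state [N], for the tail frequencies [M]: finitely many of them
    are involved, so limits can be taken termwise. *)
Definition cost_minorant (M : nat -> nat -> R) N T := c 0%N + \sum_(t < N) e t * M t.+1 T.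

Lemma cost_minorant_ge (M : nat -> nat -> R) N eps :
  (forall t d, 0 < d -> \forall T \near \oo, g t - d <= M t T) -> 0 < eps ->
  \forall T \near \oo, pcost N - eps <= cost_minorant M N T.
Proof.
move=> HM eps0; rewrite /pcost /cost_minorant.
elim: N => [|N IH] in eps eps0 *.
  by near=> T; rewrite !big_ord0; lra.
(* The summand 1 keeps the denominator positive when the increment [e N] is 0. *)
have d0 : 0 < eps / 2 / (1 + e N) by rewrite !divr_gt0 //; have := e0 N; lra.
near=> T; rewrite !big_ord_recr /=.
have H1 : c 0%N + \sum_(t < N) e t * g t.+1 - eps / 2 <= c 0%N + \sum_(t < N) e t * M t.+1 T.
  by near: T; apply: IH; lra.
have H2 : g N.+1 - eps / 2 / (1 + e N) <= M N.+1 T by near: T; exact: HM.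
have := ler_wpM2l (e0 N) H2; rewrite mulrBr.
have : e N * (eps / 2 / (1 + e N)) <= eps / 2.
  by rewrite mulrCA ler_piMr //; [lra | rewrite ler_pdivrMr; have := e0 N; lra].
lra.
Unshelve. all: by end_near.
Qed.

Lemma tail_cost_le_limsup (M : nat -> nat -> R) (y : nat -> \bar R) :
  (forall t d, 0 < d -> \forall T \near \oo, g t - d <= M t T) ->
  (forall N, \forall T \near \oo, ((cost_minorant M N T)%:E <= y T)%E) ->
  (tail_cost <= limn_esup y)%E.
Proof.
move=> HM Hy.
suff H N : ((pcost N)%:E <= limn_esup y)%E.
  by apply: (cvge_to_le pcost_cvg); exact: nearW.
apply/lee_addgt0Pr => eps eps0.
rewrite -leeBlDr //.
have [K _ HK] : \forall T \near \oo, ((pcost N)%:E - eps%:E <= y T)%E.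
  near=> T; apply: (@le_trans _ _ (cost_minorant M N T)%:E); last by near: T.
  by rewrite -EFinB lee_fin; near: T; exact: cost_minorant_ge.
exact: (limn_esup_ge HK).
Unshelve. all: by end_near.
Qed.

Lemma tail_cost_pinfty_cvg (M : nat -> nat -> R) (y : nat -> R) :
  (forall t d, 0 < d -> \forall T \near \oo, g t - d <= M t T) ->
  (forall N, \forall T \near \oo, cost_minorant M N T <= y T) ->
  tail_cost = +oo%E -> (fun T => (y T)%:E) @ \oo --> +oo%E.
Proof.
move=> HM Hy Joo; apply/cvgeyPge => A.
have := pcost_cvg; rewrite Joo => /cvgeyPge /(_ (A + 1)) [N _ /(_ N (leqnn N))].
rewrite /= lee_fin => HN.
near=> T; rewrite lee_fin.
have H1 : pcost N - 1 <= cost_minorant M N T by near: T; exact: cost_minorant_ge.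
have H2 : cost_minorant M N T <= y T by near: T.
lra.
Unshelve. all: by end_near.
Qed.

(** The truncation error [K * rho ^+ N] does not depend on [T]: choose [N] first, then let [T]
    grow. *)
Lemma tail_cost_cvg (M : nat -> nat -> R) (y : nat -> R) (K rho : R) :
  (forall t, M t @ \oo --> g t) ->
  (forall N, \forall T \near \oo, cost_minorant M N T <= y T) ->
  0 <= rho < 1 ->
  (forall N, \forall T \near \oo, y T <= cost_minorant M N T + K * rho ^+ N) ->
  (tail_cost < +oo)%E -> (fun T => (y T)%:E) @ \oo --> tail_cost.
Proof.
move=> HM Hlo rho01 Hup Jfin.
have : tail_cost \is a fin_num.
  rewrite fin_numE (lt_eqF Jfin) andbT gt_eqF //.
  by rewrite (lt_le_trans _ (pcost_le 0)) // ltNyr.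
move=> /fineK E; rewrite -E; set j := fine tail_cost in E *.
apply: cvg_EFin; first by near=> T.
rewrite (_ : fine \o _ = y) //.
have pj N : pcost N <= j by rewrite -lee_fin E.
have pcj : pcost @ \oo --> j.
  by have /fine_cvgP[_] : (fun N => (pcost N)%:E) @ \oo --> j%:E by rewrite E.
have rhoc : (fun N => K * rho ^+ N) @ \oo --> (0 : R).
  rewrite -[X in _ --> X](mulr0 K); apply: cvgMl_tmp; apply: cvg_expr.
  by rewrite ger0_norm; lra.
apply/cvgrPdistC_le => eps eps0.
have [N HN1 HN2] : exists2 N, j - eps / 2 <= pcost N & K * rho ^+ N <= eps / 2.
  have e2 : 0 < eps / 2 by lra.
  have /cvgrPdistC_le /(_ _ e2) [N1 _ H1] := pcj.
  have /cvgrPdistC_le /(_ _ e2) [N2 _ H2] := rhoc.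
  exists (maxn N1 N2).
    have := H1 _ (leq_maxl N1 N2); rewrite /= ler_norml; lra.
  have := H2 _ (leq_maxr N1 N2); rewrite /= subr0; apply: le_trans; exact: ler_norm.
have Mc : cost_minorant M N @ \oo --> pcost N.
  apply: (cvgD (cvg_cst _)); apply: cvgn_sum => t.
  by apply: cvgMl_tmp; exact: HM.
near=> T.
have H3 : `|cost_minorant M N T - pcost N| <= eps / 2.
  by near: T; move/cvgrPdistC_le : Mc; apply; lra.
have H4 : cost_minorant M N T <= y T by near: T.
have H5 : y T <= cost_minorant M N T + K * rho ^+ N by near: T.
move: H3; rewrite !ler_norml; have := pj N; lra.
Unshelve. all: by end_near.
Qed.

End CostLimit.
End TailLimit.

(** * Bounded random variables *)

Section BoundedVariables.
Context {d : measure_display} {Omega : measurableType d} {R : realType}.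
Variable P : probability Omega R.
Implicit Types X Y : Omega -> R.

(** A class closed under all operations used below, on which integrability is automatic and [Ex] is
    linear and real-valued. *)
Definition brv X := measurable_fun setT X /\ exists C, forall w, `|X w| <= C.

Definition Ex X : R := \int[P]_w X w.

Lemma brv_cst (a : R) : brv (fun=> a).
Proof. by split; [exact: measurable_cst | exists `|a|]. Qed.

Lemma brvD X Y : brv X -> brv Y -> brv (fun w => X w + Y w).
Proof.
move=> [mX [C HC]] [mY [D HD]]; split; first exact: measurable_funD.
by exists (C + D) => w; apply: (le_trans (ler_normD _ _)); exact: lerD.
Qed.

Lemma brvM X Y : brv X -> brv Y -> brv (fun w => X w * Y w).
Proof.
move=> [mX [C HC]] [mY [D HD]]; split; first exact: measurable_funM.
by exists (C * D) => w; rewrite normrM ler_pM.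
Qed.

Lemma brvZ (a : R) X : brv X -> brv (fun w => a * X w).
Proof. by apply: brvM; exact: brv_cst. Qed.

Lemma brvB X Y : brv X -> brv Y -> brv (fun w => X w - Y w).
Proof.
move=> bX bY; rewrite (_ : (fun w => _) = fun w => X w + (-1) * Y w).
  by apply: brvD => //; exact: brvZ.
by apply/funext => w; rewrite mulN1r.
Qed.

Lemma brvX X n : brv X -> brv (fun w => X w ^+ n).
Proof.
move=> bX; elim: n => [|n IH].
  by rewrite (_ : (fun w => _) = fun=> 1) //; exact: brv_cst.
rewrite (_ : (fun w => _) = fun w => X w * X w ^+ n); first exact: brvM.
by apply/funext => w; rewrite exprS.
Qed.

Lemma brv_sum n (F : 'I_n -> Omega -> R) : (forall i, brv (F i)) ->
  brv (fun w => \sum_(i < n) F i w).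
Proof.
elim: n F => [|n IH] F H.
  by rewrite (_ : (fun w => _) = fun=> 0); [exact: brv_cst | apply/funext => w; rewrite big_ord0].
rewrite (_ : (fun w => _) = fun w => (\sum_(i < n) F (widen_ord (leqnSn n) i) w) + F ord_max w).
  by apply: brvD => //; exact: (IH (fun i => F (widen_ord (leqnSn n) i))).
by apply/funext => w; rewrite big_ord_recr.
Qed.

Lemma brv_bool (b : Omega -> bool) : measurable [set w | b w] ->
  brv (fun w => (b w)%:R).
Proof.
move=> mb; split.
  rewrite (_ : (fun w => _) = \1_[set w | b w]); first exact: measurable_indic.
  by apply/funext => w; rewrite indicE mem_setE.
by exists 1 => w; case: (b w); rewrite ?normr1 ?normr0.
Qed.

Lemma brv_integrable X D : measurable D -> brv X -> P.-integrable D (EFin \o X).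
Proof.
move=> mD [mX [C HC]]; apply: measurable_bounded_integrable => //.
- by rewrite (le_lt_trans (probability_le1 P mD)) // ltry.
- exact: measurable_funTS.
- exists C; split; first exact: num_real.
  by move=> M CM w _ /=; rewrite (le_trans (HC w)) // ltW.
Qed.

Lemma ExD X Y : brv X -> brv Y -> Ex (fun w => X w + Y w) = Ex X + Ex Y.
Proof. by move=> bX bY; apply: RintegralD => //; exact: brv_integrable. Qed.

Lemma ExB X Y : brv X -> brv Y -> Ex (fun w => X w - Y w) = Ex X - Ex Y.
Proof. by move=> bX bY; apply: RintegralB => //; exact: brv_integrable. Qed.

Lemma ExZ (a : R) X : brv X -> Ex (fun w => a * X w) = a * Ex X.
Proof. by move=> bX; apply: RintegralZl => //; exact: brv_integrable. Qed.

Lemma Ex_cst (a : R) : Ex (fun=> a) = a.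
Proof. by rewrite /Ex Rintegral_cst // (congr1 fine (probability_setT P)) mulr1. Qed.

Lemma le_Ex X Y : brv X -> brv Y -> (forall w, X w <= Y w) -> Ex X <= Ex Y.
Proof. by move=> bX bY XY; apply: le_Rintegral => //; exact: brv_integrable. Qed.

Lemma Ex_ge0 X : (forall w, 0 <= X w) -> 0 <= Ex X.
Proof. by move=> X0; apply: Rintegral_ge0. Qed.

Lemma Ex_sum n (F : 'I_n -> Omega -> R) : (forall i, brv (F i)) ->
  Ex (fun w => \sum_(i < n) F i w) = \sum_(i < n) Ex (F i).
Proof.
elim: n F => [|n IH] F H.
  rewrite big_ord0 (_ : (fun w => _) = fun=> 0); first exact: Ex_cst.
  by apply/funext => w; rewrite big_ord0.
rewrite big_ord_recr /= -(IH (fun i => F (widen_ord (leqnSn n) i))) // -ExD //.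
  by congr Ex; apply/funext => w; rewrite big_ord_recr.
exact: (@brv_sum n (fun i => F (widen_ord (leqnSn n) i))).
Qed.

Lemma Ex_bool (b : Omega -> bool) : measurable [set w | b w] ->
  P [set w | b w] = (Ex (fun w => (b w)%:R))%:E.
Proof.
move=> mb; rewrite /Ex /Rintegral.
rewrite (_ : (fun w => (b w)%:R%:E) = (fun w => (\1_[set w | b w] w)%:E)).
  rewrite integral_indic // setIT fineK // fin_num_measure //.
by apply/funext => w; rewrite indicE mem_setE.
Qed.

Lemma expectation_Ex X : brv X -> 'E_P[X]%E = (Ex X)%:E.
Proof.
move=> bX; rewrite unlock /Ex /Rintegral fineK //.
exact: integrable_fin_num (brv_integrable measurableT bX).
Qed.

Lemma chebyshev_sqr X (eps v : R) : brv X -> 0 < eps -> Ex (fun w => X w ^+ 2) <= v ->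
  (P [set w | (eps < `|X w|)%R] <= (v / eps ^+ 2)%:E)%E.
Proof.
move=> bX eps0 Xv; have [mX _] := bX.
have mA : measurable [set w | eps < `|X w|].
  rewrite -[X in measurable X]setTI.
  rewrite (_ : [set w | _] = (fun w => `|X w|) @^-1` `]eps, +oo[%classic).
    have mN : measurable_fun setT (fun w => `|X w|) by exact: measurableT_comp.
    by apply: mN.
  by apply/seteqP; split => w /=; rewrite in_itv /= andbT.
rewrite Ex_bool // lee_fin ler_pdivlMr ?exprn_gt0 // mulrC.
apply: le_trans Xv; rewrite -ExZ; last exact: brv_bool.
apply: le_Ex; [by apply: brvZ; exact: brv_bool | exact: brvX |] => w.
case: ltP => Xw; last by rewrite mulr0 sqr_ge0.
by rewrite mulr1 -(ger0_norm (sqr_ge0 (X w))) normrX lerXn2r ?nnegrE ?normr_ge0 // ltW.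
Qed.

Lemma markov_pow X (a v : R) : brv X -> (forall w, 0 <= X w) -> 0 < a -> Ex X <= v ->
  (P [set w | (a <= X w)%R] <= (v / a)%:E)%E.
Proof.
move=> bX X0 a0 Xv; have [mX _] := bX.
have mA : measurable [set w | a <= X w].
  rewrite -[X in measurable X]setTI.
  rewrite (_ : [set w | _] = X @^-1` `[a, +oo[%classic); first by apply: mX.
  by apply/seteqP; split => w /=; rewrite in_itv /= andbT.
rewrite Ex_bool // lee_fin ler_pdivlMr // mulrC.
apply: le_trans Xv; rewrite -ExZ; last exact: brv_bool.
apply: le_Ex => //; first by apply: brvZ; exact: brv_bool.
by move=> w; case: (leP a (X w)) => Xw; [rewrite mulr1 | rewrite mulr0; exact: X0].
Qed.

Lemma borel_cantelli (A : nat -> set Omega) (r : nat -> R) (C : R) :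
  (forall n, measurable (A n)) -> (forall n, (P (A n) <= (r n)%:E)%E) ->
  (forall N, \sum_(n < N) r n <= C) ->
  {ae P, forall w, \forall n \near \oo, ~ A n w}.
Proof.
move=> mA PA rC.
have r0 n : 0 <= r n by rewrite -lee_fin (le_trans _ (PA n)).
have H : P (lim_sup_set A) = 0%E.
  apply: lim_sup_set_cvg0 => //.
  apply: (@le_lt_trans _ _ C%:E); last exact: ltry.
  apply: (le_trans (lee_nneseries _ (fun n _ => PA n))) => //.
  apply: lime_le; first by apply: is_cvg_nneseries => n _ _; rewrite lee_fin.
  by apply: nearW => N; rewrite sumEFin lee_fin big_mkord.
exists (lim_sup_set A); split => //.
  by apply: bigcap_measurable => // n _; apply: bigcup_measurable => k _.
move=> w /= Hw n _; apply: contrapT => Hn; apply: Hw.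
exists n => // k /= nk Ak; apply: Hn; exists k => //.
Qed.

End BoundedVariables.

(** * Random variables with countably many values *)

Section Countable.
Context {d : measure_display} {Omega : measurableType d} {R : realType}.
Variable P : probability Omega R.
Context {C : countType}.
Variable h : Omega -> C.
Hypothesis mh : forall c, measurable [set w | h w = c].

Lemma measurable_countable (A : set C) : measurable [set w | A (h w)].
Proof.
pose F n := [set w | A (h w) /\ pickle (h w) = n].
rewrite (_ : [set w | _] = \bigcup_n F n); last first.
  apply/seteqP; split => w /=; first by move=> Aw; exists (pickle (h w)).
  by move=> [n _ []].
apply: bigcup_measurable => n _.
have [[w0 [Aw0 w0n]]|Hn] := pselect (exists w0, A (h w0) /\ pickle (h w0) = n).
  rewrite (_ : F n = [set w | h w = h w0]) //.
  apply/seteqP; split => w /=; last by move=> E; rewrite /F /= E.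
  by move=> [_]; rewrite -w0n => /(pcan_inj pickleK).
rewrite (_ : F n = set0) //.
by apply/seteqP; split => w //= Hw; apply: Hn; exists w.
Qed.

(** Stands in for conditioning on [h]: the fibres form a countable measurable partition, over which
    the integral is summed. *)
Lemma Ex_countable0 (g : Omega -> R) : brv g ->
  (forall w0, \int[P]_(w in [set w | h w = h w0]) g w = 0) -> Ex P g = 0.
Proof.
move=> bg Hg.
pose F n := [set w | pickle (h w) = n].
have FE : \bigcup_n F n = setT.
  by apply/seteqP; split => w //= _; exists (pickle (h w)).
have mF n : measurable (F n) by exact: (measurable_countable [set c | pickle c = n]).
have : (\int[P]_(w in \bigcup_n F n) (g w)%:E = 0)%E.
  rewrite integral_bigcup //.
  - apply: eseries0 => n _ _.
    have [[w0 w0n]|Hn] := pselect (exists w0, pickle (h w0) = n).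
      rewrite (_ : F n = [set w | h w = h w0]).
        rewrite -[LHS]fineK ?(Hg w0 : fine _ = 0) //.
        by apply: integrable_fin_num => //; exact: brv_integrable.
      apply/seteqP; split => w /=; last by move=> E; rewrite /F /= E.
      by rewrite -w0n => /(pcan_inj pickleK).
    rewrite (_ : F n = set0) ?integral_set0 //.
    by apply/seteqP; split => w //= Hw; apply: Hn; exists w.
  - apply/trivIsetP => i j _ _ ij; apply/seteqP; split => w //= [wi wj].
    have E : i = j := eq_trans (esym (wi : pickle (h w) = i)) wj.
    by move: ij; rewrite E eqxx.
  - by rewrite FE; exact: brv_integrable.
by rewrite FE /Ex /Rintegral => ->.
Qed.

Lemma ae_countable (B : Omega -> Prop) :
  (forall w0, P.-negligible [set w | h w = h w0 /\ ~ B w]) ->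
  {ae P, forall w, B w}.
Proof.
move=> HB.
suff : P.-negligible (\bigcup_n [set w | pickle (h w) = n /\ ~ B w]).
  by apply: negligibleS => w /= Bw; exists (pickle (h w)).
apply: negligible_bigcup => n.
have [[w0 w0n]|Hn] := pselect (exists w0, pickle (h w0) = n).
  apply: negligibleS (HB w0) => w /= [].
  by rewrite -w0n => /(pcan_inj pickleK).
apply: negligibleS (negligible_set0 _) => w /= [wn _].
by apply: Hn; exists w.
Qed.

End Countable.

(** * A law of large numbers for bounded martingale differences *)

Section StoppedSums.
Variables (R : realType) (B : nat -> bool) (X : nat -> R).
Hypothesis XB : forall k, `|X k| <= (B k)%:R.

Definition cnt T : nat := (\sum_(k < T) B k)%N.

(** The sum over the first [n] trials, a trial being a time with [B k]. The weight of time [k] only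
    looks at earlier trials, so stopping preserves martingale differences, and the random count is
    replaced by a fixed [n]. *)
Definition stopped_sum n T : R := \sum_(k < T) (cnt k < n)%N%:R * X k.

Lemma stopped_cnt n T : (\sum_(k < T) (cnt k < n)%N * B k)%N = minn (cnt T) n.
Proof.
elim: T => [|T IH]; first by rewrite /cnt !big_ord0 min0n.
rewrite big_ord_recr /= IH /cnt big_ord_recr /= -/(cnt T).
by case: (B T) => /=; case: (ltnP (cnt T) n) => /= H; lia.
Qed.

Lemma stopped_sum_frozen n T : (n <= cnt T)%N -> stopped_sum n T.+1 = stopped_sum n T.
Proof. by move=> H; rewrite /stopped_sum big_ord_recr /= ltnNge H mul0r addr0. Qed.

Lemma cnt_nondecreasing T : (cnt T <= cnt T.+1)%N.
Proof. by rewrite /cnt big_ord_recr /= leq_addr. Qed.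

Lemma dist_stopped_sum n T : (n <= cnt T)%N ->
  `|\sum_(k < T) X k - stopped_sum n T| <= (cnt T - n)%:R.
Proof.
move=> nT; rewrite /stopped_sum -sumrB.
apply: (le_trans (ler_norm_sum _ _ _)).
apply: (@le_trans _ _ (\sum_(k < T) ((n <= cnt k)%N * B k)%N%:R)).
  apply: ler_sum => k _; case: ltnP => _; first by rewrite mul1r subrr normr0.
  by rewrite mul0r subr0 mul1n.
rewrite -natr_sum ler_nat leq_subRL //.
have -> : cnt T = (\sum_(k < T) (cnt k < n)%N * B k + \sum_(k < T) (n <= cnt k)%N * B k)%N.
  rewrite -big_split; apply: eq_bigr => k _ /=.
  by case: ltnP => _; rewrite ?mul1n ?mul0n ?addn0.
by rewrite leq_add2r stopped_cnt (minn_idPr nT).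
Qed.

Lemma square_between N : (0 < N)%N -> exists j, (j.+1 ^ 2 <= N < j.+2 ^ 2)%N.
Proof.
elim: N => // N IH _; have [->|N0] := posnP N; first by exists 0%N.
have [j /andP[j1 j2]] := IH N0.
have [H|H] := ltnP N.+1 (j.+2 ^ 2); first by exists j; rewrite H leqW.
exists j.+1; rewrite H /=; apply: (leq_ltn_trans j2).
by rewrite ltn_exp2r.
Qed.

(* Between two consecutive squares the sum varies by at most their distance,
   which is negligible before the squares themselves. *)
Lemma stopped_sum_cvg :
  cnt @ \oo --> \oo ->
  (forall m : nat, \forall j \near \oo, forall T, (j.+1 ^ 2 <= cnt T)%N ->
     `|stopped_sum (j.+1 ^ 2) T| <= (j.+1 ^ 2)%:R / m.+1%:R) ->
  (fun T => (cnt T)%:R^-1 * \sum_(k < T) X k) @ \oo --> (0 : R).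
Proof.
move=> cntoo Hs; apply/cvgrPdistC_le => e e0.
have [m Hm] : exists m : nat, m.+1%:R^-1 <= e / 2.
  have [m _ Hm] := near_infty_natSinv_lt (PosNum (divr_gt0 e0 (ltr0n _ 2))).
  by exists m; rewrite ltW // (Hm m) /=.
(* [m2] makes the gap [2 * j.+1] between consecutive squares at most a fraction [e / 2] of the
   count. *)
have [m2 Hm2] : exists m : nat, m.+1%:R^-1 <= e / 4.
  have [m' _ Hm'] := near_infty_natSinv_lt (PosNum (divr_gt0 e0 (ltr0n _ 4))).
  by exists m'; rewrite ltW // (Hm' m') /=.
have [J _ HJ] := Hs m.
pose J' := maxn J m2.
have cJ : \forall T \near \oo, (J'.+1 ^ 2 <= cnt T)%N.
  by have := cntoo _ (nbhs_infty_ge (J'.+1 ^ 2)%N).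
near=> T; rewrite subr0.
have JT : (J'.+1 ^ 2 <= cnt T)%N by near: T.
have [j /andP[j1 j2]] := square_between (leq_trans (isT : (0 < J'.+1 ^ 2)%N) JT).
have Jj : (J' <= j)%N.
  have := leq_ltn_trans JT j2; rewrite ltn_exp2r //.
have H1 := HJ j (leq_trans (leq_maxl _ _) Jj) T j1.
have H2 := dist_stopped_sum j1.
have H3 : (cnt T - j.+1 ^ 2)%:R <= 2 * j.+1%:R :> R.
  rewrite -[2]/(2%:R) -natrM ler_nat; move: j2; rewrite !expnS !expn0 !muln1; nia.
have c0 : 0 < (cnt T)%:R :> R.
  by rewrite ltr0n (leq_trans _ j1) // expn_gt0.
rewrite normrM ger0_norm ?invr_ge0 // mulrC ler_pdivrMr //.
have -> : \sum_(k < T) X k = (\sum_(k < T) X k - stopped_sum (j.+1 ^ 2) T) + stopped_sum (j.+1 ^ 2) T.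
  by rewrite subrK.
apply: (le_trans (ler_normD _ _)).
have cj : j.+1%:R * j.+1%:R <= (cnt T)%:R :> R.
  by rewrite -natrM ler_nat; move: j1; rewrite expnS expn1.
have H4 : 2 * j.+1%:R <= e / 2 * (cnt T)%:R.
  apply: (@le_trans _ _ (e / 2 * (j.+1%:R * j.+1%:R))); last first.
    by apply: ler_wpM2l => //; lra.
  have : 1 <= e / 4 * j.+1%:R.
    have j0 : 0 < j.+1%:R :> R by rewrite ltr0n.
    rewrite -ler_pdivrMr // div1r; apply: le_trans Hm2.
    rewrite lef_pV2 ?posrE ?ltr0n // ler_nat ltnS.
    exact: leq_trans (leq_maxr _ _) Jj.
  have : 0 <= j.+1%:R :> R by [].
  set y := j.+1%:R; nra.
have H5 : (j.+1 ^ 2)%:R / m.+1%:R <= e / 2 * (cnt T)%:R.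
  rewrite mulrC; by apply: ler_pM => //; rewrite ?invr_ge0 ?ler_nat.
apply: (le_trans (lerD (le_trans H2 (le_trans H3 H4)) (le_trans H1 H5))).
by rewrite -mulrDl -splitr.
Unshelve. all: by end_near.
Qed.

End StoppedSums.

(** * Histories, adapted variables and martingale differences *)

Section Filtration.
Context {d : measure_display} {Omega : measurableType d} {R : realType}.
Variables (tau : nat -> Omega -> nat) (act : nat -> Omega -> bool).
Hypothesis htau : forall k, measurable_fun setT (tau k).
Hypothesis hact : forall k, measurable_fun setT (act k).

Definition hist k w := (tau_hist tau k w, act_hist act k w).

(** Factorization through the history, for values in any type. Histories range over a countable
    type, so this already implies measurability. *)
Definition adapted (T : Type) k (X : Omega -> T) :=
  forall w w', hist k w = hist k w' -> X w = X w'.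

Lemma hist_tau k i w w' : (i <= k)%N -> hist k w = hist k w' -> tau i w = tau i w'.
Proof.
move=> ik /(congr1 (fun h => tnth h.1 (Ordinal (ik : (i < k.+1)%N)))) /=.
by rewrite !tnth_mktuple.
Qed.

Lemma hist_act k i w w' : (i < k)%N -> hist k w = hist k w' -> act i w = act i w'.
Proof.
move=> ik /(congr1 (fun h => tnth h.2 (Ordinal ik))) /=.
by rewrite !tnth_mktuple.
Qed.

Lemma hist_le j k w w' : (j <= k)%N -> hist k w = hist k w' -> hist j w = hist j w'.
Proof.
move=> jk H; congr (_, _); apply: eq_from_tnth => i; rewrite !tnth_mktuple.
  by apply: hist_tau H; rewrite (leq_trans _ jk) // -ltnS.
by apply: hist_act H; rewrite (leq_trans _ jk).
Qed.

Lemma adaptedW (T : Type) j k (X : Omega -> T) : (j <= k)%N -> adapted j X -> adapted k X.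
Proof. by move=> jk HX w w' /(hist_le jk); exact: HX. Qed.

Lemma adapted_act k i : (i < k)%N -> adapted k (act i).
Proof. by move=> ik w w'; exact: hist_act. Qed.

Lemma adapted_comp (S T : Type) k (X : Omega -> S) (g : S -> T) :
  adapted k X -> adapted k (fun w => g (X w)).
Proof. by move=> HX w w' /HX ->. Qed.

Lemma adapted_comp2 (S S' T : Type) k (X : Omega -> S) (Y : Omega -> S') (g : S -> S' -> T) :
  adapted k X -> adapted k Y -> adapted k (fun w => g (X w) (Y w)).
Proof. by move=> HX HY w w' H; rewrite (HX _ _ H) (HY _ _ H). Qed.

Lemma adapted_sum n (F : 'I_n -> Omega -> R) k :
  (forall i, adapted k (F i)) -> adapted k (fun w => \sum_(i < n) F i w).
Proof. by move=> HF w w' H; apply: eq_bigr => i _; exact: HF. Qed.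

Lemma measurable_tau k t : measurable [set w | tau k w = t].
Proof. by have := htau k measurableT (Y := [set t]); rewrite setTI; exact. Qed.

Lemma measurable_act k b : measurable [set w | act k w = b].
Proof. by have := hact k measurableT (Y := [set b]); rewrite setTI; exact. Qed.

Lemma measurable_hist k c : measurable [set w | hist k w = c].
Proof.
case: c => s u.
rewrite (_ : [set w | _] =
  (\bigcap_(i in [set: 'I_k.+1]) [set w | tau i w = tnth s i]) `&`
  (\bigcap_(i in [set: 'I_k]) [set w | act i w = tnth u i])).
  apply: measurableI; apply: fin_bigcap_measurable => // i _.
    exact: measurable_tau.
  exact: measurable_act.
apply/seteqP; split => w /=.
  by move=> [<- <-]; split => i _ /=; rewrite tnth_mktuple.
move=> [H1 H2]; congr (_, _); apply: eq_from_tnth => i; rewrite tnth_mktuple.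
  exact: H1.
exact: H2.
Qed.

Lemma measurable_adapted k (A : Omega -> Prop) : adapted k A -> measurable [set w | A w].
Proof.
move=> HA; have := measurable_countable (@measurable_hist k)
  [set c | exists w, hist k w = c /\ A w].
congr (measurable _); apply/seteqP; split => w /=; last by exists w.
by move=> [w' [/HA <-]].
Qed.

Lemma adapted_brv k (X : Omega -> R) C : adapted k X -> (forall w, `|X w| <= C) -> brv X.
Proof.
move=> HX XC; split; last by exists C.
move=> _ Y mY; rewrite setTI.
apply: (@measurable_adapted k (fun w => Y (X w))).
by move=> w w' /HX ->.
Qed.

Variable P : probability Omega R.

(** Bounded martingale differences: [X k] is revealed at time [k.+1], and its vanishing conditional
    mean given the history up to [k] is expressed as orthogonality to all bounded variables of that
    history. *)
Definition mdiff (X : nat -> Omega -> R) := forall k,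
  [/\ adapted k.+1 (X k), exists C, forall w, `|X k w| <= C &
    forall (Z : Omega -> R) C, adapted k Z -> (forall w, `|Z w| <= C) ->
      Ex P (fun w => Z w * X k w) = 0].

Lemma mdiff_brv X k : mdiff X -> brv (X k).
Proof. by move=> /(_ k) [aX [C HC] _]; exact: (adapted_brv aX HC). Qed.

Lemma mdiff_weight X (Y : nat -> Omega -> R) (D : nat -> R) : mdiff X ->
  (forall k, adapted k (Y k)) -> (forall k w, `|Y k w| <= D k) ->
  mdiff (fun k w => Y k w * X k w).
Proof.
move=> mX aY YC k; have [aX [C XC] H] := mX k; split.
- by apply: adapted_comp2 => //; exact: adaptedW (aY k).
- by exists (D k * C) => w; rewrite normrM ler_pM.
- move=> Z C' aZ ZC.
  rewrite -(H (fun w => Z w * Y k w) (C' * D k)).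
  + by congr Ex; apply/funext => w; rewrite mulrA.
  + exact: adapted_comp2.
  + by move=> w; rewrite normrM ler_pM.
Qed.

Lemma mdiff_l2 X T : mdiff X ->
  Ex P (fun w => (\sum_(k < T) X k w) ^+ 2) = \sum_(k < T) Ex P (fun w => X k w ^+ 2).
Proof.
move=> mX; elim: T => [|T IH].
  rewrite big_ord0 (_ : (fun w => _) = fun=> 0); first exact: Ex_cst.
  by apply/funext => w; rewrite big_ord0 expr0n.
have bX k : brv (X k) by exact: mdiff_brv.
have bS : brv (fun w => \sum_(k < T) X k w) by apply: brv_sum => i.
rewrite big_ord_recr /= -IH (_ : (fun w => _) = (fun w =>
  (\sum_(k < T) X k w) ^+ 2 + 2 * ((\sum_(k < T) X k w) * X T w) + X T w ^+ 2)); last first.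
  by apply/funext => w; rewrite big_ord_recr /=; ring.
rewrite ExD; [| apply: brvD; [exact: brvX | apply: brvZ; exact: brvM] | exact: brvX].
rewrite ExD; [| exact: brvX | apply: brvZ; exact: brvM].
rewrite ExZ; last exact: brvM.
have [_ [C HC]] := bS.
have [_ _ HT] := mX T; rewrite (HT _ C) ?mulr0 ?addr0 //.
apply: adapted_sum => i; have [aX _ _] := mX i; exact: adaptedW aX.
Qed.

Lemma inv_square_sum N : \sum_(j < N) (j.+1%:R ^+ 2)^-1 <= 2 :> R.
Proof.
(* Telescoping, from [1/y^2 <= 2/y - 2/(y + 1)] for [y >= 1]. *)
suff : \sum_(j < N) (j.+1%:R ^+ 2)^-1 <= 2 - 2 / N.+1%:R :> R.
  by move/le_trans; apply; rewrite lerBlDr lerDl divr_ge0.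
elim: N => [|N IH]; first by rewrite big_ord0 divr1 subrr.
rewrite big_ord_recr /=; apply: (le_trans (lerD IH (lexx _))).
rewrite -[N.+2%:R]natr1; set y := N.+1%:R.
have y1 : 1 <= y by rewrite ler1n.
rewrite -subr_ge0.
have -> : 2 - 2 / (y + 1) - (2 - 2 / y + (y ^+ 2)^-1) = (y - 1) / (y ^+ 2 * (y + 1)).
  by field; rewrite !gt_eqF //; lra.
by rewrite divr_ge0 ?mulr_ge0 ?sqr_ge0 //; lra.
Qed.

Section LawOfLargeNumbers.
Variables (X : nat -> Omega -> R) (B : nat -> Omega -> bool).
Hypotheses (mX : mdiff X) (aB : forall k, adapted k.+1 (B k)).
Hypothesis XB : forall k w, `|X k w| <= (B k w)%:R.

Let N k w := cnt (B^~ w) k.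
Let S n T w := stopped_sum (B^~ w) (X^~ w) n T.

Let aN k : adapted k (N k).
Proof.
move=> w w' H; rewrite /N /cnt; apply: eq_bigr => i _.
by congr nat_of_bool; apply: (@adaptedW _ i.+1 k).
Qed.

Let mS n : mdiff (fun k w => (N k w < n)%N%:R * X k w).
Proof.
apply: (mdiff_weight (D := fun=> 1)) => //.
  by move=> k; exact: (adapted_comp (fun x => (x < n)%N%:R : R) (@aN k)).
by move=> k w; case: (_ < _)%N; rewrite ?normr1 ?normr0.
Qed.

Let bS n T : brv (S n T).
Proof.
by apply: (@brv_sum _ _ _ T (fun k w => (N k w < n)%N%:R * X k w)) => i; exact: (mdiff_brv i (mS n)).
Qed.

(** Orthogonality reduces this to the mean number of trials before stopping, at most [n] whatever
    [T] is. *)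
Let l2S n T : Ex P (fun w => S n T w ^+ 2) <= n%:R.
Proof.
rewrite (mdiff_l2 T (mS n)).
pose Y k w : R := ((N k w < n)%N * B k w)%N%:R.
have bY k : brv (Y k).
  apply: (@adapted_brv k.+1 _ 1).
    by move=> w w' H; rewrite /Y (aB H) (@aN k _ _ (hist_le (leqnSn k) H)).
  by move=> w; rewrite /Y; case: (_ < _)%N; case: (B k w); rewrite ?normr1 ?normr0.
apply: (@le_trans _ _ (\sum_(k < T) Ex P (Y k))).
  apply: ler_sum => k _; apply: le_Ex => //.
    by apply: brvX; exact: (mdiff_brv k (mS n)).
  move=> w; rewrite /Y exprMn; case: (_ < _)%N; last by rewrite expr0n mul0r.
  rewrite expr1n !mul1r mul1n; have := XB k w; rewrite -[X k w ^+ 2]ger0_norm ?sqr_ge0 // normrX.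
  case: (B k w) => /= H; first by rewrite expr_le1.
  by move: H; rewrite normr_le0 => /eqP ->; rewrite normr0 expr0n.
rewrite -Ex_sum // -[leRHS](Ex_cst P); apply: le_Ex; [exact: brv_sum | exact: brv_cst |].
by move=> w; rewrite /Y -natr_sum ler_nat stopped_cnt geq_minr.
Qed.

(** Requiring that the count has reached [j.+1 ^ 2] means that the stopped sum is frozen; the events
    then increase with [T]. *)
Let A m j T := [set w | (j.+1 ^ 2 <= N T w)%N /\
  (j.+1 ^ 2)%:R / m.+1%:R < `|S (j.+1 ^ 2) T w| ].

Let mA m j T : measurable (A m j T).
Proof.
apply: (@measurable_adapted T) => w w' H.
have -> : N T w = N T w' by exact: aN.
congr (_ /\ (_ < `| _ |)); apply: eq_bigr => k _.
by have [aX _ _] := mS (j.+1 ^ 2)%N k; exact: (adaptedW _ aX).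
Qed.

Let PA m j T : (P (A m j T) <= (m.+1%:R ^+ 2 * (j.+1%:R ^+ 2)^-1)%:E)%E.
Proof.
have p : 0 < (j.+1 ^ 2)%:R / m.+1%:R :> R.
  by rewrite divr_gt0 // ltr0n ?expn_gt0.
have := chebyshev_sqr (bS (j.+1 ^ 2)%N T) p (l2S (j.+1 ^ 2)%N T).
move=> /(le_trans (_ : (P (A m j T) <= _)%E)) H; apply: le_trans (H _) _.
  apply: le_measure; rewrite ?inE //; last by move=> w [].
  apply: (@measurable_adapted T) => w w' E.
  congr (_ < `| _ |); apply: eq_bigr => k _.
  by have [aX _ _] := mS (j.+1 ^ 2)%N k; exact: (adaptedW _ aX).
rewrite lee_fin natrX le_eqVlt; apply/orP; left; apply/eqP.
by field; rewrite !gt_eqF // ?ltr0n.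
Qed.

(** Continuity from below along these increasing events gives the bound uniformly in time, where one
    would otherwise call on a maximal inequality. *)
Let PbigA m j : (P (\bigcup_T A m j T) <= (m.+1%:R ^+ 2 * (j.+1%:R ^+ 2)^-1)%:E)%E.
Proof.
have ndA : nondecreasing_seq (A m j).
  apply/nondecreasing_seqP => T; apply/subsetPset => w [H1 H2]; split.
    by apply: (leq_trans H1); exact: cnt_nondecreasing.
  by rewrite /S stopped_sum_frozen.
have := nondecreasing_cvg_mu (mu := P) (mA m j) (bigcupT_measurable _ (mA m j)) ndA.
by move=> H; apply: (cvge_to_le H); apply: nearW => T; exact: PA.
Qed.

(** The normalization is the random number of trials because the estimate of [rs] divides by the
    number of transmissions, about whose growth nothing but divergence is known at that stage. Along
    the squares, Chebyshev's bounds are summable. *)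
Theorem mdiff_lln : {ae P, forall w, (fun T => cnt (B^~ w) T) @ \oo --> \oo ->
  (fun T => (cnt (B^~ w) T)%:R^-1 * \sum_(k < T) X k w) @ \oo --> (0 : R)}.
Proof.
have H m : {ae P, forall w, \forall j \near \oo, ~ (\bigcup_T A m j T) w}.
  apply: (@borel_cantelli _ _ _ P _ _ (m.+1%:R ^+ 2 * 2)) (PbigA m) _.
    by move=> j; exact: bigcupT_measurable.
  by move=> K; rewrite -mulr_sumr ler_wpM2l ?sqr_ge0 // inv_square_sum.
have := ae_foralln H; apply: filterS => w Hw cntoo.
apply: (stopped_sum_cvg (XB^~ w)) => // m.
apply: filterS (Hw m) => j Hj T jT.
by rewrite leNgt; apply/negP => lt; apply: Hj; exists T.
Qed.

End LawOfLargeNumbers.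

Lemma mdiff_avg (X : nat -> Omega -> R) : mdiff X -> (forall k w, `|X k w| <= 1) ->
  {ae P, forall w, avg (fun k => X k w) @ \oo --> (0 : R)}.
Proof.
move=> mX X1; have := mdiff_lln (B := fun _ _ => true) mX _ X1.
move=> /(_ (fun _ _ _ _ => erefl)); apply: filterS => w.
have E : cnt (fun=> true) = id.
  by apply/funext => T; rewrite /cnt sum1_card card_ord.
by rewrite E => H; apply: H; exact: cvg_id.
Qed.

End Filtration.

(** * The controlled process *)

Section Law.
Context {d : measure_display} {Omega : measurableType d} {R : realType}.
Variables (tau : nat -> Omega -> nat) (act : nat -> Omega -> bool).
Hypothesis htau : forall k, measurable_fun setT (tau k).
Hypothesis hact : forall k, measurable_fun setT (act k).
Variables (rs : R) (f : policy R) (P : probability Omega R).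
Hypotheses (hrs : 0 < rs <= 1) (hf : admissible f).
Hypothesis hlaw : is_policy_law tau act rs f P.

Local Notation hist := (hist tau act).
Local Notation adapted := (adapted tau act).
Local Notation mdiff := (mdiff tau act P).

Definition decision k w : R := f (tau_hist tau k w) (act_hist act k w).

Definition succeeds k w := act k w && (tau k.+1 w == 0)%N.

Definition fails k w := act k w && (tau k.+1 w != 0)%N.

Lemma adapted_decision k : adapted k (decision k).
Proof.
by move=> w w' H; rewrite /decision (congr1 fst H : tau_hist _ _ _ = _)
  (congr1 snd H : act_hist _ _ _ = _).
Qed.

Lemma decision_itv k w : 0 <= decision k w <= 1.
Proof. exact: hf. Qed.

Lemma adapted_success k : adapted k.+1 (succeeds k).
Proof. by move=> w w' H; rewrite /succeeds (hist_act (leqnn _) H) (hist_tau (leqnn _) H). Qed.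

Lemma adapted_failure k : adapted k.+1 (fails k).
Proof. by move=> w w' H; rewrite /fails (hist_act (leqnn _) H) (hist_tau (leqnn _) H). Qed.

Lemma measurable_adaptedb k (b : Omega -> bool) : adapted k b -> measurable [set w | b w].
Proof. by move=> ab; apply: (measurable_adapted htau hact (k := k)) => w w' /ab ->. Qed.

Lemma Rintegral_bool (D : set Omega) (b : Omega -> bool) :
  measurable D -> measurable [set w | b w] ->
  \int[P]_(w in D) (b w)%:R = fine (P (D `&` [set w | b w])).
Proof.
move=> mD mb; rewrite /Rintegral; congr fine.
rewrite (_ : (fun w => (b w)%:R%:E) = (fun w => (\1_[set w | b w] w)%:E)).
  by rewrite integral_indic // setIC.
by apply/funext => w; rewrite indicE mem_setE.
Qed.

Lemma hist_eventE k w0 :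
  [set w | hist k w = hist k w0] = hist_event tau act (tau_hist tau k w0) (act_hist act k w0).
Proof.
apply/seteqP; split => w /=; last by move=> [E1 E2]; apply/pair_equal_spec.
by move=> H; split; [exact: (congr1 fst H) | exact: (congr1 snd H)].
Qed.

Lemma mdiff_intro (X : nat -> Omega -> R) :
  (forall k, adapted k.+1 (X k)) -> (forall k w, `|X k w| <= 1) ->
  (forall k w0, \int[P]_(w in [set w | hist k w = hist k w0]) X k w = 0) -> mdiff X.
Proof.
move=> aX X1 HX k; split; [exact: aX | by exists 1 |].
move=> Z C aZ ZC.
have bX : brv (X k) by exact: (adapted_brv htau hact (aX k) (X1 k)).
have bZ : brv Z by exact: (adapted_brv htau hact aZ ZC).
apply: (Ex_countable0 (measurable_hist htau hact (k := k))); first exact: brvM.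
move=> w0; have mD := measurable_hist htau hact (hist k w0).
rewrite (@eq_Rintegral _ _ _ _ _ (fun w => Z w0 * X k w)); last first.
  by move=> w; rewrite inE /= => /aZ ->.
rewrite RintegralZl //; last exact: brv_integrable.
by rewrite HX mulr0.
Qed.

Lemma norm_diff_itv (x y : R) : 0 <= x <= 1 -> 0 <= y <= 1 -> `|x - y| <= 1.
Proof. by move=> x01 y01; rewrite ler_norml; lra. Qed.

Lemma bool_itv (b : bool) : 0 <= (b%:R : R) <= 1.
Proof. by case: b; rewrite ?lexx ?ler01. Qed.

Lemma mdiff_act : mdiff (fun k w => (act k w)%:R - decision k w).
Proof.
apply: mdiff_intro => [k w w' H|k w|k w0].
- by rewrite (hist_act (leqnn _) H) (adapted_decision (hist_le (leqnSn k) H)).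
- by apply: norm_diff_itv; [exact: bool_itv | exact: decision_itv].
have mD := measurable_hist htau hact (hist k w0).
have ma : measurable [set w | act k w] by exact: (measurable_act hact k true).
rewrite (@eq_Rintegral _ _ _ _ _ (fun w => (act k w)%:R - decision k w0)); last first.
  by move=> w; rewrite inE /= => /adapted_decision ->.
rewrite RintegralB //; [| exact/brv_integrable/brv_bool | exact/brv_integrable/brv_cst].
rewrite Rintegral_bool // Rintegral_cst // hist_eventE.
have [_ H _] := hlaw; rewrite H fineM // ?subrr //.
by rewrite fin_num_measure // -hist_eventE.
Qed.

Lemma mdiff_success : mdiff (fun k w => (act k w)%:R * ((succeeds k w)%:R - rs)).
Proof.
apply: mdiff_intro => [k w w' H|k w|k w0].
- by rewrite (hist_act (leqnn _) H) (adapted_success H).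
- rewrite normrM; case: (act k w); last by rewrite normr0 mul0r.
  by rewrite normr1 mul1r; apply: norm_diff_itv; [exact: bool_itv | have /andP[/ltW -> ->] := hrs].
have mD := measurable_hist htau hact (hist k w0).
have ma : measurable [set w | act k w] by exact: (measurable_act hact k true).
have ms : measurable [set w | succeeds k w] by exact: measurable_adaptedb (@adapted_success k).
rewrite (@eq_Rintegral _ _ _ _ _ (fun w => (succeeds k w)%:R - rs * (act k w)%:R)); last first.
  by move=> w _; rewrite /succeeds; case: (act k w) => /=; rewrite ?mul1r ?mul0r ?mulr1 // mulr0 subrr.
rewrite RintegralB //; [| exact/brv_integrable/brv_bool
  | exact/(brv_integrable P mD)/brvZ/brv_bool].
rewrite RintegralZl //; last exact/brv_integrable/brv_bool.
rewrite !Rintegral_bool // hist_eventE.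
have [_ _ H] := hlaw.
have := H k (tau_hist tau k w0) (act_hist act k w0) true 0%N.
rewrite (_ : trans_prob _ _ _ _ = rs); last first.
  by rewrite /trans_prob /= mulr1 mulr0 addr0.
have -> : [set w | succeeds k w] = [set w | act k w = true] `&` [set w | tau k.+1 w = 0%N].
  by apply/seteqP; split => w /=; [move=> /andP[-> /eqP] | move=> [E1 E2]; rewrite /succeeds E1 E2].
rewrite setIA => ->; rewrite fineM // ?subrr //.
by rewrite fin_num_measure //; apply: measurableI; rewrite -?hist_eventE.
Qed.

Lemma mdiffB (X Y : nat -> Omega -> R) (a b : R) : mdiff X -> mdiff Y ->
  mdiff (fun k w => a * X k w - b * Y k w).
Proof.
move=> mX mY k; have [aX [C XC] HX] := mX k; have [aY [D YD] HY] := mY k; split.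
- by apply: (adapted_comp2 (fun x y => a * x - b * y)).
- exists (`|a| * C + `|b| * D) => w; apply: (le_trans (ler_normB _ _)).
  by rewrite !normrM; apply: lerD; apply: ler_wpM2l.
- move=> Z K aZ ZK.
  have bX : brv (X k) by exact: (adapted_brv htau hact aX XC).
  have bY : brv (Y k) by exact: (adapted_brv htau hact aY YD).
  have bZ : brv Z by exact: (adapted_brv htau hact aZ ZK).
  rewrite (_ : (fun w => _) = (fun w => a * (Z w * X k w) - b * (Z w * Y k w))).
    rewrite ExB ?ExZ; [|exact: brvM..|by apply: brvZ; exact: brvM|by apply: brvZ; exact: brvM].
    by rewrite (HX _ _ aZ ZK) (HY _ _ aZ ZK) !mulr0 subrr.
  by apply/funext => w; ring.
Qed.

Lemma mdiff_failure : mdiff (fun k w => (fails k w)%:R - (1 - rs) * decision k w).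
Proof.
(* A failure is a transmission without success: the centred failure is [1 - rs] times the centred
   action minus the centred success. *)
have := mdiffB (1 - rs) 1 mdiff_act mdiff_success.
rewrite (_ : (fun k w => _) = (fun k w => (fails k w)%:R - (1 - rs) * decision k w)) //.
apply/funext => k; apply/funext => w; rewrite /fails /succeeds.
by case: (act k w); case: (tau k.+1 w == 0)%N => /=; ring.
Qed.

Lemma ae_start : {ae P, forall w, tau 0 w = 0%N}.
Proof.
have [H0 _ _] := hlaw.
exists (~` [set w | tau 0%N w = 0%N]); split.
- by apply: measurableC; exact: measurable_tau.
- by rewrite probability_setC ?H0 ?subee //; exact: measurable_tau.
- by move=> w.
Qed.

(** Every finite history that violates the recursion has a transition probability 0 in it, and there
    are countably many histories. *)
Lemma ae_dynamics :
  {ae P, forall w k, tau k.+1 w = if succeeds k w then 0%N else (tau k w).+1}.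
Proof.
apply: ae_foralln => k.
apply: (ae_countable (h := hist k.+1)) => w0.
have [B0|NB0] := pselect (tau k.+1 w0 = if succeeds k w0 then 0%N else (tau k w0).+1).
  apply: negligibleS (negligible_set0 _) => w /= [H]; apply.
  by rewrite (hist_tau (leqnn _) H) (adapted_success H) (hist_tau (leqnSn _) H).
pose E := hist_event tau act (tau_hist tau k w0) (act_hist act k w0) `&`
  [set w | act k w = act k w0] `&` [set w | tau k.+1 w = tau k.+1 w0].
apply: (negligibleS (A := E)).
  move=> w /= [H _]; rewrite /E -hist_eventE /=; split; first split.
  - exact: hist_le (leqnSn k) H.
  - exact: hist_act H.
  - exact: hist_tau H.
have mE : measurable E.
  rewrite /E -hist_eventE; apply: measurableI; first apply: measurableI.
  - exact: measurable_hist.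
  - exact: measurable_act.
  - exact: measurable_tau.
suff PE : P E = 0%E by apply/negligibleP.
have [_ _ H] := hlaw; rewrite /E H /trans_prob tnth_mktuple /=.
move: NB0; rewrite /succeeds; case: (act k w0) => /=.
  case: eqP => [->//|_ /eqP/negPf ->]; by rewrite !mulr0 addr0 mul0e.
by move/eqP/negPf => ->; rewrite mul0e.
Qed.

Lemma ae_certain : {ae P, forall w k, decision k w = 1 -> act k w}.
Proof.
apply: ae_foralln => k.
apply: (ae_countable (h := hist k)) => w0.
have mD := measurable_hist htau hact (hist k w0).
have [D1|ND1] := pselect (decision k w0 = 1); last first.
  apply: negligibleS (negligible_set0 _) => w /= [H]; apply => D1.
  by case: ND1; rewrite -(adapted_decision H).
have ma : measurable [set w | act k w] by exact: (measurable_act hact k true).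
pose E := hist_event tau act (tau_hist tau k w0) (act_hist act k w0).
have mE : measurable E by rewrite /E -hist_eventE.
apply: (negligibleS (A := E `\` [set w | act k w])).
  move=> w /= [H Hw]; rewrite /E -hist_eventE; split => //= aw; exact: Hw.
apply/negligibleP; first exact: measurableD.
have [_ H _] := hlaw.
rewrite measureD //; last by rewrite -ge0_fin_numE // fin_num_measure.
have HE : P (E `&` [set w | act k w]) = P E.
  by rewrite /E H -/(decision k w0) D1 mul1e.
transitivity (P E - P E)%E; first by congr (_ - _)%E; exact: HE.
by rewrite subee // fin_num_measure.
Qed.

(** Times without transmission reset the run as well, since [fails] includes the action. *)
Fixpoint failure_run k w : nat :=
  if k is j.+1 then if fails j w then (failure_run j w).+1 else 0%N else 0%N.

Lemma failure_run_le k w : (failure_run k w <= k)%N.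
Proof. by elim: k => //= k IH; case: ifP. Qed.

Lemma adapted_failure_run k : adapted k (failure_run k).
Proof.
elim: k => // k IH w w' H /=.
by rewrite (adapted_failure H) (IH _ _ (hist_le (leqnSn k) H)).
Qed.

Lemma failure_run_pow_bound (x : R) k w : 1 <= x -> `|x ^+ failure_run k w| <= x ^+ k.
Proof.
move=> x1; rewrite ger0_norm ?exprn_ge0 //; last lra.
by rewrite ler_weXn2l // failure_run_le.
Qed.

Lemma brv_failure_run (x : R) k : 1 <= x -> brv (fun w => x ^+ failure_run k w).
Proof.
move=> x1; apply: (adapted_brv htau hact (k := k) (C := x ^+ k)).
  exact: (adapted_comp (fun n => x ^+ n) (@adapted_failure_run k)).
by move=> w; exact: failure_run_pow_bound.
Qed.

(** A drift inequality: the run is prolonged with conditional probability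
    [(1 - rs) * decision <= p]. It is stated pathwise, with the martingale difference split off, to
    serve both in mean and almost surely. *)
Lemma failure_run_step (p x : R) k w : 1 - rs <= p -> 1 <= x ->
  x ^+ failure_run k.+1 w <= x * x ^+ failure_run k w *
    ((fails k w)%:R - (1 - rs) * decision k w) + p * x * x ^+ failure_run k w + 1.
Proof.
move=> rsp x1; have /andP[rs0 rs1] := hrs; have dk := decision_itv k w.
have U0 : 0 <= x ^+ failure_run k w by rewrite exprn_ge0 //; lra.
have y0 : 0 <= x * x ^+ failure_run k w by rewrite mulr_ge0 //; lra.
have vp : 0 <= p - (1 - rs) * decision k w by nra.
have := mulr_ge0 y0 vp; rewrite /=; set y := x * _ in y0 *.
rewrite -[p * x * _]mulrA -/y mulrBr.
case: (fails k w); rewrite ?exprS -?/y /= ?expr0; lra.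
Qed.

Lemma Ex_failure_run (p x : R) k : 1 - rs <= p -> 1 <= x -> p * x < 1 ->
  Ex P (fun w => x ^+ failure_run k w) <= (1 - p * x)^-1.
Proof.
move=> rsp x1 px1.
have /andP[rs0 rs1] := hrs.
have den : 0 < 1 - p * x by lra.
have px0 : 0 <= p * x by apply: mulr_ge0; lra.
elim: k => [|k IH].
  rewrite (_ : (fun w => _) = fun=> 1) // Ex_cst -[leLHS]invr1.
  by rewrite lef_pV2 ?posrE //; lra.
have bU := brv_failure_run k x1.
have bX : brv (fun w => (fails k w)%:R - (1 - rs) * decision k w).
  exact: (mdiff_brv htau hact k mdiff_failure).
have bUX : brv (fun w => x * x ^+ failure_run k w * ((fails k w)%:R - (1 - rs) * decision k w)).
  by apply: brvM => //; exact: brvZ.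
apply: (@le_trans _ _ (Ex P (fun w => (x * x ^+ failure_run k w *
    ((fails k w)%:R - (1 - rs) * decision k w) + p * x * x ^+ failure_run k w) + 1))).
  apply: le_Ex; [exact: brv_failure_run | by apply: brvD; [apply: brvD => //; exact: brvZ | exact: brv_cst]|].
  by move=> w; exact: failure_run_step.
rewrite ExD; [|by apply: brvD => //; exact: brvZ|exact: brv_cst].
rewrite ExD; [|by []|exact: brvZ].
rewrite ExZ // Ex_cst.
have [_ _ H] := mdiff_failure k.
rewrite (H (fun w => x * x ^+ failure_run k w) (x * x ^+ k)).
- rewrite add0r.
  (* The bound is the fixed point of [u |-> p * x * u + 1]. *)
  have -> : (1 - p * x)^-1 = p * x * (1 - p * x)^-1 + 1 by field; rewrite gt_eqF.
  by rewrite lerD2r ler_wpM2l.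
- exact: (adapted_comp (fun n => x * x ^+ n) (@adapted_failure_run k)).
- move=> w; rewrite normrM ger0_norm; last lra.
  by rewrite ler_wpM2l //; [lra | exact: failure_run_pow_bound].
Qed.

End Law.

(** * Runs of failed transmissions *)

Section GeometricBounds.
Variable R : realType.

Lemma geometric_sum_le (r : R) N : 0 <= r < 1 -> \sum_(j < N) r ^+ j <= (1 - r)^-1.
Proof.
move=> /andP[r0 r1]; have d0 : 0 < 1 - r by lra.
rewrite -(ler_pM2r d0) mulVf ?gt_eqF //.
suff -> : (\sum_(j < N) r ^+ j) * (1 - r) = 1 - r ^+ N by rewrite gerBl exprn_ge0.
elim: N => [|N IH]; first by rewrite big_ord0 mul0r expr0 subrr.
by rewrite big_ord_recr /= mulrDl IH exprS; ring.
Qed.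

Lemma expr_unbounded (x y : R) : 1 < x -> exists n, y < x ^+ n.
Proof.
move=> x1; have y1 : 0 < (`|y| + 1)^-1 by rewrite invr_gt0 ltr_wpDl.
have /cvgrPdistC_le /(_ _ y1) [n _ /(_ n (leqnn n))] : (fun n => x^-1 ^+ n) @ \oo --> (0 : R).
  by apply: cvg_expr; rewrite ger0_norm ?invr_ge0 ?invf_lt1; lra.
rewrite /= subr0 ger0_norm ?exprn_ge0 ?invr_ge0; [|lra..].
rewrite exprVn lef_pV2 ?posrE ?exprn_gt0 ?ltr_wpDl //; [|lra..].
move=> H; exists n; apply: lt_le_trans H.
by rewrite (le_lt_trans (ler_norm y)) // ltrDl.
Qed.

Definition horizon (mu : R) j := (Num.truncn (mu ^+ j)).+1.

Lemma horizon_ge (mu : R) j : 0 <= mu -> mu ^+ j <= (horizon mu j)%:R.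
Proof.
by move=> mu0; have /andP[_ /ltW] := truncn_itv (exprn_ge0 j mu0).
Qed.

Lemma horizon_le (mu : R) j : 0 <= mu -> (horizon mu j)%:R <= mu ^+ j + 1.
Proof.
move=> mu0; have /andP[H _] := truncn_itv (exprn_ge0 j mu0).
by rewrite /horizon -natr1 lerD2r.
Qed.

(** Sums of nonnegative terms are monotone in [T], so a linear bound at the horizons extends to all
    times at the price of the factor [mu + 1]. *)
Lemma horizon_between (mu : R) J T : 1 < mu -> (horizon mu J < T)%N ->
  exists j, [/\ (J <= j)%N, (T <= horizon mu j)%N &
    (horizon mu j)%:R <= (mu + 1) * T%:R].
Proof.
move=> mu1 JT; have mu0 : 0 <= mu by lra.
have ex : exists j, (T <= horizon mu j)%N.
  have [n Hn] := expr_unbounded T%:R mu1.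
  by exists n; rewrite -(ler_nat R) (le_trans (ltW Hn)) // horizon_ge.
have [j Hj jmin] := ex_minnP ex.
have T1 : 1 <= T%:R :> R by rewrite ler1n (leq_trans _ JT).
have Jj : (J < j)%N.
  rewrite ltnNge; apply/negP => jJ.
  have : (horizon mu j <= horizon mu J)%N.
    by rewrite /horizon ltnS; apply: le_truncn; rewrite ler_weXn2l // ltW.
  by move=> /(leq_trans Hj); rewrite leqNgt JT.
case: j => // j in Hj jmin Jj *.
exists j.+1; split => //; first exact: ltnW.
have jT : (horizon mu j < T)%N by rewrite ltnNge; apply/negP => /jmin; rewrite ltnn.
apply: (le_trans (horizon_le _ mu0)); rewrite exprS.
have : mu ^+ j <= T%:R.
  by apply: (le_trans (horizon_ge _ mu0)); rewrite ler_nat ltnW.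
nra.
Qed.

End GeometricBounds.

Section CostSplit.
Variables (R : realType) (c : nat -> R).
Hypotheses (c0 : 0 <= c 0%N) (cS : forall t, c t <= c t.+1).

Lemma cost_truncated t N :
  c 0%N + \sum_(s < N) (c s.+1 - c s) * (s.+1 <= t)%N%:R = c (minn t N).
Proof.
elim: N => [|N IH]; first by rewrite big_ord0 addr0 minn0.
rewrite big_ord_recr /= addrA IH; case: ltnP => tN.
  by rewrite mulr1 (minn_idPr tN) addrC subrK.
by rewrite mulr0 addr0 (minn_idPl (leqW tN)).
Qed.

Lemma cost_homo s t : (s <= t)%N -> c s <= c t.
Proof.
elim: t => [|t IH]; first by rewrite leqn0 => /eqP ->.
rewrite leq_eqVlt => /orP[/eqP ->//|]; rewrite ltnS => /IH /le_trans; apply.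
exact: cS.
Qed.

Lemma cost_ge0 t : 0 <= c t.
Proof. by apply: (le_trans c0); exact: cost_homo. Qed.

Lemma cost_truncated_le t N :
  c 0%N + \sum_(s < N) (c s.+1 - c s) * (s.+1 <= t)%N%:R <= c t.
Proof. by rewrite cost_truncated cost_homo // geq_minl. Qed.

(** Beyond [N], raising the base from [la] to [la'] gains a factor [(la / la')^N]; what is left is
    an exponential moment of base [la']. *)
Lemma cost_le_truncated (K la la' : R) t N : 0 <= K -> 0 <= la <= la' -> 0 < la' ->
  (forall s, c s <= K * la ^+ s) ->
  c t <= c 0%N + \sum_(s < N) (c s.+1 - c s) * (s.+1 <= t)%N%:R
    + K * (la / la') ^+ N * la' ^+ t.
Proof.
move=> K0 /andP[la0 lala'] la'0 cK; rewrite cost_truncated.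
have r0 : 0 <= la / la' by rewrite divr_ge0 // ltW.
have rest : 0 <= K * (la / la') ^+ N * la' ^+ t.
  by rewrite !mulr_ge0 ?exprn_ge0 // ltW.
have [tN|Nt] := leqP t N; first by rewrite lerDl.
rewrite -[leLHS]add0r; apply: lerD; first exact: cost_ge0.
apply: (le_trans (cK t)); rewrite -mulrA; apply: ler_wpM2l => //.
rewrite -(subnK (ltnW Nt)) addnC exprD [la' ^+ _]exprD mulrA -exprMn divfK ?gt_eqF //.
apply: ler_wpM2l; first by rewrite exprn_ge0.
by rewrite lerXn2r ?nnegrE // ltW.
Qed.

Lemma cost_minorant_avg (tau : nat -> nat) N T : (0 < T)%N ->
  cost_minorant c (fun t => avg (fun k => (t <= tau k)%N%:R)) N T =
  avg (fun k => c 0%N + \sum_(s < N) (c s.+1 - c s) * (s.+1 <= tau k)%N%:R) T.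
Proof.
move=> T0; rewrite avgD avg_cst // /cost_minorant; congr (_ + _).
by rewrite avg_sum; apply: eq_bigr => i _; rewrite avgZ.
Qed.

End CostSplit.

Section RunAverage.
Context {d : measure_display} {Omega : measurableType d} {R : realType}.
Variables (tau : nat -> Omega -> nat) (act : nat -> Omega -> bool).
Hypothesis htau : forall k, measurable_fun setT (tau k).
Hypothesis hact : forall k, measurable_fun setT (act k).
Variables (rs : R) (f : policy R) (P : probability Omega R).
Hypotheses (hrs : 0 < rs <= 1) (hf : admissible f).
Hypothesis hlaw : is_policy_law tau act rs f P.

Local Notation run := (failure_run tau act).
Local Notation adapted := (adapted tau act).
Local Notation mdiff := (mdiff tau act P).
Local Notation decision := (decision tau act f).
Local Notation failure := (fails tau act).

(** From [K] on, a state without transmission is below [t0], so its successor is at most [t0]; with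
    a transmission, the state either returns to 0 or grows together with the run. *)
Lemma tau_le_run w t0 K :
  (forall k, tau k.+1 w = if succeeds tau act k w then 0%N else (tau k w).+1) ->
  (tau K w <= t0)%N ->
  (forall k, (K <= k)%N -> (t0 <= tau k w)%N -> act k w) ->
  forall k, (K <= k)%N -> (tau k w <= t0 + run k w)%N.
Proof.
move=> dyn K0 Kact; elim => [|k IH]; first by rewrite leqn0 => /eqP <-; rewrite (leq_trans K0) ?leq_addr.
rewrite leq_eqVlt => /orP[/eqP <-|Kk]; first by rewrite (leq_trans K0) ?leq_addr.
rewrite ltnS in Kk; have := dyn k; rewrite /= /fails /succeeds.
case: (act k w) (Kact k Kk) => /= Ha.
  case: eqP => [->//|_ E]; rewrite E /= addnS ltnS; exact: IH.
move=> ->; rewrite addn0 ltnNge; apply/negP => /Ha //.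
Qed.

Variables (p la : R).
Hypotheses (rsp : 1 - rs <= p) (p0 : 0 < p) (la1 : 1 < la) (pla : p * la < 1).

Let X k w : R := (failure k w)%:R - (1 - rs) * decision k w.

Let X1 k w : `|X k w| <= 1.
Proof.
have /andP[rs0 rs1] := hrs; have /andP[d0 d1] := decision_itv tau act hf k w.
apply: norm_diff_itv; first exact: bool_itv.
by apply/andP; split; [apply: mulr_ge0 | apply: mulr_ile1] => //; lra.
Qed.

Let wt j k w : R := (run k w < j)%N%:R * (la * la ^+ run k w).

Let la0 : 0 <= la. Proof. by apply: ltW; exact: lt_trans ltr01 la1. Qed.

Let wt_mdiff j : mdiff (fun k w => wt j k w * X k w).
Proof.
apply: (mdiff_weight (D := fun k => la * la ^+ k)).
- exact: (mdiff_failure htau hact hrs hf hlaw).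
- by move=> k w w' H; rewrite /wt (adapted_failure_run H).
- move=> k w; rewrite /wt normrM [X in _ * X]normrM (ger0_norm la0).
  have H : la * `|la ^+ run k w| <= la * la ^+ k.
    by apply: ler_wpM2l => //; apply: failure_run_pow_bound; exact: ltW.
  case: (_ < _)%N; rewrite ?normr1 ?normr0 ?mul1r ?mul0r // mulr_ge0 // exprn_ge0 //.
Qed.

(** The square has base [la ^+ 2], and [p * la ^+ 2] may exceed 1. Truncation bounds one of the two
    factors by [la ^+ j] and leaves the controlled moment of base [la]. *)
Let wt_l2 j T : Ex P (fun w => (\sum_(k < T) wt j k w * X k w) ^+ 2) <=
  T%:R * (la ^+ 2 * la ^+ j * (1 - p * la)^-1).
Proof.
rewrite (mdiff_l2 htau hact T (wt_mdiff j)).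
rewrite mulr_natl -[in leRHS](card_ord T) -sumr_const; apply: ler_sum => k _.
have bU := brv_failure_run htau hact k (ltW la1).
apply: (@le_trans _ _ (Ex P (fun w => la ^+ 2 * la ^+ j * la ^+ run k w))).
  apply: le_Ex; [exact/brvX/(mdiff_brv htau hact k (wt_mdiff j)) | exact: brvZ |].
  move=> w; rewrite exprMn -[leRHS]mulr1; apply: ler_pM; rewrite ?sqr_ge0 //; last first.
    by rewrite -[X k w ^+ 2]ger0_norm ?sqr_ge0 // normrX expr_le1.
  rewrite /wt; case: ltnP => H; last by rewrite mul0r expr0n /= !mulr_ge0 ?exprn_ge0.
  rewrite mul1r exprMn -mulrA; apply: ler_wpM2l; first by rewrite exprn_ge0.
  rewrite expr2; apply: ler_wpM2r; first by rewrite exprn_ge0.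
  by rewrite ler_weXn2l ?(ltW la1) // ltnW.
rewrite ExZ //; apply: ler_wpM2l; first by rewrite mulr_ge0 // exprn_ge0.
exact: (Ex_failure_run htau hact hrs hf hlaw k rsp (ltW la1) pla).
Qed.

(** Sum of the drift inequality; the shift by one step telescopes, and the truncation is invisible
    as long as all runs are shorter than [j]. *)
Let run_sum_le j T w : (forall k, (k < T)%N -> (run k w < j)%N) ->
  (1 - p * la) * \sum_(k < T) la ^+ run k w <=
  1 + T%:R + \sum_(k < T) wt j k w * X k w.
Proof.
move=> runj.
have step : \sum_(k < T) la ^+ run k.+1 w <=
    \sum_(k < T) (wt j k w * X k w + p * la * la ^+ run k w + 1).
  apply: ler_sum => k _; apply: (le_trans (failure_run_step tau act hrs hf k w rsp (ltW la1))).
  by rewrite /wt runj // mul1r.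
have tel : \sum_(k < T) la ^+ run k.+1 w =
    \sum_(k < T) la ^+ run k w + (la ^+ run T w - 1).
  have := telescope_sumr (fun k => la ^+ run k w) (leq0n T).
  by rewrite big_mkord sumrB /= expr0 => <-; rewrite addrC subrK.
have UT : 0 <= la ^+ run T w by rewrite exprn_ge0.
move: step; rewrite tel !big_split /= -mulr_sumr sumr_const card_ord.
rewrite mulrBl mul1r; lra.
Qed.

(* For the horizons T_j of order mu^j, with la < mu < 1/p, runs longer than j
   are summably rare, and the martingale part truncated at level j, whose
   second moment is of order T_j * la^j, is of order T_j. *)
Lemma ae_failure_run_avg :
  {ae P, forall w, exists C, \forall T \near \oo, avg (fun k => la ^+ run k w) T <= C}.
Proof.
have la1' := la1; have pla' := pla; have p0' := p0.
(* The bases satisfy [la < mu < mu' < 1/p]: the ratio [la / mu] makes large martingale sums summably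
   rare, and [mu / mu'] does the same for long runs. *)
pose mu := (la + p^-1) / 2; pose mu' := (mu + p^-1) / 2.
have lap : la < p^-1 by rewrite -(ltr_pM2l p0) divff ?gt_eqF.
have lamu : la < mu by rewrite /mu; lra.
have mumu' : mu < mu' by rewrite /mu' /mu; lra.
have pmu' : p * mu' < 1.
  by rewrite -(divff (lt0r_neq0 p0)) ltr_pM2l // /mu' /mu; lra.
have mu0 : 0 <= mu by lra.
pose Tj := horizon mu.
have Tj0 j : 0 < (Tj j)%:R :> R by rewrite ltr0n.
have muj j : 0 < mu ^+ j by rewrite exprn_gt0 //; lra.
have mu'j j : 0 < mu' ^+ j by rewrite exprn_gt0 //; lra.
pose C := (1 - p * la)^-1; pose C' := (1 - p * mu')^-1.
have C0 : 0 < C by rewrite invr_gt0; lra.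
have C'0 : 0 < C' by rewrite invr_gt0; lra.
pose M j w := \sum_(k < Tj j) wt j k w * X k w.
have bM j : brv (M j).
  by apply: (brv_sum (F := fun k w => wt j k w * X k w)) => k;
    exact: (mdiff_brv htau hact k (wt_mdiff j)).
pose A j := [set w | (Tj j)%:R < `|M j w|].
pose Y j w := \sum_(k < Tj j) mu' ^+ run k w.
have bY j : brv (Y j).
  by apply: (brv_sum (F := fun k w => mu' ^+ run k w)) => k; apply: brv_failure_run => //; lra.
(* A single run of length at least [j] before the horizon already puts the outcome in [B j]. *)
pose B j := [set w | mu' ^+ j <= Y j w].
have aM j : adapted (Tj j) (M j).
  apply: adapted_sum => k; have [aX _ _] := wt_mdiff j k; exact: (adaptedW _ aX).
have aY j : adapted (Tj j) (Y j).
  apply: adapted_sum => k w w' H.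
  by rewrite (adapted_failure_run (hist_le (ltnW (ltn_ord k)) H)).
have mA j : measurable (A j).
  by apply: (measurable_adapted htau hact (k := Tj j)) => w w' /aM ->.
have mB j : measurable (B j).
  by apply: (measurable_adapted htau hact (k := Tj j)) => w w' /aY ->.
have PA j : (P (A j) <= (la ^+ 2 * C * (la / mu) ^+ j)%:E)%E.
  apply: (le_trans (chebyshev_sqr (bM j) (Tj0 j) (wt_l2 j (Tj j)))).
  rewrite lee_fin -/C expr_div_n.
  have -> : (Tj j)%:R * (la ^+ 2 * la ^+ j * C) / (Tj j)%:R ^+ 2 =
      la ^+ 2 * C * (la ^+ j / (Tj j)%:R) by field; rewrite gt_eqF.
  apply: ler_wpM2l; first by rewrite mulr_ge0 ?sqr_ge0 // ltW.
  apply: ler_wpM2l; first by rewrite exprn_ge0 //; lra.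
  by rewrite lef_pV2 ?posrE // horizon_ge.
have PB j : (P (B j) <= (2 * C' * (mu / mu') ^+ j)%:E)%E.
  have EY : Ex P (Y j) <= (Tj j)%:R * C'.
    rewrite Ex_sum; last by move=> k; apply: brv_failure_run => //; lra.
    rewrite mulr_natl -[in leRHS](card_ord (Tj j)) -sumr_const; apply: ler_sum => k _.
    by apply: (Ex_failure_run htau hact hrs hf hlaw k rsp) => //; lra.
  have Y0 w : 0 <= Y j w by apply: sumr_ge0 => k _; rewrite exprn_ge0 //; lra.
  apply: (le_trans (markov_pow (bY j) Y0 (mu'j j) EY)).
  rewrite lee_fin.
  have -> : 2 * C' * (mu / mu') ^+ j = (2 * mu ^+ j) * C' / mu' ^+ j.
    by rewrite expr_div_n; move: (mu' ^+ j)^-1 => z; ring.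
  apply: ler_wpM2r; first by rewrite invr_ge0 ltW.
  apply: ler_wpM2r; first exact: ltW.
  apply: (le_trans (horizon_le j mu0)).
  have : 1 <= mu ^+ j by rewrite exprn_ege1 //; lra.
  rewrite mulr_natl mulr2n; lra.
have geo (K r : R) N : 0 <= K -> 0 <= r < 1 -> \sum_(j < N) K * r ^+ j <= K * (1 - r)^-1.
  by move=> K0 r01; rewrite -mulr_sumr ler_wpM2l // geometric_sum_le.
have r1 : 0 <= la / mu < 1 by apply/andP; split; [apply: divr_ge0 | rewrite ltr_pdivrMr ?mul1r]; lra.
have r2 : 0 <= mu / mu' < 1 by apply/andP; split; [apply: divr_ge0 | rewrite ltr_pdivrMr ?mul1r]; lra.
have HA := borel_cantelli mA PA (fun N => geo _ _ N (mulr_ge0 (sqr_ge0 la) (ltW C0)) r1).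
have HB := borel_cantelli mB PB (fun N => geo _ _ N (mulr_ge0 (ler0n R 2) (ltW C'0)) r2).
move: HA HB; apply: filterS2 => w HAw HBw.
have [J _ HJ] : \forall j \near \oo, ~ A j w /\ ~ B j w.
  by near=> j; split; near: j.
(* The 3 bounds [1 + Tj + M] by [3 * Tj], [C] comes from the drift, and [mu + 1] from the nearest
   horizon. *)
exists (3 * C * (mu + 1)); exists (Tj J).+1 => // T /= JT.
have mu1 : 1 < mu by lra.
have [j [Jj TTj TjT]] := horizon_between mu1 JT.
have [NA NB] := HJ j Jj.
have runj k : (k < Tj j)%N -> (run k w < j)%N.
  move=> kT; rewrite ltnNge; apply/negP => jk; apply: NB.
  rewrite /B /= /Y (bigD1 (Ordinal kT)) //=.
  rewrite -[leLHS]addr0; apply: lerD.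
    by rewrite ler_weXn2l //; lra.
  by apply: sumr_ge0 => i _; rewrite exprn_ge0 //; lra.
have := run_sum_le runj; rewrite -/(M j w).
have MT : M j w <= (Tj j)%:R.
  by rewrite (le_trans (ler_norm _)) // leNgt; apply/negP.
have T1 : 1 <= (Tj j)%:R :> R by rewrite ler1n.
move=> H.
have H2 : \sum_(k < Tj j) la ^+ run k w <= 3 * C * (Tj j)%:R.
  rewrite -(ler_pM2l (_ : 0 < 1 - p * la)); last lra.
  rewrite mulrAC [3 * _ * C]mulrC mulrA /C divff ?mul1r; last by rewrite gt_eqF //; lra.
  lra.
have T0 : 0 < T%:R :> R by rewrite ltr0n (leq_trans _ JT).
rewrite /avg mulrC ler_pdivrMr // -[leRHS]mulrA.
apply: (le_trans (_ : _ <= \sum_(k < Tj j) la ^+ run k w)).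
  rewrite -(big_mkord xpredT (fun k => la ^+ run k w)) -(big_mkord xpredT (fun k => la ^+ run k w)).
  rewrite [leRHS](@big_cat_nat _ _ _ T) //= lerDl sumr_ge0 // => i _.
  by rewrite exprn_ge0 //; lra.
apply: (le_trans H2); apply: ler_wpM2l => //.
by rewrite mulr_ge0 // ltW.
Unshelve. all: by end_near.
Qed.

End RunAverage.

(** * Lower bound for feasible policies *)

Section AlmostEverywhere.
Context {d : measure_display} {Omega : measurableType d} {R : realType}.
Variable P : probability Omega R.
Implicit Types X Y : Omega -> R.

Lemma Ex_ae_eq X Y : brv X -> brv Y -> {ae P, forall w, X w = Y w} -> Ex P X = Ex P Y.
Proof.
move=> [mX _] [mY _] XY; congr fine; apply: ae_eq_integral => //.
- exact/measurable_EFinP.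
- exact/measurable_EFinP.
- by apply: filterS XY => w -> _.
Qed.

Lemma le_Ex_ae X Y : brv X -> brv Y -> {ae P, forall w, X w <= Y w} -> Ex P X <= Ex P Y.
Proof.
move=> bX bY XY.
have bM : brv (fun w => Num.max (X w) (Y w)).
  have [mX [C HC]] := bX; have [mY [D HD]] := bY; split.
    exact: (measurable_maxr mX mY).
  exists (Num.max C D) => w; rewrite le_max.
  by case: (leP (X w) (Y w)) => _; rewrite ?HC ?HD ?orbT.
rewrite -(Ex_ae_eq bM bY); first by apply: le_Ex => // w; rewrite le_max lexx.
by apply: filterS XY => w /max_idPr.
Qed.

Lemma integral_Ex X : brv X -> (\int[P]_w (X w)%:E = (Ex P X)%:E)%E.
Proof. by move=> bX; rewrite -expectation_Ex // unlock. Qed.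

Lemma expectationE X : ('E_P[X] = \int[P]_w (X w)%:E)%E.
Proof. by rewrite unlock. Qed.

Lemma bounded_cvg_Ex (X : nat -> Omega -> R) (l C : R) :
  (forall T, brv (X T)) -> (forall T w, `|X T w| <= C) ->
  {ae P, forall w, (X^~ w) @ \oo --> l} -> (fun T => Ex P (X T)) @ \oo --> l.
Proof.
move=> bX XC Xl.
have mX T : measurable_fun setT (fun w => (X T w)%:E).
  by apply/measurable_EFinP; have [] := bX T.
have mc : measurable_fun setT (fun _ : Omega => l%:E) by exact: measurable_cst.
have H1 : {ae P, forall w, setT w -> (X T w)%:E @[T --> \oo] --> l%:E}.
  by apply: filterS Xl => w Hw _; apply: cvg_EFin => //; exact: nearW.
have H2 : {ae P, forall w n, setT w -> (`|(X n w)%:E| <= C%:E)%E}.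
  by apply: aeW => w T _; rewrite lee_fin.
have [_ _] := dominated_convergence measurableT mX mc H1
  (finite_measure_integrable_cst P C measurableT) H2.
rewrite (_ : (fun T => _) = (fun T => (Ex P (X T))%:E)); last first.
  by apply/funext => T; rewrite integral_Ex.
have -> : (\int[P]_(x in setT) l%:E = l%:E)%E.
  by rewrite (integral_Ex (brv_cst l)) Ex_cst.
by move=> /fine_cvgP[].
Qed.

End AlmostEverywhere.

Section SequenceTails.
Variable R : realType.
Implicit Types u : nat -> R.

Lemma near_inv_le (e : R) : 0 < e -> \forall T \near \oo, (T%:R : R)^-1 <= e.
Proof.
move=> e0; near=> T.
have H : e^-1 <= T%:R by near: T; exact: nbhs_infty_ger.
by rewrite -[leRHS]invrK lef_pV2 // ?posrE ?invr_gt0 // (lt_le_trans _ H) ?invr_gt0.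
Unshelve. all: by end_near.
Qed.

Lemma avg_le_shift u T : (forall k, 0 <= u k) -> u 0%N <= 1 ->
  avg u T <= avg (fun k => u k.+1) T + T%:R^-1.
Proof.
move=> u0 u1; rewrite /avg -[X in _ + X]mulr1 -mulrDr; apply: ler_wpM2l; first by rewrite invr_ge0.
have := telescope_sumr u (leq0n T); rewrite big_mkord sumrB => E.
by have := u0 T; lra.
Qed.

Lemma avg_ge_shift u T : (forall k, 0 <= u k <= 1) ->
  avg (fun k => u k.+1) T - T%:R^-1 <= avg u T.
Proof.
move=> u01; rewrite /avg -[X in _ - X]mulr1 -mulrBr; apply: ler_wpM2l; first by rewrite invr_ge0.
have := telescope_sumr u (leq0n T); rewrite big_mkord sumrB => E.
by have := u01 T; have := u01 0%N; lra.
Qed.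

End SequenceTails.

Section LowerBound.
Context {d : measure_display} {Omega : measurableType d} {R : realType}.
Variables (tau : nat -> Omega -> nat) (act : nat -> Omega -> bool).
Hypothesis htau : forall k, measurable_fun setT (tau k).
Hypothesis hact : forall k, measurable_fun setT (act k).
Variables (rs : R) (f : policy R) (P : probability Omega R).
Hypotheses (hrs : 0 < rs <= 1) (hf : admissible f).
Hypothesis hlaw : is_policy_law tau act rs f P.

Local Notation success := (succeeds tau act).
Let I k t w : R := (t <= tau k w)%N%:R.
Let D k w : R := (act k w)%:R * ((success k w)%:R - rs).

Definition tail_prob k t := Ex P (fun w => (t <= tau k w)%N%:R).

Lemma adapted_tail k t : adapted tau act k (fun w => (t <= tau k w)%N%:R : R).
Proof. by move=> w w' H; rewrite (hist_tau (leqnn _) H). Qed.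

Lemma brv_tail k t : brv (fun w => (t <= tau k w)%N%:R : R).
Proof.
apply: (adapted_brv htau hact (C := 1) (@adapted_tail k t)) => w.
by case: (_ <= _)%N; rewrite ?normr1 ?normr0.
Qed.

Lemma brv_act k : brv (fun w => (act k w)%:R : R).
Proof. by apply: brv_bool; exact: (measurable_act hact k true). Qed.

Let bD k : brv (D k).
Proof. exact: (mdiff_brv htau hact k (mdiff_success htau hact hrs hlaw)). Qed.

Let ED0 k t : Ex P (fun w => I k t w * D k w) = 0.
Proof.
have [_ _ H] := mdiff_success htau hact hrs hlaw k.
apply: (H _ 1); first exact: adapted_tail.
by move=> w; rewrite /I; case: (_ <= _)%N; rewrite ?normr1 ?normr0.
Qed.

Lemma tail_prob_itv k t : 0 <= tail_prob k t <= 1.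
Proof.
apply/andP; split; first by apply: Ex_ge0 => w.
rewrite -[leRHS](Ex_cst P); apply: le_Ex; [exact: brv_tail|exact: brv_cst|].
by move=> w; case: (_ <= _)%N.
Qed.

Lemma tail_prob0 k : tail_prob k 0 = 1.
Proof. by rewrite /tail_prob -[RHS](Ex_cst P). Qed.

Lemma tail_prob_nonincreasing k t : tail_prob k t.+1 <= tail_prob k t.
Proof.
apply: le_Ex; [exact: brv_tail..|] => w; rewrite ler_nat.
by case: ltnP => // /ltnW ->.
Qed.

Lemma tail_prob_step k t : (1 - rs) * tail_prob k t <= tail_prob k.+1 t.+1.
Proof.
have /andP[rs0 rs1] := hrs.
have bID : brv (fun w => I k t w * D k w) by apply: brvM => //; exact: brv_tail.
have bI : brv (fun w => (1 - rs) * I k t w) by apply: brvZ; exact: brv_tail.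
apply: (@le_trans _ _ (Ex P (fun w => (1 - rs) * I k t w - I k t w * D k w))).
  by rewrite ExB // ED0 subr0 ExZ //; exact: brv_tail.
apply: le_Ex_ae; [exact: brvB|exact: brv_tail|].
apply: filterS (ae_dynamics htau hact hlaw) => w /(_ k).
rewrite /D /I /succeeds => ->.
by case: (act k w); case: (tau k.+1 w == 0)%N => /=; rewrite ?ltnS;
  case: (t <= tau k w)%N => /=; lra.
Qed.

Lemma tail_prob_success k : 1 - tail_prob k.+1 1 = rs * Ex P (fun w => (act k w)%:R).
Proof.
have bI0 : brv (fun w => I k 0 w * D k w) by apply: brvM => //; exact: brv_tail.
suff -> : tail_prob k.+1 1 = Ex P (fun w => 1 - (I k 0 w * D k w + rs * (act k w)%:R)).
  rewrite ExB; [|exact: brv_cst|by apply: brvD => //; apply: brvZ; exact: brv_act].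
  rewrite ExD //; last by apply: brvZ; exact: brv_act.
  rewrite ED0 Ex_cst ExZ; last exact: brv_act.
  ring.
apply: Ex_ae_eq; first exact: brv_tail.
  apply: brvB; first exact: brv_cst.
  by apply: brvD => //; apply: brvZ; exact: brv_act.
apply: filterS (ae_dynamics htau hact hlaw) => w /(_ k).
rewrite /D /I /succeeds => ->.
by case: (act k w); case: (tau k.+1 w == 0)%N => /=; ring.
Qed.

(** A positive state can only be entered from its predecessor; hence no state is, on average, more
    frequent than 0. *)
Lemma point_prob_step k t :
  tail_prob k.+1 t.+1 - tail_prob k.+1 t.+2 <= tail_prob k t - tail_prob k t.+1.
Proof.
rewrite -!ExB; [|exact: brv_tail..].
apply: le_Ex_ae; [by apply: brvB; exact: brv_tail..|].
apply: filterS (ae_dynamics htau hact hlaw) => w /(_ k) ->.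
case: (success k w) => /=; last by rewrite !ltnS.
rewrite subr0 subr_ge0 ler_nat; by case: ltnP => // /ltnW ->.
Qed.

Let M t T := avg (fun k => tail_prob k t) T.
Let rate T := avg (fun k => Ex P (fun w => (act k w)%:R)) T.

Let M_step t T : (1 - rs) * M t T - T%:R^-1 <= M t.+1 T.
Proof.
apply: le_trans (avg_ge_shift _ _); last by move=> k; exact: tail_prob_itv.
rewrite lerD2r -avgZ; apply: le_avg => k _; exact: tail_prob_step.
Qed.

Let point k t := tail_prob k t - tail_prob k t.+1.

Let point_ge0 k t : 0 <= point k t.
Proof. by rewrite subr_ge0 tail_prob_nonincreasing. Qed.

Let point_le1 k t : point k t <= 1.
Proof. by have := tail_prob_itv k t; have := tail_prob_itv k t.+1; rewrite /point; lra. Qed.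

Let point0_le T : avg (fun k => point k 0) T <= rs * rate T + T%:R^-1.
Proof.
apply: (le_trans (avg_le_shift T (fun k => point_ge0 k 0) (point_le1 _ _))).
rewrite lerD2r /rate -avgZ; apply: le_avg => k _.
by rewrite /point tail_prob0 tail_prob_success.
Qed.

Let pointS_le t T : avg (fun k => point k t.+1) T <= avg (fun k => point k t) T + T%:R^-1.
Proof.
apply: (le_trans (avg_le_shift T (fun k => point_ge0 k t.+1) (point_le1 _ _))).
by rewrite lerD2r; apply: le_avg => k _; exact: point_prob_step.
Qed.

Lemma feasible_tail (b : R) : 0 < b ->
  (forall e, 0 < e -> \forall T \near \oo, rate T <= b + e) ->
  forall t e, 0 < e -> \forall T \near \oo, tail rs b t - e <= M t T.
Proof.
move=> hb Hrate; have /andP[rs0 rs1] := hrs.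
have Hpoint t e : 0 < e -> \forall T \near \oo, avg (fun k => point k t) T <= rs * b + e.
  elim: t e => [|t IH] e e0; near=> T.
    apply: (le_trans (point0_le T)).
    have H1 : rate T <= b + e / 2 by near: T; apply: Hrate; lra.
    have H2 : T%:R^-1 <= e / 2 by near: T; apply: near_inv_le; lra.
    have := ler_wpM2l (ltW rs0) H1; have : rs * (e / 2) <= e / 2 by rewrite ler_piMl //; lra.
    rewrite mulrDr; lra.
  apply: (le_trans (pointS_le t T)).
  have H1 : avg (fun k => point k t) T <= rs * b + e / 2 by near: T; apply: IH; lra.
  have H2 : T%:R^-1 <= e / 2 by near: T; apply: near_inv_le; lra.
  lra.
have Hlin t e : 0 < e -> \forall T \near \oo, 1 - t%:R * (rs * b) - e <= M t T.
  elim: t e => [|t IH] e e0; near=> T.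
    have T0 : (0 < T)%N by near: T; exact: nbhs_infty_gt.
    have -> : M 0 T = 1.
      by rewrite /M (eq_avg (v := fun=> 1)) ?avg_cst // => k; exact: tail_prob0.
    by rewrite mul0r; lra.
  have H1 : 1 - t%:R * (rs * b) - e / 2 <= M t T by near: T; apply: IH; lra.
  have H2 : avg (fun k => point k t) T <= rs * b + e / 2 by near: T; apply: Hpoint; lra.
  have : avg (fun k => point k t) T = M t T - M t.+1 T by rewrite /point avgB.
  by rewrite -natr1; lra.
elim=> [|t IH] e e0.
  by apply: filterS (Hlin 0%N e e0) => T; rewrite mul0r subr0.
near=> T; rewrite /= lerBlDr ge_max; apply/andP; split; rewrite -lerBlDr.
  have H1 : tail rs b t - e / 2 <= M t T by near: T; apply: IH; lra.
  have H2 : T%:R^-1 <= e / 2 by near: T; apply: near_inv_le; lra.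
  apply: le_trans (M_step t T).
  have r1 : 0 <= 1 - rs by lra.
  have := ler_wpM2l r1 H1; have : (1 - rs) * (e / 2) <= e / 2 by rewrite ler_piMl //; lra.
  rewrite mulrBr; lra.
by near: T; exact: Hlin.
Unshelve. all: by end_near.
Qed.

Lemma expected_rateE T :
  ((T%:R^-1)%:E * 'E_P[fun w => (\sum_(k < T) (act k w)%:R)%R])%E = (rate T)%:E.
Proof.
rewrite expectation_Ex; last first.
  by apply: (brv_sum (F := fun k w => (act k w)%:R)) => k; exact: brv_act.
rewrite Ex_sum; last by move=> k; exact: brv_act.
by rewrite -EFinM.
Qed.

Lemma feasible_error_ge (c : nat -> R) (b : R) : 0 < b ->
  0 <= c 0%N -> (forall t, c t <= c t.+1) ->
  (limn_esup (fun T : nat =>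
    ((T%:R^-1)%:E * 'E_P[fun w => (\sum_(k < T) (act k w)%:R)%R])%E) <= b%:E)%E ->
  (tail_cost c (tail rs b) <= limn_esup (fun T : nat =>
    ((T%:R^-1)%:E * 'E_P[fun w => (\sum_(k < T) c (tau k w))%R])%E))%E.
Proof.
move=> hb c0 cS Hb; have /andP[rs0 rs1] := hrs.
have g0 t : 0 <= tail rs b t.
  by apply: le_trans (tail_pow b hrs t); rewrite exprn_ge0; lra.
apply: (tail_cost_le_limsup g0 cS (M := M)).
- apply: feasible_tail => // e e0.
  have lt : (b%:E < (b + e)%:E)%E by rewrite lte_fin ltrDl.
  have [N HN] := limn_esup_ltP (le_lt_trans Hb lt).
  exists N => // T /= NT; have := HN _ NT.
  by rewrite expected_rateE lte_fin => /ltW.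
- move=> N; near=> T.
  have T0 : (0 < T)%N by near: T; exact: nbhs_infty_gt.
  pose Y k w := c 0%N + \sum_(s < N) (c s.+1 - c s) * (s.+1 <= tau k w)%N%:R.
  have bs k s : brv (fun w => (c s.+1 - c s) * (s.+1 <= tau k w)%N%:R).
    by apply: brvZ; exact: brv_tail.
  have bY k : brv (Y k).
    apply: brvD; first exact: brv_cst.
    by apply: (brv_sum (F := fun s w => (c s.+1 - c s) * (s.+1 <= tau k w)%N%:R)) => s.
  have -> : (cost_minorant c M N T)%:E =
      ((T%:R^-1)%:E * 'E_P[fun w => (\sum_(k < T) Y k w)%R])%E.
    rewrite expectation_Ex; last exact: (brv_sum (F := Y)).
    rewrite Ex_sum // -EFinM -[_ * _]/(avg (fun k => Ex P (Y k)) T).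
    have -> : avg (fun k => Ex P (Y k)) T =
        avg (fun k => c 0%N + \sum_(s < N) (c s.+1 - c s) * tail_prob k s.+1) T.
      apply: eq_avg => k; rewrite ExD; [|exact: brv_cst|exact: brv_sum].
      rewrite Ex_cst Ex_sum //; congr (_ + _); apply: eq_bigr => s _.
      by rewrite ExZ //; exact: brv_tail.
    rewrite avgD avg_cst // avg_sum /cost_minorant; congr (_ + _)%:E.
    by apply: eq_bigr => s _; rewrite avgZ.
  apply: lee_wpmul2l; first by rewrite lee_fin invr_ge0.
  have mc : measurable_fun setT (fun w => \sum_(k < T) c (tau k w)).
    move=> _ B mB; rewrite setTI.
    apply: (measurable_adapted htau hact (k := T) (A := fun w => B (\sum_(k < T) c (tau k w)))).
    move=> w w' H; congr B; apply: eq_bigr => k _.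
    by rewrite (hist_tau (ltnW (ltn_ord k)) H).
  (* The cost is not bounded as a function of the outcome and its mean may be infinite, so extended
     integrals are compared. *)
  rewrite !expectationE; apply: ge0_le_integral => //.
  + move=> w _; rewrite lee_fin; apply: sumr_ge0 => k _; rewrite /Y cost_truncated.
    exact: cost_ge0.
  + apply/measurable_EFinP.
    exact: (proj1 (@brv_sum _ _ _ T (fun k : 'I_T => Y k) (fun k => bY k))).
  + exact/measurable_EFinP.
  + by move=> w _; rewrite lee_fin; apply: ler_sum => k _; exact: cost_truncated_le.
Unshelve. all: by end_near.
Qed.

End LowerBound.

(** * Policies with convergent rules *)

Section ConvergentRules.
Context {d : measure_display} {Omega : measurableType d} {R : realType}.
Variables (tau : nat -> Omega -> nat) (act : nat -> Omega -> bool).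
Hypothesis htau : forall k, measurable_fun setT (tau k).
Hypothesis hact : forall k, measurable_fun setT (act k).
Variables (rs : R) (f : policy R) (P : probability Omega R).
Hypotheses (hrs : 0 < rs <= 1) (hf : admissible f).
Hypothesis hlaw : is_policy_law tau act rs f P.
Variables (b : R) (t0 : nat) (rule : nat -> Omega -> nat -> R).
Hypothesis hb : 0 < b.
Hypothesis t0_gt : (b^-1 - 1) / rs < t0%:R.
Hypothesis lt_t0 : forall t, (t < t0)%N -> t%:R <= (b^-1 - 1) / rs.
Hypothesis ruleE : forall k w, decision tau act f k w = rule k w (tau k w).

Local Notation success := (succeeds tau act).
Local Notation run := (failure_run tau act).

Section AlmostSure.
Hypothesis rule_cvg : {ae P, forall w t,
  (fun k => rule k w t) @ \oo --> threshold_rule b rs t}.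
Hypothesis rule_one : {ae P, forall w,
  \forall k \near \oo, forall t, (t0 <= t)%N -> rule k w t = 1}.

Let weighted_mdiff_avg (X : nat -> Omega -> R) : mdiff tau act P X ->
  (forall k w, `|X k w| <= 1) ->
  {ae P, forall w t, avg (fun k => (t <= tau k w)%N%:R * X k w) @ \oo --> (0 : R)}.
Proof.
move=> mX X1; apply: ae_foralln => t.
have w1 k w : `|(t <= tau k w)%N%:R : R| <= 1.
  by case: (_ <= _)%N; rewrite ?normr1 ?normr0.
apply: (mdiff_avg htau hact (X := fun k w => (t <= tau k w)%N%:R * X k w)).
- apply: (mdiff_weight (D := fun=> 1)) => // k; exact: adapted_tail.
- by move=> k w; rewrite normrM mulr_ile1.
Qed.

(** [rule] is a decision function on all states, visited or not, because convergence is needed at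
    each of them; [ruleE] ties it to the policy at the current state. *)
Lemma ae_tail_cvg :
  {ae P, forall w t, avg (fun k => (t <= tau k w)%N%:R) @ \oo --> tail rs b t}.
Proof.
have /andP[rs0 rs1] := hrs.
have H1 := weighted_mdiff_avg (mdiff_act htau hact hf hlaw) _.
have {}H1 := H1 (fun k w => norm_diff_itv (bool_itv (act k w)) (decision_itv tau act hf k w)).
have S1 k w : `|(act k w)%:R * ((success k w)%:R - rs)| <= 1.
  rewrite normrM; apply: mulr_ile1 => //.
    by case: (act k w); rewrite ?normr1 ?normr0.
  by apply: norm_diff_itv; [exact: bool_itv | rewrite (ltW rs0)].
have H2 := weighted_mdiff_avg (mdiff_success htau hact hrs hlaw) S1.
have H3 := ae_dynamics htau hact hlaw.
have H12 : {ae P, forall w,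
  (forall t, avg (fun k => (t <= tau k w)%N%:R * ((act k w)%:R - rule k w (tau k w))) @ \oo --> (0 : R)) /\
  (forall t, avg (fun k => (t <= tau k w)%N%:R * ((act k w)%:R * ((success k w)%:R - rs))) @ \oo --> (0 : R))}.
  move: H1 H2; apply: filterS2 => w A B; split => // t.
  have := A t; rewrite (_ : (fun k => _ * (_ - decision _ _ _ k w)) =
    (fun k => (t <= tau k w)%N%:R * ((act k w)%:R - rule k w (tau k w)))); first exact.
  by apply/funext => k; rewrite ruleE.
have H45 : {ae P, forall w, (forall t, (fun k => rule k w t) @ \oo --> threshold_rule b rs t) /\
   \forall k \near \oo, forall t, (t0 <= t)%N -> rule k w t = 1}.
  by move: rule_cvg rule_one; apply: filterS2.
move: H12 H3 H45; apply: filterS3 => w [A B] C [D E].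
apply: (occupation_limit (a := fun k => act k w) (q := threshold_rule b rs) hrs _ _ _ _ C A B D E) => //.
- by move=> t; exact: threshold_rule_itv.
- by move=> t; exact: (tail_threshold hrs hb t0_gt lt_t0).
- exact: (tail_above hrs hb t0_gt).
Qed.

Let tail_le1 t : tail rs b t <= 1.
Proof.
have /andP[rs0 rs1] := hrs; have b0 := hb.
elim: t => //= t IH; rewrite ge_max; apply/andP; split.
  have g0 : 0 <= tail rs b t by apply: le_trans (tail_pow b hrs t); rewrite exprn_ge0; lra.
  nra.
by rewrite gerBl mulr_ge0 // mulr_ge0 // ltW.
Qed.

Lemma ae_tau_le_run :
  {ae P, forall w, exists K, forall k, (K <= k)%N -> (tau k w <= t0 + run k w)%N}.
Proof.
have /andP[rs0 rs1] := hrs.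
have H1 := ae_dynamics htau hact hlaw.
have H2 := ae_certain htau hact hlaw.
have H34 : {ae P, forall w, (forall t, avg (fun k => (t <= tau k w)%N%:R) @ \oo --> tail rs b t) /\
   \forall k \near \oo, forall t, (t0 <= t)%N -> rule k w t = 1}.
  by move: ae_tail_cvg rule_one; apply: filterS2.
move: H1 H2 H34; apply: filterS3 => w dyn cert [tl [K0 _ HK0]].
have Kact k : (K0 <= k)%N -> (t0 <= tau k w)%N -> act k w.
  by move=> Kk tk; apply: cert; rewrite ruleE; exact: HK0.
(* If the state stayed above [t0] forever, the frequency of the states above [t0] would be 1,
   whereas its limit is [(1 - rs) * tail t0 < 1]. *)
have [K [K0K Kt0]] : exists K, (K0 <= K)%N /\ (tau K w <= t0)%N.
  apply: contrapT => H.
  have c1 : (fun k => (t0.+1 <= tau k w)%N%:R : R) @ \oo --> (1 : R).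
    apply: cvg_near_cst; exists K0 => // k /= Kk.
    have -> // : (t0.+1 <= tau k w)%N.
    by rewrite ltnNge; apply/negP => Hk; apply: H; exists k.
  have E : tail rs b t0.+1 = 1.
    have /cvg_lim <- // := tl t0.+1; exact/cvg_lim/avg_cvg.
  have := tail_above hrs hb t0_gt (leqnn t0); rewrite E.
  have := tail_le1 t0; nra.
exists K; apply: (tau_le_run dyn Kt0) => k Kk; apply: Kact; exact: leq_trans Kk.
Qed.

Lemma ae_avg_cost_cvg (c : nat -> R) :
  0 <= c 0%N -> (forall t, c t <= c t.+1) ->
  ((tail_cost c (tail rs b) < +oo)%E -> exists p K la : R,
    [/\ 1 - rs <= p, 0 < p, 0 <= K, 1 < la & p * la < 1 /\ forall t, c t <= K * la ^+ t]) ->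
  {ae P, forall w, (fun T => (avg (fun k => c (tau k w)) T)%:E) @ \oo -->
    tail_cost c (tail rs b)}.
Proof.
move=> c0 cS Hgrowth; have /andP[rs0 rs1] := hrs.
have g0 t : 0 <= tail rs b t.
  by apply: le_trans (tail_pow b hrs t); rewrite exprn_ge0; lra.
have Hlo w N : \forall T \near \oo,
    cost_minorant c (fun t => avg (fun k => (t <= tau k w)%N%:R)) N T <= avg (fun k => c (tau k w)) T.
  near=> T; rewrite (cost_minorant_avg c (tau^~ w)); last by near: T; exact: nbhs_infty_gt.
  by apply: le_avg => k _; exact: cost_truncated_le.
have [Joo|Jfin] := eqVneq (tail_cost c (tail rs b)) +oo%E.
  apply: filterS ae_tail_cvg => w Hw; rewrite Joo.
  apply: (tail_cost_pinfty_cvg g0 cS _ (Hlo w) Joo) => t e e0.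
  have /cvgrPdistC_le /(_ _ e0) := Hw t; apply: filterS => T.
  by rewrite ler_norml => /andP[]; lra.
have {}Jfin : (tail_cost c (tail rs b) < +oo)%E by rewrite ltey.
have [p [K [la [rsp p0 K0 la1 [pla cK]]]]] := Hgrowth Jfin.
(* Strictly between [la] and [1/p]: moments of base [la'] are still controlled, and [la / la' < 1]
   makes the truncation error vanish. *)
pose la' := (la + p^-1) / 2.
have lap : la < p^-1 by rewrite -(ltr_pM2l p0) divff ?gt_eqF.
have lala' : la < la' by rewrite /la'; lra.
have la'1 : 1 < la' by lra.
have pla' : p * la' < 1 by rewrite -(divff (lt0r_neq0 p0)) ltr_pM2l // /la'; lra.
have Hrun := ae_failure_run_avg htau hact hrs hf hlaw rsp p0 la'1 pla'.
move: ae_tail_cvg ae_tau_le_run Hrun; apply: filterS3 => w tl [K1 HK1] [C HC].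
have la'0 : 0 <= la' by lra.
(* Covers the finitely many times at which the state is not yet dominated by the run. *)
pose W := \sum_(k < K1) la' ^+ tau k w.
have W0 : 0 <= W by apply: sumr_ge0 => k _; rewrite exprn_ge0.
pose B := la' ^+ t0 * C + W.
have HB : \forall T \near \oo, avg (fun k => la' ^+ tau k w) T <= B.
  near=> T; have T0 : (0 < T)%N by near: T; exact: nbhs_infty_gt.
  apply: (@le_trans _ _ (avg (fun k => la' ^+ t0 * la' ^+ run k w + W) T)).
    apply: le_avg => k _; have [Kk|kK] := leqP K1 k.
      rewrite -exprD; apply: (@le_trans _ _ (la' ^+ (t0 + run k w))); last by rewrite lerDl.
      by rewrite ler_weXn2l ?(ltW la'1) // HK1.
    rewrite -[leLHS]add0r lerD //; first by rewrite mulr_ge0 // exprn_ge0.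
    by rewrite /W (bigD1 (Ordinal kK)) //= lerDl sumr_ge0 // => i _; rewrite exprn_ge0.
  rewrite avgD avg_cst // avgZ lerD2r; apply: ler_wpM2l; first by rewrite exprn_ge0.
  by near: T.
apply: (tail_cost_cvg g0 cS (K := K * B) (rho := la / la') tl (Hlo w)) => //.
  by apply/andP; split; [apply: divr_ge0 | rewrite ltr_pdivrMr ?mul1r]; lra.
move=> N; near=> T; have T0 : (0 < T)%N by near: T; exact: nbhs_infty_gt.
rewrite (cost_minorant_avg c (tau^~ w)) //.
have HBT : avg (fun k => la' ^+ tau k w) T <= B by near: T.
have r0 : 0 <= K * (la / la') ^+ N.
  by rewrite mulr_ge0 // exprn_ge0 // divr_ge0 //; lra.
rewrite mulrAC; apply: le_trans (lerD (lexx _) (ler_wpM2l r0 HBT)).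
rewrite -avgZ -avgD; apply: le_avg => k _.
apply: cost_le_truncated => //; last by lra.
by apply/andP; split; lra.
Unshelve. all: by end_near.
Qed.

End AlmostSure.

Section Expected.
Hypothesis rule_fixed : forall k w t, rule k w t = threshold_rule b rs t.

Let rule_cvg : {ae P, forall w t,
  (fun k => rule k w t) @ \oo --> threshold_rule b rs t}.
Proof. by apply: aeW => w t; under eq_fun do rewrite rule_fixed; exact: cvg_cst. Qed.

Let rule_one k w t : (t0 <= t)%N -> rule k w t = 1.
Proof.
have /andP[rs0 _] := hrs.
move=> tt; rewrite rule_fixed threshold_rule1 //.
by apply: (le_trans (ltW t0_gt)); rewrite ler_nat.
Qed.

Let tail_ae : {ae P, forall w t, avg (fun k => (t <= tau k w)%N%:R) @ \oo --> tail rs b t}.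
Proof.
apply: ae_tail_cvg => //; apply: aeW => w; apply: nearW => k t; exact: rule_one.
Qed.

Let tau_le : {ae P, forall w k, (tau k w <= t0 + run k w)%N}.
Proof.
move: (ae_start htau hlaw) (ae_dynamics htau hact hlaw) (ae_certain htau hact hlaw).
apply: filterS3 => w st dyn cert k.
apply: (tau_le_run (K := 0%N) dyn) => //; first by rewrite st.
by move=> j _ tj; apply: cert; rewrite ruleE; exact: rule_one.
Qed.

Let tau_le_time : {ae P, forall w k, (tau k w <= k)%N}.
Proof.
move: (ae_start htau hlaw) (ae_dynamics htau hact hlaw).
apply: filterS2 => w st dyn; elim=> [|k IH]; first by rewrite st.
by rewrite dyn; case: (success k w); rewrite // ltnS.
Qed.

Lemma expected_tail_cvg t : avg (fun k => tail_prob tau P k t) @ \oo --> tail rs b t.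
Proof.
pose X T w := avg (fun k => (t <= tau k w)%N%:R : R) T.
have bt k := brv_tail htau hact (R := R) k t.
have bS T : brv (fun w => \sum_(k < T) (t <= tau k w)%N%:R : R).
  exact: (brv_sum (F := fun k w => (t <= tau k w)%N%:R)).
have -> : avg (fun k => tail_prob tau P k t) = fun T => Ex P (X T).
  by apply/funext => T; rewrite /X /avg ExZ // Ex_sum.
apply: (bounded_cvg_Ex (C := 1)).
- by move=> T; exact: brvZ.
- move=> T w; rewrite ger0_norm; last by rewrite mulr_ge0 ?invr_ge0 // sumr_ge0.
  case: T => [|T]; first by rewrite /X /avg invr0 mul0r ler01.
  rewrite -(avg_cst 1 (ltn0Sn T)); apply: le_avg => k _.
  by case: (_ <= _)%N.
- by apply: filterS tail_ae => w; exact.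
Qed.

(** Visits to 0 occur at [rs] times the transmission rate, so the rate tends to [(1 - tail 1) / rs],
    and [tail 1 >= 1 - rs * b]. *)
Lemma expected_rate_le : (limn_esup (fun T : nat =>
  ((T%:R^-1)%:E * 'E_P[fun w => (\sum_(k < T) (act k w)%:R)%R])%E) <= b%:E)%E.
Proof.
have /andP[rs0 rs1] := hrs.
pose rate T := avg (fun k => Ex P (fun w => (act k w)%:R)) T.
have c1 : (fun T => avg (fun k => tail_prob tau P k.+1 1) T - avg (fun k => tail_prob tau P k 1) T) @ \oo --> (0 : R).
  apply: (avg_shift (u := fun k => tail_prob tau P k 1) (C := 1)) => k.
  have := tail_prob_itv htau hact (R := R) P k 1; rewrite ler_norml => /andP[? ?].
  by apply/andP; split; lra.
have c2 : rate @ \oo --> (1 - tail rs b 1) / rs.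
  have := cvgMl_tmp (a := rs^-1) (cvgB (cvg_cst (1 : R)) (cvgD c1 (expected_tail_cvg (t := 1%N)))).
  rewrite add0r [rs^-1 * _]mulrC => /(_ _ _ _ _) H.
  apply/cvgrPdistC_le => e e0; have /cvgrPdistC_le /(_ _ e0) := H.
  move: (nbhs_infty_gt 0%N); apply: filterS2 => T T0; rewrite !fctE subrK.
  suff -> : rate T = rs^-1 * (1 - avg (fun k => tail_prob tau P k.+1 1) T) by [].
  rewrite -(avg_cst 1 T0) -avgB -avgZ; apply: eq_avg => k.
  by rewrite (tail_prob_success htau hact hrs hlaw) mulKf // gt_eqF.
rewrite (_ : (fun T => _) = (fun T => (rate T)%:E)); last first.
  by apply/funext => T; rewrite (expected_rateE hact).
rewrite (limn_esup_cvg (l := ((1 - tail rs b 1) / rs)%:E)); last first.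
  by apply: cvg_EFin => //; exact: nearW.
rewrite lee_fin ler_pdivrMr // -lerN2 opprB -lerBlDl.
have := tail_ge rs b 1; rewrite mul1r; lra.
Qed.

Lemma expected_cost_eq (c : nat -> R) :
  0 <= c 0%N -> (forall t, c t <= c t.+1) ->
  ((tail_cost c (tail rs b) < +oo)%E -> exists p K la : R,
    [/\ 1 - rs <= p, 0 < p, 0 <= K, 1 < la & p * la < 1 /\ forall t, c t <= K * la ^+ t]) ->
  limn_esup (fun T : nat =>
    ((T%:R^-1)%:E * 'E_P[fun w => (\sum_(k < T) c (tau k w))%R])%E) =
  tail_cost c (tail rs b).
Proof.
move=> c0 cS Hgrowth; have /andP[rs0 rs1] := hrs.
have g0 t : 0 <= tail rs b t.
  by apply: le_trans (tail_pow b hrs t); rewrite exprn_ge0; lra.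
have Jle := feasible_error_ge htau hact hrs hlaw hb c0 cS expected_rate_le.
have [Joo|Jfin] := eqVneq (tail_cost c (tail rs b)) +oo%E.
  (* The lower bound for feasible policies applies to this one, so an infinite [tail_cost] needs no
     further estimate. *)
  by rewrite Joo; apply/eqP; rewrite -leye_eq -Joo.
have {}Jfin : (tail_cost c (tail rs b) < +oo)%E by rewrite ltey.
have [p [K [la [rsp p0 K0 la1 [pla cK]]]]] := Hgrowth Jfin.
pose la' := (la + p^-1) / 2.
have lap : la < p^-1 by rewrite -(ltr_pM2l p0) divff ?gt_eqF.
have lala' : la < la' by rewrite /la'; lra.
have la'1 : 1 < la' by lra.
have pla' : p * la' < 1 by rewrite -(divff (lt0r_neq0 p0)) ltr_pM2l // /la'; lra.
have la'0 : 0 <= la' by lra.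
(* Almost surely tau k <= k, so that the costs may be made bounded. *)
pose Y k w := c (minn (tau k w) k).
have bY k : brv (Y k).
  apply: (adapted_brv htau hact (k := k) (C := c k)).
    by move=> w w' H; rewrite /Y (hist_tau (leqnn _) H).
  move=> w; rewrite ger0_norm; last exact: (cost_ge0 c0 cS).
  exact: (cost_homo cS (geq_minr _ _)).
pose y T := avg (fun k => Ex P (Y k)) T.
rewrite (_ : (fun T => _) = (fun T => (y T)%:E)); last first.
  apply/funext => T; rewrite /y /avg EFinM; congr (_ * _)%E.
  rewrite -Ex_sum // -integral_Ex; last exact: (brv_sum (F := Y)).
  rewrite expectationE; apply: ae_eq_integral => //.
  - apply/measurable_EFinP => _ B mB; rewrite setTI.
    apply: (measurable_adapted htau hact (k := T) (A := fun w => B (\sum_(k < T) c (tau k w)))).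
    move=> w w' H; congr B; apply: eq_bigr => k _.
    by rewrite (hist_tau (ltnW (ltn_ord k)) H).
  - apply/measurable_EFinP.
    exact: (proj1 (@brv_sum _ _ _ T (fun k : 'I_T => Y k) (fun k => bY k))).
  - apply: filterS tau_le_time => w Hw _; congr EFin; apply: eq_bigr => k _.
    by rewrite /Y (minn_idPl (Hw k)).
apply: limn_esup_cvg.
have bs k s : brv (fun w => (c s.+1 - c s) * (s.+1 <= tau k w)%N%:R).
  by apply: brvZ; exact: brv_tail.
pose Z N k w := c 0%N + \sum_(s < N) (c s.+1 - c s) * (s.+1 <= tau k w)%N%:R.
have bZ N k : brv (Z N k).
  apply: brvD; first exact: brv_cst.
  by apply: (brv_sum (F := fun s w => (c s.+1 - c s) * (s.+1 <= tau k w)%N%:R)) => s.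
have EZ N k : Ex P (Z N k) = c 0%N + \sum_(s < N) (c s.+1 - c s) * tail_prob tau P k s.+1.
  rewrite ExD; [|exact: brv_cst|exact: (brv_sum (F := fun s w => (c s.+1 - c s) * (s.+1 <= tau k w)%N%:R))].
  rewrite Ex_cst Ex_sum //; congr (_ + _); apply: eq_bigr => s _.
  by rewrite ExZ //; exact: brv_tail.
have mE N T : (0 < T)%N ->
    cost_minorant c (fun t => avg (fun k => tail_prob tau P k t)) N T = avg (fun k => Ex P (Z N k)) T.
  move=> T0; rewrite (eq_avg (EZ N)) avgD avg_cst // avg_sum /cost_minorant.
  by congr (_ + _); apply: eq_bigr => s _; rewrite avgZ.
(* Bounds the moments of base [la'] of the state, through its domination by [t0] plus the run. *)
pose B := la' ^+ t0 * (1 - p * la')^-1.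
apply: (tail_cost_cvg g0 cS (K := K * B) (rho := la / la') (@expected_tail_cvg)) => //.
- move=> N; near=> T; rewrite mE; last by near: T; exact: nbhs_infty_gt.
  apply: le_avg => k _; apply: le_Ex_ae => //.
  apply: filterS tau_le_time => w Hw; rewrite /Y (minn_idPl (Hw k)).
  exact: cost_truncated_le.
- by apply/andP; split; [apply: divr_ge0 | rewrite ltr_pdivrMr ?mul1r]; lra.
move=> N; near=> T; have T0 : (0 < T)%N by near: T; exact: nbhs_infty_gt.
rewrite mE // -[X in _ <= _ + X](avg_cst _ T0) -avgD; apply: le_avg => k _.
have r0 : 0 <= K * (la / la') ^+ N.
  by rewrite mulr_ge0 // exprn_ge0 // divr_ge0 //; lra.
have bU := brv_failure_run htau hact k (ltW la'1).
pose V w := K * (la / la') ^+ N * (la' ^+ t0 * la' ^+ run k w).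
have bV : brv V by apply: brvZ; exact: brvZ.
apply: (@le_trans _ _ (Ex P (fun w => Z N k w + V w))).
  apply: le_Ex_ae => //; first exact: brvD.
  move: tau_le_time tau_le; apply: filterS2 => w Hw Hw2; rewrite /Y (minn_idPl (Hw k)).
  apply: (le_trans (cost_le_truncated c0 cS (tau k w) N (la' := la') K0 _ _ cK)).
  - by apply/andP; split; lra.
  - lra.
  rewrite lerD2l /V; apply: ler_wpM2l => //.
  by rewrite -exprD ler_weXn2l ?(ltW la'1) //.
rewrite ExD // lerD2l /V ExZ; last exact: brvZ.
rewrite ExZ // [leRHS]mulrAC; apply: ler_wpM2l => //.
rewrite /B; apply: ler_wpM2l; first by rewrite exprn_ge0.
exact: (Ex_failure_run htau hact hrs hf hlaw k rsp (ltW la'1) pla').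
Unshelve. all: by end_near.
Qed.

End Expected.
End ConvergentRules.

(** * The learning policy *)

Section CountLimit.

Lemma cnt_homo (B : nat -> bool) j k : (j <= k)%N -> (cnt B j <= cnt B k)%N.
Proof.
elim: k => [|k IH]; first by rewrite leqn0 => /eqP ->.
rewrite leq_eqVlt => /orP[/eqP ->//|]; rewrite ltnS => /IH /leq_trans; apply.
exact: cnt_nondecreasing.
Qed.

Lemma cnt_cvg (B : nat -> bool) : (forall K, exists2 k, (K <= k)%N & B k) ->
  cnt B @ \oo --> \oo.
Proof.
move=> HB; have unb n : exists K, (n <= cnt B K)%N.
  elim: n => [|n [K HK]]; first by exists 0%N.
  have [k Kk Bk] := HB K; exists k.+1.
  by rewrite /cnt big_ord_recr /= Bk addn1 ltnS (leq_trans HK) // cnt_homo.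
move=> A [N _ NA]; have [K HK] := unb N; exists K => // k /= Kk.
by apply: NA; rewrite /= (leq_trans HK) // cnt_homo.
Qed.

End CountLimit.

Section LearningRule.
Variables (R : realType) (b : R).
Hypothesis hb : 0 < b.

Lemma mle_gt0 (ns nf : nat) : (0 < ns)%N -> 0 < mle R ns nf.
Proof.
by move=> ns0; rewrite /mle divr_gt0 ?ltr0n // -natrD ltr0n addn_gt0 ns0.
Qed.

Lemma learned_rule_itv k (s : k.+1.-tuple nat) (u : k.-tuple bool) t :
  0 <= learned_rule b s u t <= 1.
Proof.
rewrite /learned_rule; case: eqP => [_|/eqP]; first by rewrite ler01 lexx.
by rewrite -lt0n => /mle_gt0 ns0; exact: threshold_rule_itv.
Qed.

Lemma admissible_learning : admissible (learning_policy b).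
Proof. by move=> k s u; exact: learned_rule_itv. Qed.

Lemma learned_rule_eventually1 k (s : k.+1.-tuple nat) (u : k.-tuple bool) :
  exists T, forall t, (T <= t)%N -> learned_rule b s u t = 1.
Proof.
rewrite /learned_rule; case: eqP => [_|/eqP]; first by exists 0%N.
rewrite -lt0n => ns0; have m0 := mle_gt0 (nb_failure s u) ns0.
have [T _ HT] := nbhs_infty_ger ((b^-1 - 1) / mle R (nb_success s u) (nb_failure s u)).
by exists T => t /HT Ht; rewrite threshold_rule1.
Qed.

(** Turns convergence of the estimated thresholds into convergence of the rules. *)
Lemma clamp_dist (x y : R) :
  `|Num.min 1 (Num.max 0 x) - Num.min 1 (Num.max 0 y)| <= `|x - y|.
Proof.
have E (z : R) : Num.min 1 (Num.max 0 z) = if z <= 0 then 0 else if z <= 1 then z else 1.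
  case: (leP z 0) => z0; first by rewrite (min_idPr ler01).
  by case: (leP z 1).
rewrite !E; have := ler_norm (x - y); have := ler_norm (y - x); rewrite (distrC y).
move: `|x - y| => D H1 H2; rewrite ler_norml.
case: (leP x 0) => ?; case: (leP y 0) => ?; try case: (leP x 1) => ?; try case: (leP y 1) => ?;
  apply/andP; split; lra.
Qed.

End LearningRule.

Section Learning.
Context {d : measure_display} {Omega : measurableType d} {R : realType}.
Variables (tau : nat -> Omega -> nat) (act : nat -> Omega -> bool).
Hypothesis htau : forall k, measurable_fun setT (tau k).
Hypothesis hact : forall k, measurable_fun setT (act k).
Variables (rs b : R) (P : probability Omega R).
Hypotheses (hrs : 0 < rs <= 1) (hb : 0 < b).
Hypothesis hlaw : is_policy_law tau act rs (learning_policy b) P.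

Local Notation success := (succeeds tau act).
Local Notation failure := (fails tau act).

Let ns k w := nb_success (tau_hist tau k w) (act_hist act k w).
Let nf k w := nb_failure (tau_hist tau k w) (act_hist act k w).

Definition learned k w := learned_rule b (tau_hist tau k w) (act_hist act k w).

Lemma learned_decision k w :
  decision tau act (learning_policy b) k w = learned k w (tau k w).
Proof. by rewrite /decision /learning_policy tnth_mktuple. Qed.

Let nsE k w : ns k w = cnt (success^~ w) k.
Proof.
rewrite /ns /nb_success /cnt; apply: eq_bigr => j _.
by rewrite !tnth_mktuple lift0.
Qed.

Let nfE k w : nf k w = cnt (failure^~ w) k.
Proof.
rewrite /nf /nb_failure /cnt; apply: eq_bigr => j _.
by rewrite !tnth_mktuple lift0.
Qed.

Let nsfE k w : (ns k w + nf k w)%N = cnt (act^~ w) k.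
Proof.
rewrite nsE nfE /cnt -big_split; apply: eq_bigr => j _ /=.
by rewrite /succeeds /fails; case: (act j w); case: (tau j.+1 w == 0)%N.
Qed.

(* If transmissions stopped, the estimate would be frozen while the state grew
   past its threshold. *)
Lemma ae_transmissions_unbounded : {ae P, forall w, cnt (act^~ w) @ \oo --> \oo}.
Proof.
move: (ae_dynamics htau hact hlaw) (ae_certain htau hact hlaw).
apply: filterS2 => w dyn cert; apply: cnt_cvg => K; apply: contrapT => H.
have noact k : (K <= k)%N -> act k w = false.
  by move=> Kk; apply/negP => ak; apply: H; exists k.
have frozen i : [/\ ns (K + i) w = ns K w, nf (K + i) w = nf K w &
    tau (K + i) w = (tau K w + i)%N].
  elim: i => [|i [IH1 IH2 IH3]]; first by rewrite !addn0.
  have na := noact (K + i)%N (leq_addr _ _).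
  split.
  - by rewrite -IH1 addnS !nsE {1}/cnt big_ord_recr /= /succeeds na addn0.
  - by rewrite -IH2 addnS !nfE {1}/cnt big_ord_recr /= /fails na addn0.
  - by rewrite addnS dyn /succeeds na /= IH3 addnS.
have [T HT] := learned_rule_eventually1 hb (tau_hist tau K w) (act_hist act K w).
have [F1 F2 F3] := frozen T.
have : act (K + T)%N w.
  apply: cert; rewrite learned_decision /learned /learned_rule.
  rewrite -/(ns (K + T) w) -/(nf (K + T) w) F1 F2 F3.
  by apply: HT; exact: leq_addl.
by rewrite noact // leq_addr.
Qed.

(** The estimation error is exactly a sum of centred successes divided by the number of
    transmissions. *)
Lemma ae_mle_cvg : {ae P, forall w, (fun k => mle R (ns k w) (nf k w)) @ \oo --> rs}.
Proof.
have mX := mdiff_success htau hact hrs hlaw.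
have aB k : adapted tau act k.+1 (act k) by exact: adapted_act.
have XB k w : `|(act k w)%:R * ((success k w)%:R - rs)| <= (act k w)%:R.
  have /andP[rs0 rs1] := hrs.
  case: (act k w); last by rewrite mul0r normr0.
  by rewrite mul1r; apply: norm_diff_itv; [exact: bool_itv | rewrite (ltW rs0)].
have := mdiff_lln htau hact mX aB XB.
move: ae_transmissions_unbounded; apply: filterS2 => w cntoo /(_ cntoo) H.
apply/cvgrPdistC_le => e e0; have /cvgrPdistC_le /(_ _ e0) := H.
have cnt0 : \forall k \near \oo, (0 < cnt (act^~ w) k)%N.
  by have := cntoo _ (nbhs_infty_gt 0%N).
move: cnt0; apply: filterS2 => k k0; rewrite subr0.
suff -> : (cnt (act^~ w) k)%:R^-1 * (\sum_(k0 < k) (act k0 w)%:R * ((success k0 w)%:R - rs)) =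
  mle R (ns k w) (nf k w) - rs by [].
have c0 : (cnt (act^~ w) k)%:R != 0 :> R by rewrite pnatr_eq0 -lt0n.
rewrite /mle -natrD nsfE.
have -> : \sum_(k0 < k) (act k0 w)%:R * ((success k0 w)%:R - rs) =
    (ns k w)%:R - rs * (cnt (act^~ w) k)%:R.
  rewrite nsE /cnt !natr_sum mulr_sumr -sumrB; apply: eq_bigr => j _.
  by rewrite /succeeds; case: (act j w); case: (tau j.+1 w == 0)%N => /=; ring.
by field.
Qed.

(** The estimate is 0 as long as there is no success, so a positive limit ends the initialization
    phase. *)
Let ns_pos w : (fun k => mle R (ns k w) (nf k w)) @ \oo --> rs ->
  \forall k \near \oo, (0 < ns k w)%N.
Proof.
have /andP[rs0 _] := hrs.
move=> /cvgr_gt /(_ _ rs0); apply: filterS => k.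
by case: (ns k w) => //; rewrite /mle mul0r ltxx.
Qed.

Let threshold_cvg w : (fun k => mle R (ns k w) (nf k w)) @ \oo --> rs ->
  (fun k => (b^-1 - 1) / mle R (ns k w) (nf k w)) @ \oo --> (b^-1 - 1) / rs.
Proof.
have /andP[rs0 _] := hrs.
by move=> H; apply: cvgMl_tmp; apply: cvgV => //; rewrite gt_eqF.
Qed.

Lemma ae_learned_cvg :
  {ae P, forall w t, (fun k => learned k w t) @ \oo --> threshold_rule b rs t}.
Proof.
have /andP[rs0 _] := hrs.
apply: filterS ae_mle_cvg => w Hm t.
apply/cvgrPdistC_le => e e0; have /cvgrPdistC_le /(_ _ e0) := threshold_cvg Hm.
move: (ns_pos Hm); apply: filterS2 => k k0 Hk.
rewrite /learned /learned_rule -/(ns k w) -/(nf k w) eqn0Ngt k0 /=.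
have m0 : 0 < mle R (ns k w) (nf k w) by exact: mle_gt0.
rewrite (threshold_ruleE hb _ m0) (threshold_ruleE hb _ rs0).
apply: (le_trans (clamp_dist _ _)).
apply: le_trans Hk; rewrite distrC.
by rewrite [X in `|X| <= _](_ : _ = (b^-1 - 1) / mle R (ns k w) (nf k w) - (b^-1 - 1) / rs) //; ring.
Qed.

Lemma ae_learned_one (t0 : nat) : (b^-1 - 1) / rs < t0%:R ->
  {ae P, forall w, \forall k \near \oo, forall t, (t0 <= t)%N -> learned k w t = 1}.
Proof.
move=> xt0; apply: filterS ae_mle_cvg => w Hm.
have /cvgr_lt /(_ _ xt0) Hlt := threshold_cvg Hm.
move: (ns_pos Hm) Hlt; apply: filterS2 => k k0 Hk t tt.
rewrite /learned /learned_rule -/(ns k w) -/(nf k w) eqn0Ngt k0 /=.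
rewrite threshold_rule1 ?mle_gt0 //.
by apply: (le_trans (ltW Hk)); rewrite ler_nat.
Qed.

End Learning.

(** * Optimality and convergence *)

Section FiniteCost.
Variable R : realType.

Lemma tail_cost_terms_cvg0 (c g : nat -> R) :
  (forall t, 0 <= g t) -> (forall t, c t <= c t.+1) ->
  (tail_cost c g < +oo)%E -> (fun t => (c t.+1 - c t) * g t.+1) @ \oo --> (0 : R).
Proof.
move=> g0 cS; rewrite /tail_cost; set S := (\sum_(0 <= t <oo) _)%E => fin.
have term0 t : 0 <= (c t.+1 - c t) * g t.+1 by rewrite mulr_ge0 // subr_ge0.
have S0 : (0 <= S)%E by apply: nneseries_ge0 => t _ _; rewrite lee_fin.
have SE : S = (fine S)%:E.
  by rewrite fineK // ge0_fin_numE //; move: fin S0; case: (S) => // r _ _; exact: ltry.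
apply: cvg_series_cvg_0; apply: nondecreasing_is_cvgn.
  apply/nondecreasing_seqP => n; rewrite /series /= big_nat_recr //= lerDl.
  exact: term0.
exists (fine S) => _ [n _ <-].
rewrite -lee_fin -SE /series /= -sumEFin; apply: nneseries_lim_ge => t _ _.
by rewrite lee_fin.
Qed.

(** Convergence of the series bounds the increments through [tail t >= (1 - rs)^t], and their
    recurrence improves this to a strict exponential margin. *)
Lemma finite_cost_growth (rs b : R) (N : nat) (a : 'I_N.+1 -> R) (c : nat -> R) :
  0 < rs <= 1 -> (forall t, c t <= c t.+1) ->
  recurrent a (fun t => c t.+1 - c t) ->
  (tail_cost c (tail rs b) < +oo)%E -> exists p K la : R,
    [/\ 1 - rs <= p, 0 < p, 0 <= K, 1 < la & p * la < 1 /\ forall t, c t <= K * la ^+ t].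
Proof.
move=> hrs cS rec fin; have /andP[rs0 rs1] := hrs.
suff [p rsp [p01 pc]] : exists2 p : R, 1 - rs <= p &
    0 < p < 1 /\ (fun t => p ^+ t * (c t.+1 - c t)) @ \oo --> (0 : R).
  have [K [la [K0 la1 pla cK]]] := recurrent_sum_growth rec p01 pc.
  by exists p, K, la; split => //; have /andP[] := p01.
(* For [rs = 1] the tail gives no information on the increments; the crude growth bound of recurrent
   sequences provides some [p > 0]. *)
have [rsE|rsN] := eqVneq rs 1.
  have [p p01 pc] := recurrent_scale_cvg0 rec.
  by exists p => //; rewrite rsE subrr; have /andP[/ltW] := p01.
have rsl : rs < 1 by rewrite lt_neqAle rsN.
have p0 : 0 < 1 - rs by lra.
exists (1 - rs) => //; split; first by rewrite p0 /=; lra.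
have g0 t : 0 <= tail rs b t.
  by apply: le_trans (tail_pow b hrs t); rewrite exprn_ge0 // ltW.
have := cvgMl_tmp (a := (1 - rs)^-1) (tail_cost_terms_cvg0 g0 cS fin).
rewrite mulr0 => /(_ _) H.
apply: (@squeeze_cvgr _ _ _ _ (fun=> 0)
  (fun t => (1 - rs)^-1 * ((c t.+1 - c t) * tail rs b t.+1))); [|exact: cvg_cst|exact: H].
near=> t; have e0 : 0 <= c t.+1 - c t by rewrite subr_ge0.
apply/andP; split; first by rewrite mulr_ge0 // exprn_ge0 // ltW.
rewrite ler_pdivlMl // mulrA -exprS mulrC; apply: ler_wpM2l => //.
exact: tail_pow.
Unshelve. all: by end_near.
Qed.

End FiniteCost.

(** Convergence of the policy is that of its transmission probability at every state. The average
    error converges in the extended reals, which includes an infinite optimum. *)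
Theorem theorem5 (R : realType) (n m : nat)
    (A : 'M[R]_n) (C : 'M[R]_(m, n)) (Sw Pi sqrtSw : 'M[R]_n) (Sv : 'M[R]_m)
    (hSw : psd Sw) (hPi : psd Pi) (hSv : posdef Sv)
    (hAC : detectable A C)
    (hsqrt : is_sqrtmx sqrtSw Sw) (hASw : stabilizable A sqrtSw)
    (Pbar : 'M[R]_n) (hPbar : is_steady_state_cov A C Sw Sv Pi Pbar)
    (rs b : R) (hrs : 0 < rs <= 1) (hb : 0 < b)
    (d : measure_display) (Omega : measurableType d)
    (tau : nat -> Omega -> nat) (act : nat -> Omega -> bool)
    (htau : forall k, measurable_fun setT (tau k))
    (hact : forall k, measurable_fun setT (act k))
    (PP : policy R -> probability Omega R)
    (hPP : forall f, admissible f -> is_policy_law tau act rs f (PP f)) :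
  let c := fun t : nat => \tr (remote_cov A Sw Pbar t) in
  optimal_policy tau act PP c b (stationary (threshold_rule b rs)) /\
  {ae PP (learning_policy b), forall w, forall t : nat,
     learned_rule b (tau_hist tau k w) (act_hist act k w) t @[k --> \oo]
       --> threshold_rule b rs t} /\
  {ae PP (learning_policy b), forall w,
     (T%:R^-1 * \sum_(k < T) c (tau k w))%:E @[T --> \oo]
       --> optimal_error tau act PP c b}.
Proof.
move=> c; have /andP[rs0 rs1] := hrs.
have c0 : 0 <= c 0%N.
  exact: (remote_cov_trace0 A Sw (steady_state_nneg hSw hPi hSv hPbar)).
have cS t : c t <= c t.+1.
  apply: remote_cov_trace_nondecreasing.
  exact: (steady_state_le_predict hSw hPi hSv hPbar).
have [N [a rec]] := remote_cov_trace_recurrent A Sw Pbar.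
have growth := finite_cost_growth (b := b) hrs cS rec.
have [t0 [t0_gt lt_t0]] := crossing_exists rs b.
pose stat := stationary (threshold_rule b rs).
have astat : admissible stat by move=> k s u; exact: threshold_rule_itv.
have lstat := hPP _ astat.
have Estat k w : decision tau act stat k w = threshold_rule b rs (tau k w).
  by rewrite /decision /stat /stationary tnth_mktuple.
(* The stationary policy is treated as a convergent rule that is constant in time and outcome. *)
pose rstat (k : nat) (w : Omega) := threshold_rule b rs.
have rstatE k w t : rstat k w t = threshold_rule b rs t by [].
have feas : feasible act PP b stat.
  by split => //; exact: (expected_rate_le htau hact hrs astat lstat hb t0_gt lt_t0 Estat rstatE).
have Jstat : avg_error tau PP c stat = tail_cost c (tail rs b).
  exact: (expected_cost_eq htau hact hrs astat lstat hb t0_gt lt_t0 Estat rstatE c0 cS growth).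
have Jopt : optimal_error tau act PP c b = tail_cost c (tail rs b).
  apply/eqP; rewrite eq_le; apply/andP; split.
    by rewrite -Jstat; apply: ereal_inf_lbound; exists stat.
  apply: le_ereal_inf_tmp => _ [f [af rf] <-].
  exact: (feasible_error_ge htau hact hrs (hPP _ af) hb c0 cS rf).
have alearn := admissible_learning hb.
have llearn := hPP _ alearn.
have cvg_rule := ae_learned_cvg htau hact hrs hb llearn.
split; first by split => //; rewrite Jstat Jopt.
split => //; rewrite Jopt.
exact: (ae_avg_cost_cvg htau hact hrs alearn llearn hb t0_gt lt_t0
  (learned_decision tau act b) cvg_rule (ae_learned_one htau hact hrs hb llearn t0_gt)
  c0 cS growth).
Qed.
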